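(* Let $p\ge1$ be a fixed integer. For each $n>p$, let $(\theta_1,\dots,\theta_{n-p})$ be random with law $$\mathrm{cst}\,\prod_{1\le k<l\le n-p}|e^{i\theta_k}-e^{i\theta_l}|^2\prod_{j=1}^{n-p}|1-e^{i\theta_j}|^{2p}\,d\theta_1\cdots d\theta_{n-p}$$ on $(-\pi,\pi)^{n-p}$ (the spectral law of the Haar measure on $U(n)$ conditioned to have $p$ eigenvalues equal to $1$), and let $Z_U^{(p)}=p!\prod_{k=1}^{n-p}(1-e^{i\theta_k})$ be the $p$-th derivative of the characteristic polynomial at $1$. Then, as $n\to\infty$, $$\frac{\log Z_U^{(p)}-p\log n}{\sqrt{\log n}}\ \xrightarrow{\text{law}}\ \frac{1}{\sqrt2}(\mathcal N_1+i\mathcal N_2),$$ with $\mathcal N_1$ and $\mathcal N_2$ independent standard (real) normal variables.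
   Context: $\mathrm{cst}$ is the normalization constant. The characteristic polynomial is $\det(x\,\mathrm{Id}-u)=(x-1)^p\prod_{k=1}^{n-p}(x-e^{i\theta_k})$. The complex logarithm is determined by continuity along $x\in(0,1)$: $\log Z_U^{(p)}=\log(p!)+\lim_{x\to1^-}\sum_{k=1}^{n-p}\log(1-xe^{i\theta_k})$, where each $\log(1-xe^{i\theta_k})$ is continuous in $x\in[0,1)$ and vanishes at $x=0$ (i.e. $\log Z_U^{(p)}=\log(p!)+\sum_k\log(1-e^{i\theta_k})$ with the principal logarithm, of imaginary part in $(-\pi/2,\pi/2)$). *)

(* Defs.v *)
From HB Require Import structures.
From mathcomp Require Import all_boot all_order all_algebra.
From mathcomp Require Import complex ring.
From mathcomp Require Import all_classical all_reals all_analysis.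
Set Implicit Arguments.
Unset Strict Implicit.
Unset Printing Implicit Defensive.
Import Order.TTheory GRing.Theory Num.Theory.
Import numFieldNormedType.Exports.
Import ComplexField.Normc.
Local Open Scope ring_scope.
Local Open Scope complex_scope.
Local Open Scope classical_set_scope.

Section complex_functions.
Context {R : realType}.
Implicit Types (z : R[i]) (x y t : R).

Definition expi t : R[i] := cos t +i* sin t.

Definition cexp z : R[i] := (expR (complex.Re z))%:C * expi (complex.Im z).

(* Principal argument: in ]-pi, pi] for z != 0. *)
Definition carg z : R :=
  let a := acos (complex.Re z / normc z) in
  if 0 <= complex.Im z then a else - a.

Definition clog z : R[i] := ln (normc z) +i* carg z.

End complex_functions.

Section law.
Context {R : realType}.
Local Open Scope ereal_scope.

(* The iterated Lebesgue integral
   \int_(]-pi, pi[) ... \int_(]-pi, pi[) f [:: t_1; ...; t_m] dt_m ... dt_1;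
   it is only used for nonnegative measurable functions, for which it is the
   integral over ]-pi, pi[^m by Tonelli's theorem. *)
Fixpoint box_integral (m : nat) : (m.-tuple R -> \bar R) -> \bar R :=
  match m with
  | 0 => fun f => f [tuple]
  | m'.+1 => fun f =>
      \int[lebesgue_measure]_(x in `](- pi)%R, pi[)
        box_integral (fun t => f [tuple of x :: t])
  end.

Definition spectral_weight (p m : nat) (t : m.-tuple R) : R :=
  ((\prod_(k < m) \prod_(l < m | (k < l)%N)
      normc (expi (tnth t k) - expi (tnth t l)) ^+ 2) *
   \prod_(j < m) normc (1 - expi (tnth t j)) ^+ (2 * p))%R.

(* cst is forced to be the normalization constant, mu being a probability. *)
Definition is_spectral_law (p m : nat) (mu : set (m.-tuple R) -> \bar R) :=
  exists cst : R, forall A : set (m.-tuple R), measurable A ->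
    mu A = cst%:E *
           box_integral (fun t => (\1_A t * spectral_weight p t)%:E).

End law.

Section characteristic_polynomial.
Context {R : realType}.

Definition char_poly_of_angles (p m : nat) (t : m.-tuple R) : {poly R[i]} :=
  ('X - 1%:P) ^+ p * \prod_(k < m) ('X - (expi (tnth t k))%:P).

Definition Zp (p m : nat) (t : m.-tuple R) : R[i] :=
  (p`!)%:R * \prod_(k < m) (1 - expi (tnth t k)).

Definition log_Zp (p m : nat) (t : m.-tuple R) : R[i] :=
  (ln (p`!%:R))%:C + \sum_(k < m) clog (1 - expi (tnth t k)).

End characteristic_polynomial.

Section probability.
Context {R : realType}.

Definition independent_RVs d (T : measurableType d) (P : probability T R)
    (X Y : {RV P >-> R}) : Prop :=
  forall A B : set R, measurable A -> measurable B ->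
    P (X @^-1` A `&` Y @^-1` B) = (P (X @^-1` A) * P (Y @^-1` B))%E.

Definition is_normal d (T : measurableType d) (P : probability T R)
    (m s : R) (X : {RV P >-> R}) : Prop :=
  forall A : set R, measurable A -> distribution P X A = normal_prob m s A.

(* R[i]^o carries the topology of the complex modulus. *)
Definition cvg_in_law (d : nat -> measure_display)
    (T : forall n, measurableType (d n)) (P : forall n, probability (T n) R)
    (X : forall n, T n -> R[i])
    d' (T' : measurableType d') (P' : probability T' R) (Y : T' -> R[i])
    : Prop :=
  forall f : R[i]^o -> R, continuous f ->
    (exists M, forall z, `|f z| <= M) ->
    ('E_(P n)[f \o X n] @[n --> \oo] --> 'E_P'[f \o Y])%E.

End probability.

Section log_Zp_theory.
Context {R : realType}.
Implicit Types (z : R[i]) (x y t : R).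

Lemma normc_gt0 z : 0 < complex.Re z -> 0 < normc z.
Proof.
case: z => a b /= a0; rewrite sqrtr_gt0 ltr_pwDl ?sqr_ge0 ?exprn_gt0//.
Qed.

(* On the right half-plane the principal argument lies in ]-pi/2, pi/2[. *)
Lemma carg_atan z : 0 < complex.Re z ->
  carg z = atan (complex.Im z / complex.Re z).
Proof.
case: z => a b /= a0; rewrite /carg /=.
have -> : a / Num.sqrt (a ^+ 2 + b ^+ 2) = cos (atan (b / a)).
  have -> : a ^+ 2 + b ^+ 2 = a ^+ 2 * (1 + (b / a) ^+ 2).
    by rewrite mulrDr mulr1 -exprMn mulrCA divff ?gt_eqF ?mulr1.
  rewrite cos_atan sqrtrM ?sqr_ge0// sqrtr_sqr gtr0_norm// invfM mulrA.
  by rewrite divff ?gt_eqF ?mul1r.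
have [b0|b0] := leP 0 b.
  rewrite cosK// in_itv/= (le_trans (ltW (atan_ltpi2 _))) ?andbT.
    by rewrite -(@atan0 R) le_atan// divr_ge0// ltW.
  by rewrite ler_pdivrMr// ler_peMr ?pi_ge0// ler1n.
rewrite cosKN ?opprK//.
rewrite (le_trans _ (ltW (atan_gtNpi2 _))) ?lerN2.
  by rewrite -(@atan0 R) le_atan// ltW// pmulr_llt0 ?invr_gt0.
by rewrite ler_pdivrMr// ler_peMr ?pi_ge0// ler1n.
Qed.

Lemma cexp_clog z : 0 < complex.Re z -> cexp (clog z) = z.
Proof.
move=> z0; rewrite /cexp /clog /= carg_atan// lnK ?posrE ?normc_gt0//.
case: z z0 => a b /= a0; rewrite /expi.
have e : a ^+ 2 + b ^+ 2 = a ^+ 2 * (1 + (b / a) ^+ 2).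
  by rewrite mulrDr mulr1 -exprMn mulrCA divff ?gt_eqF ?mulr1.
have s0 : Num.sqrt (1 + (b / a) ^+ 2) != 0.
  by rewrite gt_eqF// sqrtr_gt0 ltr_pwDl// sqr_ge0.
rewrite e sqrtrM ?sqr_ge0// sqrtr_sqr gtr0_norm//.
have an0 : a != 0 by rewrite gt_eqF.
have -> : sin (atan (b / a)) = b / a * cos (atan (b / a)).
  have := atanK (b / a); rewrite {1}/tan => {2}<-.
  by rewrite divfK// cos_atan invr_eq0.
rewrite cos_atan.
apply/eqP; rewrite eq_complex /= !mul0r subr0 addr0.
apply/andP; split; apply/eqP; first by rewrite -mulrA divff ?mulr1.
rewrite [LHS]mulrC mulrA.
set r := Num.sqrt _ in s0 *; by field; rewrite s0 an0.
Qed.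

Lemma cexpD z w : cexp (z + w) = cexp z * cexp w.
Proof.
rewrite /cexp /expi; case: z w => [a b] [c d] /=.
rewrite expRD cosD sinD; apply/eqP; rewrite eq_complex /= !mul0r !subr0 !addr0.
by apply/andP; split; apply/eqP; ring.
Qed.

Lemma cexp0 : cexp (0 : R[i]) = 1.
Proof.
rewrite /cexp /expi /= expR0 cos0 sin0.
by apply/eqP; rewrite eq_complex /= !(mul0r, mulr0, subr0, addr0, mulr1) !eqxx.
Qed.

Lemma Re_1subM_gt0 x t : - pi < t < pi -> t != 0 -> 0 <= x <= 1 ->
  0 < complex.Re (1 - x%:C * expi t).
Proof.
move=> /andP[tl tr] t0 /andP[x0 x1] /=; rewrite mul0r subr0 subr_gt0.
have ct : cos t < 1.
  have -> : cos t = cos `|t| by case: (ger0P t) => // _; rewrite cosN.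
  rewrite -(@cos0 R) ltr_cos ?normr_gt0// in_itv/= ?lexx ?pi_ge0//.
  by rewrite normr_ge0 ltW// ltr_norml tl.
have [->|xn0] := eqVneq x 0; first by rewrite mul0r.
have xp : 0 < x by rewrite lt_neqAle eq_sym xn0.
by rewrite (lt_le_trans _ x1)// gtr_pMr.
Qed.

Lemma cexp_log_Zp (p m : nat) (t : m.-tuple R) :
  (forall k, - pi < tnth t k < pi) -> (forall k, tnth t k != 0) ->
  cexp (log_Zp p t) = Zp p t.
Proof.
move=> tpi t0; rewrite /log_Zp /Zp cexpD; congr (_ * _).
  rewrite /cexp /expi /= lnK ?posrE ?ltr0n ?fact_gt0// cos0 sin0.
  rewrite -(rmorph_nat (real_complex R)).
  by apply/eqP; rewrite eq_complex /= !(mul0r, mulr0, subr0, addr0, mulr1) !eqxx.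
rewrite (big_morph _ cexpD cexp0); apply: eq_bigr => k _.
rewrite cexp_clog//.
by have := @Re_1subM_gt0 1 _ (tpi k) (t0 k); rewrite mul1r; apply; rewrite ler01 lexx.
Qed.

Lemma clog1 : clog (1 : R[i]) = 0.
Proof.
rewrite /clog normc1 ln1 carg_atan//= mul0r atan0.
by apply/eqP; rewrite eq_complex /= !eqxx.
Qed.

(* With clog1, clog (1 - x e^(it)) is the branch of the logarithm that is
   continuous on [0, 1] and vanishes at x = 0. *)
Lemma clog_1subM_continuous x t : - pi < t < pi -> t != 0 -> 0 <= x <= 1 ->
  {for x, continuous (fun y => complex.Re (clog (1 - y%:C * expi t)))} /\
  {for x, continuous (fun y => complex.Im (clog (1 - y%:C * expi t)))}.
Proof.
move=> tpi t0 x01; have := Re_1subM_gt0 tpi t0 x01.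
set re := fun y : R => complex.Re (1 - y%:C * expi t).
set im := fun y : R => complex.Im (1 - y%:C * expi t).
have cre : continuous re.
  move=> y; have -> : re = (fun y => 1 - y * cos t).
    by apply/funext => u; rewrite /re /= mul0r subr0.
  by apply: cvgB; [exact: cvg_cst|apply: cvgM; [exact: cvg_id|exact: cvg_cst]].
have cim : continuous im.
  move=> y; have -> : im = (fun y => 0 - y * sin t).
    by apply/funext => u; rewrite /im /= mul0r addr0.
  by apply: cvgB; [exact: cvg_cst|apply: cvgM; [exact: cvg_id|exact: cvg_cst]].
rewrite -/(re x) => rex; split.
- have -> : (fun y => complex.Re (clog (1 - y%:C * expi t))) =
    (fun y => ln (Num.sqrt (re y ^+ 2 + im y ^+ 2))) by [].
  apply: continuous_comp; last first.
    apply: continuous_ln.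
    by rewrite sqrtr_gt0 ltr_pwDl ?sqr_ge0 ?exprn_gt0.
  apply: continuous_comp; last exact: sqrt_continuous.
  by apply: cvgD; rewrite !expr2; apply: cvgM; (exact: cre || exact: cim).
- rewrite /prop_for /continuous_at /= carg_atan//.
  have ca : atan (im y / re y) @[y --> x] --> atan (im x / re x).
    apply: (@continuous_comp _ _ _ (fun y => im y / re y) (@atan R)).
      apply: cvgM; first exact: cim.
      by apply: cvgV; [rewrite gt_eqF|exact: cre].
    exact: continuous_atan.
  apply: cvg_trans ca; apply: near_eq_cvg.
  have : \forall y \near x, 0 < re y by exact: (cvgr_gt _ (cre x)).
  by apply: filterS => y ry; rewrite carg_atan.
Qed.

Lemma Zp_derivn (p m : nat) (t : m.-tuple R) :
  Zp p t = (char_poly_of_angles p t)^`(p).[1].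
Proof.
have H (q : {poly R[i]}) : (('X - 1%:P) ^+ p * q)^`(p).[1] = (p`!)%:R * q.[1].
  elim: p q => [|p IH] q; first by rewrite expr0 mul1r fact0 mul1r.
  rewrite derivSn.
  have -> : deriv (('X - 1%:P) ^+ p.+1 * q) =
      ('X - 1%:P) ^+ p * (q *+ p.+1 + ('X - 1%:P) * deriv q) :> {poly R[i]}.
    by rewrite derivM deriv_exp derivXsubC mul1r mulrnAl mulrDr -mulrnAr mulrA -exprSr.
  rewrite IH hornerD hornerMn hornerM hornerXsubC subrr mul0r addr0.
  by rewrite factS natrM mulrnAr -mulrnAl -mulr_natl.
rewrite /char_poly_of_angles H horner_prod; congr (_ * _).
by apply: eq_bigr => k _; rewrite hornerXsubC.
Qed.

End log_Zp_theory.

(* Main.v *)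
(* The joint characteristic function of Re log Z and Im log Z at (xi, eta) is the
   expectation of the product over j of e^(i psi(theta_j)), with
   psi = xi log |1 - z| + eta arg (1 - z).  By Andreief's identity it is a ratio
   of Toeplitz determinants whose symbol is the Fisher-Hartwig singularity
   |1 - z|^(2p) e^(i psi).  Integration by parts gives a two-term recurrence
   (k + b) c_k = (k - 1 - a) c_(k-1) for its Fourier coefficients, where
   a = p + eta/2 + i xi/2 and b = p - eta/2 + i xi/2; row operations then evaluate
   the determinant as c_0^m times a double product of rational factors.  Raising p
   by one multiplies c_0 by an explicit rational factor, which expresses c_0 as an
   infinite product of factors W_i, and the ratio of determinants becomes the limit
   of \prod_(j < m) \prod_(j <= i < N) W_i.  Since
   W_i = exp (kappa / (i(i+1)) + O(delta / i^3)) with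
   kappa = - (xi^2 + eta^2)/4 + i p xi and delta = |xi| + |eta|, this ratio is
   exp (kappa H_m + O(delta)) uniformly in m.  At the scale
   (xi, eta) = (s, t) / sqrt (ln n) it converges, once centred, to
   exp (- (s^2 + t^2)/4), and the continuity theorem for characteristic functions
   concludes.  The latter follows from Bernstein approximation by trigonometric
   polynomials on a large box, tightness being read off Gaussian mixtures of
   characters. *)
Require Import Defs.
From HB Require Import structures.
From mathcomp Require Import all_boot all_order all_algebra all_fingroup.
From mathcomp Require Import zify.
From mathcomp Require Import complex ring lra.
From mathcomp Require Import all_classical all_reals all_analysis.
From mathcomp Require Import measurable_realfun.
Set Implicit Arguments.
Unset Strict Implicit.
Unset Printing Implicit Defensive.
Import Order.TTheory GRing.Theory Num.Theory.
Import numFieldNormedType.Exports.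
Import ComplexField.Normc.
Local Open Scope ring_scope.
Local Open Scope complex_scope.
Local Open Scope classical_set_scope.

(** * Toeplitz determinants *)

(** The coefficients c_k are quotients of Gamma functions, but none is evaluated: the law is
    normalised, so only ratios to the values at (xi, eta) = (0, 0) matter. The recurrence in p
    determines c_0 up to a constant, which is fixed by letting p grow: |1 - z|^(2p) then
    concentrates at z = -1, where e^(i psi) = 2^(i xi), so the ratio of c_0 to its value at (0, 0)
    tends to 2^(i xi). The extra factors 1 + i xi / (i + 1 + 2p) over the block N <= i < 2N have the
    same limit, and the two cancel. The symbol jumps at theta = 0; since p >= 1 the weight vanishes
    there, so integration by parts leaves no boundary term. W_i is compared with 1/(i(i+1)) rather
    than 1/i^2 because its tails telescope to 1/(j+1), whose sum over j < m is exactly H_m. The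
    error delta / i^3 leaves tails of order delta / j^2, which are summable, and delta has order 1 /
    sqrt (ln n). The imaginary part p xi H_m of the exponent is the centring p log n, up to a
    bounded multiple of xi. That c_0 is nonzero at (0, 0) is not computed either: otherwise the
    spectral law could not have total mass 1. *)

Section toeplitz.
Variable F : fieldType.
Implicit Types (a b : F) (c : int -> F).

Definition toeplitz c m : 'M[F]_m := \matrix_(i, j) c (i%:Z - j%:Z).

Lemma prod_mul_diag (m : nat) (d : 'I_m -> F) (M : 'M[F]_m) :
  \det (\matrix_(i, j) (d j * M i j)) = (\prod_j d j) * \det M.
Proof.
have -> : \matrix_(i, j) (d j * M i j) = M *m diag_mx (\row_j d j).
  by apply/matrixP => i j; rewrite mul_mx_diag !mxE mulrC.
rewrite det_mulmx det_diag mulrC; congr (_ * _).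
by apply: eq_bigr => j _; rewrite mxE.
Qed.

(* Subtracting multiples of consecutive rows clears the first column and leaves
   the Toeplitz matrix of k |-> c k - c (k - 1), whose parameters are
   (a + 1, b). *)
Lemma det_toeplitz_step a b c m :
  (forall k : int, (k%:~R + b) * c k = (k%:~R - 1 - a) * c (k - 1)) ->
  (\prod_(i < m) (i.+1%:R + b)) * \det (toeplitz c m.+1) =
  c 0 * (\prod_(i < m) i.+1%:R) * \det (toeplitz (fun k => c k - c (k - 1)) m).
Proof.
move=> rec.
(* Lower bidiagonal: multiplying by [L] on the left keeps row 0 and replaces row i by (i + b) row_i
   - (i - 1 - a) row_(i-1). *)
pose L : 'M[F]_m.+1 := \matrix_(i, j)
  if i == 0 then (j == 0)%:R
  else (i%:R + b) * (i == j)%:R - (i%:R - 1 - a) * (i == j.+1 :> nat)%:R.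
have detL : \det L = \prod_(i < m) (i.+1%:R + b).
  rewrite det_trig.
    rewrite big_ord_recl mxE eqxx mul1r; apply: eq_bigr => i _.
    rewrite mxE /= eqxx /= mulr1 (_ : (_ == _ :> nat) = false) ?mulr0 ?subr0//.
    by rewrite eqn_leq ltnn andbF.
  apply/is_trig_mxP => i j ij; rewrite mxE.
  case: eqP => [i0|/eqP i0].
    by case: eqP => // j0; move: ij; rewrite i0 j0 ltnn.
  rewrite -[i == j]/(i == j :> nat) (ltn_eqF ij) mulr0.
  by rewrite (@ltn_eqF i j.+1) ?mulr0 ?subr0// ltnS ltnW.
have LM (M : 'M[F]_m.+1) (i : 'I_m) j : (L *m M) (lift 0 i) j =
    (i.+1%:R + b) * M (lift 0 i) j - (i%:R - a) * M (widen_ord (leqnSn m) i) j.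
  rewrite mxE (bigD1 (lift 0 i)) //= (bigD1 (widen_ord (leqnSn m) i)) /=; last first.
    by rewrite -(inj_eq val_inj) /= /bump /= add1n ltn_eqF.
  rewrite big1 ?addr0 => [|k /andP[ki kj]]; last first.
    rewrite mxE /= [lift 0 i == k]eq_sym (negPf ki) mulr0 sub0r.
    rewrite (_ : (bump 0 i == k.+1 :> nat) = false) ?mulr0 ?oppr0 ?mul0r//.
    apply/negP => /eqP; rewrite /bump /= add1n => -[e]; case/eqP: kj.
    by apply: val_inj => /=; rewrite e.
  rewrite !mxE /= eqxx /bump /= !add1n eqxx.
  rewrite -(inj_eq val_inj) /= /bump /= add1n.
  rewrite [_ == i.+2]ltn_eqF // [_ == i :> nat]gtn_eqF // mulr1 mulr0 subr0.
  rewrite mulr0 sub0r mulr1 mulNr; congr (_ - _ * _).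
  by rewrite -natr1; ring.
rewrite -detL -det_mulmx (expand_det_col _ 0) big_ord_recl big1 ?addr0 => [|i _].
  have -> : (L *m toeplitz c m.+1) 0 0 = c 0.
    rewrite mxE big_ord_recl big1 => [|i _]; last by rewrite !mxE eqxx mul0r.
    by rewrite !mxE /= mul1r addr0 subrr.
  rewrite -mulrA; congr (_ * _); rewrite /cofactor addn0 expr0 mul1r.
  rewrite -prod_mul_diag; congr (\det _); apply/matrixP => i j; rewrite 2!mxE LM !mxE.
  rewrite !lift0 /=.
  have e1 : i.+1%:Z - j.+1%:Z = i%:Z - j%:Z by rewrite !intS; ring.
  have e2 : i%:Z - j.+1%:Z = i%:Z - j%:Z - 1 by rewrite !intS; ring.
  rewrite e1 e2; have := rec (i%:Z - j%:Z).
  have eA : (i%:Z - j%:Z)%:~R = i%:R - j%:R :> F by rewrite rmorphB.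
  rewrite eA => r.
  rewrite -[i.+1%:R]natr1 -[j.+1%:R]natr1.
  set x := c (_ - _) in r *; set y := c (_ - _ - 1) in r *.
  (* The recurrence at k = i - j turns the new entry into (j + 1) (c k - c (k - 1)), which is the
     column factor split off by [prod_mul_diag]. *)
  rewrite (_ : (i%:R + 1 + b) * x = (i%:R - j%:R + b) * x + (j%:R + 1) * x);
    last by ring.
  by rewrite r; ring.
rewrite LM !mxE lift0 /= !subr0.
have := rec i.+1%:Z; rewrite (_ : i.+1%:Z - 1 = i%:Z); last by rewrite intS; ring.
rewrite -[_%:~R]/(i.+1%:R) => ->.
by rewrite -natr1 [X in X * _](_ : _ = 0) ?mul0r//; ring.
Qed.

(** Each elimination raises a by one, keeps b, and multiplies the zeroth coefficient by (1 + a + b)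
    / (1 + a); the double product collects these factors. *)
Lemma det_toeplitz a b c m :
  (forall k : int, (k%:~R + b) * c k = (k%:~R - 1 - a) * c (k - 1)) ->
  (forall i : nat, i.+1%:R + a != 0) -> (forall i : nat, i.+1%:R + b != 0) ->
  \det (toeplitz c m) = c 0 ^+ m * \prod_(j < m) \prod_(i < j)
    (i.+1%:R * (i.+1%:R + a + b) / ((i.+1%:R + a) * (i.+1%:R + b))).
Proof.
elim: m a c => [|m IH] a c rec a0 b0.
  by rewrite det_mx00 big_ord0 expr0 mulr1.
have pb0 : \prod_(i < m) (i.+1%:R + b) != 0 by apply/prodf_neq0.
apply: (mulfI pb0); rewrite (det_toeplitz_step _ rec).
have a1 : 1 + a != 0 by exact: a0 0%N.
have b1 : 1 + b != 0 by exact: b0 0%N.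
rewrite (IH (a + 1)) => [||i|//]; last first.
- by rewrite addrCA natr1 addrC; exact: a0.
- move=> k; have r1 := rec k; have r2 := rec (k - 1).
  rewrite rmorphB /= in r2.
  rewrite mulrBr r1.
  rewrite (_ : (k%:~R + b) * c (k - 1) = (k%:~R - 1 + b) * c (k - 1) + c (k - 1));
    last by ring.
  by rewrite r2; ring.
have c1 : c 0 - c (0 - 1) = c 0 * ((1 + a + b) / (1 + a)).
  have r : b * c 0 = (- 1 - a) * c (0 - 1) by have := rec 0; rewrite !add0r.
  rewrite sub0r in r *.
  rewrite (_ : 1 + a + b = b + (1 + a)); last by ring.
  apply: (mulIf a1); rewrite -[RHS]mulrA divfK// (_ : c 0 * _ = b * c 0 + c 0 * (1 + a));
    last by ring.
  by rewrite r; ring.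
rewrite c1 [in RHS]big_ord_recl big_ord0 mul1r exprS exprMn.
rewrite [X in X = _](_ : _ = c 0 * c 0 ^+ m * (\prod_(i < m) (i.+1%:R : F) *
  ((1 + a + b) / (1 + a)) ^+ m * \prod_(j < m) \prod_(i < j)
   ((i.+1%:R * (i.+1%:R + (a + 1) + b)) / ((i.+1%:R + (a + 1)) * (i.+1%:R + b)))));
  last by ring.
rewrite [RHS]mulrCA; congr (_ * _).
rewrite (_ : (_ / _) ^+ m = \prod_(i < m) ((1 + a + b) / (1 + a))); last first.
  by rewrite prodr_const card_ord.
rewrite -!big_split /=; apply: eq_bigr => j _; rewrite /bump /= add1n.
(* Returning from a + 1 to a shifts half of the linear factors by one index, so the quotient of the
   two products telescopes. *)
have key (n : nat) : n.+1%:R * ((1 + a + b) / (1 + a)) *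
   (\prod_(i < n) (i.+1%:R * (i.+1%:R + (a + 1) + b) /
      ((i.+1%:R + (a + 1)) * (i.+1%:R + b)))) =
   (n.+1%:R + b) * \prod_(i < n.+1) (i.+1%:R * (i.+1%:R + a + b) /
      ((i.+1%:R + a) * (i.+1%:R + b))).
  elim: n => [|n IHn].
    by rewrite big_ord0 big_ord1 /=; field; rewrite a1 b1.
  rewrite big_ord_recr big_ord_recr /= mulrA.
  have n0 := a0 n.+1; have nb := b0 n.+1; have nb' := b0 n.
  set P := \prod_(i < n) _ in IHn *; set Q := \prod_(i < n.+1) _ in IHn *.
  have IH' : n.+1%:R * ((1 + a + b) / (1 + a)) * P * ((n.+2%:R) *
     ((n.+1%:R + (a + 1) + b) / ((n.+1%:R + (a + 1)) * (n.+1%:R + b)))) =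
     (n.+1%:R + b) * Q * ((n.+2%:R) *
     ((n.+1%:R + (a + 1) + b) / ((n.+1%:R + (a + 1)) * (n.+1%:R + b)))).
    by rewrite IHn.
  have e : n.+1%:R + (a + 1) = n.+2%:R + a by rewrite -[n.+2%:R]natr1; ring.
  rewrite e in IH' *; move: n0 nb nb' IH'; move: (n.+1%:R) (n.+2%:R) => u v n0 nb nb' IH'.
  transitivity (u * ((1 + a + b) / (1 + a)) * P *
       (v * ((v + a + b) / ((v + a) * (u + b))))).
    by field; rewrite a1 n0 nb'.
  rewrite IH'; field; rewrite n0 nb nb' //.
exact: key.
Qed.
End toeplitz.

(** * Complex-valued bounded measurable functions *)

Section complex_norm.
Context {R : realType}.
Implicit Types (z w : R[i]) (x y t : R).

Lemma normc_ge0 z : 0 <= normc z.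
Proof. by case: z => a b; exact: sqrtr_ge0. Qed.

Lemma normc_Re z : `|complex.Re z| <= normc z.
Proof.
case: z => a b /=; rewrite -sqrtr_sqr ler_sqrt ?lerDl ?sqr_ge0//.
by rewrite addr_ge0 ?sqr_ge0.
Qed.

Lemma normc_Im z : `|complex.Im z| <= normc z.
Proof.
case: z => a b /=; rewrite -sqrtr_sqr ler_sqrt ?lerDr ?sqr_ge0//.
by rewrite addr_ge0 ?sqr_ge0.
Qed.

Lemma normc_leD z : normc z <= `|complex.Re z| + `|complex.Im z|.
Proof.
case: z => a b /=; rewrite -[leRHS]ger0_norm ?addr_ge0// -sqrtr_sqr ler_sqrt ?sqr_ge0//.
by rewrite sqrrD !real_normK ?num_real// lerD2r lerDl mulrn_wge0// mulr_ge0.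
Qed.

Lemma normcR x : normc x%:C = `|x|.
Proof. by rewrite /= expr0n addr0 sqrtr_sqr. Qed.

Lemma normcX z n : normc (z ^+ n) = normc z ^+ n.
Proof. by elim: n => [|n IH]; rewrite ?expr0 ?normc1// !exprS normcM IH. Qed.

Lemma normc_expi t : normc (expi t) = 1.
Proof. by rewrite /= cos2Dsin2 sqrtr1. Qed.

Lemma normc_eq0 z : (normc z == 0) = (z == 0).
Proof. by apply/eqP/eqP => [/eq0_normc//|->]; rewrite normc0. Qed.

Lemma expiD x y : expi (x + y) = expi x * expi y :> R[i].
Proof.
by rewrite /expi cosD sinD; apply/eqP; rewrite eq_complex /= eqxx addrC mulrC
  [sin x * _]mulrC eqxx.
Qed.

Lemma expi0 : expi 0 = 1 :> R[i].
Proof. by rewrite /expi cos0 sin0. Qed.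

Lemma expi_sum (I : Type) (r : seq I) (P : pred I) (F : I -> R) :
  expi (\sum_(i <- r | P i) F i) = \prod_(i <- r | P i) expi (F i).
Proof. exact: (big_morph _ expiD expi0). Qed.

Lemma cReM z w : complex.Re (z * w) =
  complex.Re z * complex.Re w - complex.Im z * complex.Im w.
Proof. by case: z w => a b [c e]. Qed.

Lemma cImM z w : complex.Im (z * w) =
  complex.Re z * complex.Im w + complex.Im z * complex.Re w.
Proof. by case: z w => a b [c e]. Qed.

Lemma cReD z w : complex.Re (z + w) = complex.Re z + complex.Re w.
Proof. by case: z w => a b [c e]. Qed.

Lemma cImD z w : complex.Im (z + w) = complex.Im z + complex.Im w.
Proof. by case: z w => a b [c e]. Qed.

Lemma Re_sum (I : Type) (r : seq I) (P : pred I) (F : I -> R[i]) :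
  complex.Re (\sum_(i <- r | P i) F i) = \sum_(i <- r | P i) complex.Re (F i).
Proof. exact: (big_morph _ cReD erefl). Qed.

Lemma Im_sum (I : Type) (r : seq I) (P : pred I) (F : I -> R[i]) :
  complex.Im (\sum_(i <- r | P i) F i) = \sum_(i <- r | P i) complex.Im (F i).
Proof. exact: (big_morph _ cImD erefl). Qed.

Lemma complex_ext z w :
  complex.Re z = complex.Re w -> complex.Im z = complex.Im w -> z = w.
Proof. by case: z w => a b [c e] /= -> ->. Qed.

End complex_norm.

Section complex_cvg.
Context {R : realType}.
Implicit Types (u v : nat -> R[i]) (l k : R[i]).

(** Stated by coordinates so that limit theorems for real sequences apply directly; [ccvg_normc] and
    [normc_ccvg] translate to the modulus. *)
Definition ccvg u l := (complex.Re (u n) @[n --> \oo] --> complex.Re l) /\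
  (complex.Im (u n) @[n --> \oo] --> complex.Im l).

Lemma ccvg_cst l : ccvg (fun=> l) l.
Proof. by split; exact: cvg_cst. Qed.

Lemma ccvgD u v l k : ccvg u l -> ccvg v k -> ccvg (fun n => u n + v n) (l + k).
Proof.
move=> [u1 u2] [v1 v2]; split.
  by under eq_fun do rewrite cReD; rewrite cReD; exact: cvgD.
by under eq_fun do rewrite cImD; rewrite cImD; exact: cvgD.
Qed.

Lemma ccvgM u v l k : ccvg u l -> ccvg v k -> ccvg (fun n => u n * v n) (l * k).
Proof.
move=> [u1 u2] [v1 v2]; split.
  by under eq_fun do rewrite cReM; rewrite cReM; apply: cvgB; exact: cvgM.
by under eq_fun do rewrite cImM; rewrite cImM; apply: cvgD; exact: cvgM.
Qed.

Lemma ccvg_normc u l : normc (u n - l) @[n --> \oo] --> 0 -> ccvg u l.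
Proof.
move=> h.
have h' : - normc (u n - l) @[n --> \oo] --> 0 by rewrite -oppr0; exact: cvgN.
split; apply/subr_cvg0; apply: (squeeze_cvgr _ h' h); apply: nearW => n.
- by rewrite -ler_norml (le_trans _ (normc_Re _))// cReD; case: l {h h'}.
- by rewrite -ler_norml (le_trans _ (normc_Im _))// cImD; case: l {h h'}.
Qed.

Lemma normc_ccvg u l : ccvg u l -> normc (u n - l) @[n --> \oo] --> 0.
Proof.
move=> [/subr_cvg0 h1 /subr_cvg0 h2].
have h : `|complex.Re (u n) - complex.Re l| + `|complex.Im (u n) - complex.Im l|
    @[n --> \oo] --> 0.
  by rewrite -[0]addr0 -(@normr0 _ R); apply: cvgD; exact: cvg_norm.
apply: (squeeze_cvgr _ (cvg_cst 0) h); apply: nearW => n.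
rewrite normc_ge0 (le_trans (normc_leD _))// cReD cImD.
by case: l {h h1 h2}.
Qed.

Lemma near_eq_ccvg u v l : (\forall n \near \oo, u n = v n) -> ccvg u l -> ccvg v l.
Proof.
move=> uv [h1 h2]; split; [apply: cvg_trans h1|apply: cvg_trans h2];
  by apply: near_eq_cvg; apply: filterS uv => n ->.
Qed.

End complex_cvg.

Section bounded_measurable.
Context {R : realType} d {T : measurableType d}.
Implicit Types (f : T -> R) (g h : T -> R[i]).

(** A class closed under sums and products whose members are integrable for every finite measure, so
    that no integrability conditions have to be carried along. *)
Definition bmeas g := [/\ measurable_fun setT (fun x => complex.Re (g x)),
  measurable_fun setT (fun x => complex.Im (g x)) &
  exists M, forall x, normc (g x) <= M].

Lemma bmeas_cst k : bmeas (fun=> k).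
Proof. by split; [exact: measurable_cst..|exists (normc k)]. Qed.

Lemma bmeasD g h : bmeas g -> bmeas h -> bmeas (fun x => g x + h x).
Proof.
move=> [g1 g2 [M gM]] [h1 h2 [N hN]]; split.
- by under eq_fun do rewrite cReD; exact: measurable_funD.
- by under eq_fun do rewrite cImD; exact: measurable_funD.
- by exists (M + N) => x; rewrite (le_trans (le_normcD _ _))// lerD.
Qed.

Lemma bmeasM g h : bmeas g -> bmeas h -> bmeas (fun x => g x * h x).
Proof.
move=> [g1 g2 [M gM]] [h1 h2 [N hN]]; split.
- by under eq_fun do rewrite cReM; apply: measurable_funB; exact: measurable_funM.
- by under eq_fun do rewrite cImM; apply: measurable_funD; exact: measurable_funM.
- by exists (M * N) => x; rewrite normcM ler_pM ?normc_ge0.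
Qed.

Lemma bmeasZ k g : bmeas g -> bmeas (fun x => k * g x).
Proof. by move=> bg; exact: (bmeasM (bmeas_cst k) bg). Qed.

Lemma bmeas_sum I (r : seq I) (P : pred I) (F : I -> T -> R[i]) :
  (forall i, bmeas (F i)) -> bmeas (fun x => \sum_(i <- r | P i) F i x).
Proof.
move=> bF; elim: r => [|i r IH].
  rewrite (_ : (fun x => _) = fun=> 0); first exact: bmeas_cst.
  by apply/funext => x; rewrite big_nil.
rewrite (_ : (fun x => _) = fun x => if P i then F i x + \sum_(j <- r | P j) F j x
  else \sum_(j <- r | P j) F j x); last by apply/funext => x; rewrite big_cons.
by case: (P i) => //; exact: bmeasD.
Qed.

Lemma bmeas_prod I (r : seq I) (P : pred I) (F : I -> T -> R[i]) :
  (forall i, bmeas (F i)) -> bmeas (fun x => \prod_(i <- r | P i) F i x).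
Proof.
move=> bF; elim: r => [|i r IH].
  rewrite (_ : (fun x => _) = fun=> 1); first exact: bmeas_cst.
  by apply/funext => x; rewrite big_nil.
rewrite (_ : (fun x => _) = fun x => if P i then F i x * \prod_(j <- r | P j) F j x
  else \prod_(j <- r | P j) F j x); last by apply/funext => x; rewrite big_cons.
by case: (P i) => //; exact: bmeasM.
Qed.

Lemma bmeas_real f M : measurable_fun setT f -> (forall x, `|f x| <= M) ->
  bmeas (fun x => (f x)%:C).
Proof.
by move=> mf fM; split; [exact: mf|exact: measurable_cst|exists M => x; rewrite normcR].
Qed.

Lemma bmeas_expi f : measurable_fun setT f -> bmeas (fun x => expi (f x)).
Proof.
move=> mf; split.
- exact: (measurableT_comp (continuous_measurable_fun (@continuous_cos R)) mf).
- exact: (measurableT_comp (continuous_measurable_fun (@continuous_sin R)) mf).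
- by exists 1 => x; rewrite normc_expi.
Qed.

End bounded_measurable.

Lemma bmeas_comp {R : realType} d d' (T : measurableType d) (T' : measurableType d')
    (g : T -> R[i]) (f : T' -> T) :
  bmeas g -> measurable_fun setT f -> bmeas (fun x => g (f x)).
Proof.
move=> [g1 g2 [M gM]] mf; split; last by exists M.
- exact: (measurableT_comp g1 mf).
- exact: (measurableT_comp g2 mf).
Qed.

Section complex_integral.
Context {R : realType} d {T : measurableType d}.
Variable mu : {finite_measure set T -> \bar R}.
Implicit Types (f : T -> R) (g h : T -> R[i]).

Definition cint g : R[i] :=
  (\int[mu]_x complex.Re (g x)) +i* (\int[mu]_x complex.Im (g x)).

Lemma bounded_integrable f M : measurable_fun setT f -> (forall x, `|f x| <= M) ->
  mu.-integrable setT (EFin \o f).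
Proof.
move=> mf fM; apply: measurable_bounded_integrable => //.
  by rewrite ltey_eq fin_num_measure.
by exists M; split; [exact: num_real|move=> N MN x _; exact: le_trans (fM x) (ltW MN)].
Qed.

Lemma bmeas_Re_integrable g : bmeas g ->
  mu.-integrable setT (EFin \o (fun x => complex.Re (g x))).
Proof.
move=> [g1 _ [M gM]]; apply: (bounded_integrable g1 (M := M)) => x.
exact: le_trans (normc_Re _) (gM x).
Qed.

Lemma bmeas_Im_integrable g : bmeas g ->
  mu.-integrable setT (EFin \o (fun x => complex.Im (g x))).
Proof.
move=> [_ g1 [M gM]]; apply: (bounded_integrable g1 (M := M)) => x.
exact: le_trans (normc_Im _) (gM x).
Qed.

Lemma integrable_scaler k f : mu.-integrable setT (EFin \o f) ->
  mu.-integrable setT (EFin \o (fun x => k * f x)).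
Proof.
move=> fi; rewrite (_ : _ \o _ = fun x => k%:E * (EFin \o f) x)%E; last by apply/funext.
exact: integrableZl.
Qed.

Lemma integrable_addr f1 f2 : mu.-integrable setT (EFin \o f1) ->
  mu.-integrable setT (EFin \o f2) -> mu.-integrable setT (EFin \o (fun x => f1 x + f2 x)).
Proof.
move=> i1 i2; rewrite (_ : _ \o _ = (EFin \o f1) \+ (EFin \o f2))%E; last by apply/funext.
exact: integrableD.
Qed.

Lemma eq_cint g h : g =1 h -> cint g = cint h.
Proof. by move=> /funext ->. Qed.

Lemma cintD g h : bmeas g -> bmeas h -> cint (fun x => g x + h x) = cint g + cint h.
Proof.
move=> bg bh; apply: complex_ext => /=.
- under eq_Rintegral do rewrite cReD; rewrite RintegralD//; exact: bmeas_Re_integrable.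
- under eq_Rintegral do rewrite cImD; rewrite RintegralD//; exact: bmeas_Im_integrable.
Qed.

Lemma cintZ k g : bmeas g -> cint (fun x => k * g x) = k * cint g.
Proof.
move=> bg; have i1 := bmeas_Re_integrable bg; have i2 := bmeas_Im_integrable bg.
apply: complex_ext; case: k => a b /=.
- under eq_Rintegral do rewrite cReM /=.
  by rewrite RintegralB ?RintegralZl//; exact: integrable_scaler.
- under eq_Rintegral do rewrite cImM /=.
  by rewrite RintegralD ?RintegralZl//; exact: integrable_scaler.
Qed.

Lemma cint_cst k : cint (fun=> k) = k * (fine (mu setT))%:C.
Proof.
by apply: complex_ext; case: k => a b /=; rewrite Rintegral_cst//= mulr0 ?subr0 ?add0r//.
Qed.

Lemma cint_sum I (r : seq I) (P : pred I) (F : I -> T -> R[i]) :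
  (forall i, bmeas (F i)) ->
  cint (fun x => \sum_(i <- r | P i) F i x) = \sum_(i <- r | P i) cint (F i).
Proof.
move=> bF; elim: r => [|i r IH].
  rewrite big_nil (eq_cint (h := fun=> 0)) ?cint_cst ?mul0r// => x.
  by rewrite big_nil.
rewrite (@eq_cint _ (fun x => if P i then F i x + \sum_(j <- r | P j) F j x
  else \sum_(j <- r | P j) F j x)); last by move=> x; rewrite big_cons.
by rewrite big_cons; case: (P i) => //; rewrite cintD ?IH//; exact: bmeas_sum.
Qed.

Lemma cint_real f : cint (fun x => (f x)%:C) = (\int[mu]_x f x)%:C.
Proof. by apply: complex_ext => //=; rewrite Rintegral_cst//= mul0r. Qed.

(** The factor 2 comes from bounding real and imaginary parts separately; the sharp constant 1 would
    bring nothing later. *)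
Lemma normc_cint_le g f : bmeas g -> mu.-integrable setT (EFin \o f) ->
  (forall x, normc (g x) <= f x) -> normc (cint g) <= 2 * \int[mu]_x f x.
Proof.
move=> bg fi gf; rewrite (le_trans (normc_leD _))//= [leRHS](_ : _ = \int[mu]_x f x + \int[mu]_x f x); last by ring.
have key u : mu.-integrable setT (EFin \o u) -> (forall x, `|u x| <= f x) ->
    `|\int[mu]_x u x| <= \int[mu]_x f x.
  move=> ui uf; rewrite (le_trans (le_normr_Rintegral _ ui))//.
  apply: le_Rintegral => //.
  move: ui => /integrable_norm; apply: eq_integrable => //.
apply: lerD; apply: key.
- exact: bmeas_Re_integrable.
- by move=> x; exact: le_trans (normc_Re _) _.
- exact: bmeas_Im_integrable.
- by move=> x; exact: le_trans (normc_Im _) _.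
Qed.

Lemma cint_cvg (g_ : nat -> T -> R[i]) g M : (forall n, bmeas (g_ n)) -> bmeas g ->
  (forall n x, normc (g_ n x) <= M) ->
  (forall x, ccvg (fun n => g_ n x) (g x)) -> ccvg (fun n => cint (g_ n)) (cint g).
Proof.
move=> bg_ bg gM cg.
have key (u_ : nat -> T -> R) u : (forall n, mu.-integrable setT (EFin \o u_ n)) ->
   mu.-integrable setT (EFin \o u) ->
   (forall n x, `|u_ n x| <= M) -> (forall x, u_ n x @[n --> \oo] --> u x) ->
   \int[mu]_x u_ n x @[n --> \oo] --> \int[mu]_x u x.
  move=> iu_ iu uM uu; apply: fine_cvg; rewrite fineK; last first.
    by apply: integrable_fin_num.
  apply: (@dominated_cvg _ _ _ _ _ _ _ _ (fun=> M%:E)) => //.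
  - by move=> n; exact: (measurable_int mu (iu_ n)).
  - by move=> x _; apply: cvg_EFin; [exact: nearW|exact: uu].
  - by apply: (bounded_integrable (f := fun=> M) (M := `|M|)) => //; exact: measurable_cst.
  - by move=> n x _; rewrite lee_fin.
split; apply: key.
- by move=> n; exact: bmeas_Re_integrable.
- exact: bmeas_Re_integrable.
- by move=> n x; exact: le_trans (normc_Re _) (gM _ _).
- by move=> x; have [] := cg x.
- by move=> n; exact: bmeas_Im_integrable.
- exact: bmeas_Im_integrable.
- by move=> n x; exact: le_trans (normc_Im _) (gM _ _).
- by move=> x; have [] := cg x.
Qed.

End complex_integral.

(** * Densities and product measures *)

Section density.
Local Open Scope ereal_scope.
Context {R : realType} d {T : measurableType d}.
Variables (m P : {measure set T -> \bar R}) (h : T -> R).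
Hypothesis mh : measurable_fun setT h.
Hypothesis h0 : forall x, (0 <= h x)%R.
Hypothesis Ph : forall A, measurable A -> P A = \int[m]_(x in A) (h x)%:E.

Import HBNNSimple.

(** First stage of the usual extension from sets to functions: simple functions, then monotone
    limits, then positive and negative parts. *)
Lemma integral_density_nnsfun (f : {nnsfun T >-> R}) :
  \int[P]_x (f x)%:E = \int[m]_x ((f x)%:E * (h x)%:E).
Proof.
under [LHS]eq_integral do rewrite fimfunE -fsumEFin//.
rewrite [LHS]ge0_integral_fsum//; last 2 first.
  - by move=> r; exact/measurable_EFinP/measurableT_comp.
  - by move=> n x _; rewrite EFinM nnfun_muleindic_ge0.
under [RHS]eq_integral.
  move=> x xD; rewrite fimfunE -fsumEFin// ge0_mule_fsuml; last first.
    by move=> r; rewrite EFinM nnfun_muleindic_ge0.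
  over.
rewrite [RHS]ge0_integral_fsum//; last 2 first.
  - move=> r; apply: emeasurable_funM; apply/measurable_EFinP => //.
    exact/measurableT_comp.
  - move=> n x _; rewrite EFinM mule_ge0//; first by rewrite nnfun_muleindic_ge0.
    by rewrite lee_fin.
apply: eq_fsbigr => r; rewrite inE => -[z _ <-{r}].
have mA : measurable (f @^-1` [set f z]) by exact: measurable_sfunP.
under [LHS]eq_integral do rewrite EFinM.
under [RHS]eq_integral do rewrite EFinM -muleA.
have m1 : measurable_fun setT (fun x => (\1_(f @^-1` [set f z]) x)%:E : \bar R).
  exact/measurable_EFinP/measurable_indic.
rewrite !ge0_integralZl//;
  try by [rewrite lee_fin|move=> x _; rewrite ?mule_ge0// lee_fin ?indicE].
  2: by apply: emeasurable_funM => //; exact/measurable_EFinP.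
rewrite integral_indic// setIT Ph// [in LHS]integral_mkcond/=; congr (_ * _).
apply: eq_integral => x _; rewrite patchE indicE; case: ifPn => _.
  by rewrite mul1e.
by rewrite mul0e.
Qed.

Lemma ge0_integral_density (f : T -> \bar R) : measurable_fun setT f ->
  (forall x, 0 <= f x) -> \int[P]_x f x = \int[m]_x (f x * (h x)%:E).
Proof.
move=> mf f0.
pose f_ := nnsfun_approx measurableT mf.
transitivity (limn (fun n => \int[P]_x (f_ n x)%:E)).
  rewrite -monotone_convergence//=.
  - apply: eq_integral => ? /[!inE] xD; apply/esym/cvg_lim => //=.
    exact: cvg_nnsfun_approx.
  - by move=> n; exact/measurable_EFinP.
  - by move=> n ? _; rewrite lee_fin.
  - by move=> ? _ ? ? mn; rewrite lee_fin; exact/lefP/nd_nnsfun_approx.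
transitivity (limn (fun n => \int[m]_x ((f_ n x)%:E * (h x)%:E))).
  rewrite (_ : (fun n => \int[P]_x _) = (fun n => \int[m]_x ((f_ n x)%:E * (h x)%:E)))//.
  by apply/funext => n; exact: integral_density_nnsfun.
rewrite -monotone_convergence//=.
- apply: eq_integral => x _; apply/cvg_lim => //=.
  apply: cvgeZr => //; exact: cvg_nnsfun_approx.
- by move=> n; apply: emeasurable_funM; apply/measurable_EFinP.
- by move=> n x _; rewrite mule_ge0// lee_fin.
- move=> x _ ? ? mn; rewrite lee_wpmul2r ?lee_fin//; exact/lefP/nd_nnsfun_approx.
Qed.

(** Since [h] is nonnegative, the positive and negative parts of f h are those of f times h, so both
    sides are the same difference of extended reals, finite or not. *)
Lemma integral_density (f : T -> R) : measurable_fun setT f ->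
  \int[P]_x (f x)%:E = \int[m]_x (f x * h x)%:E.
Proof.
move=> mf; have mfe : measurable_fun setT (EFin \o f) by exact/measurable_EFinP.
rewrite [LHS]integralE [RHS]integralE; congr (_ - _).
  rewrite ge0_integral_density//; last exact: measurable_funepos.
  apply: eq_integral => x _; rewrite !funeposE; have [f0|f0] := leP 0%R (f x).
    by rewrite !max_l ?lee_fin ?mulr_ge0.
  by rewrite !max_r ?mul0e ?lee_fin ?(ltW f0)// nmulr_rle0.
rewrite ge0_integral_density//; last exact: measurable_funeneg.
apply: eq_integral => x _; rewrite !funenegE -!EFinN; have [f0|f0] := leP 0%R (f x).
  by rewrite !max_r ?mul0e ?lee_fin ?oppr_le0 ?mulr_ge0.
rewrite !max_l ?lee_fin ?oppr_ge0 ?(ltW f0)// -?EFinM ?mulNr//.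
by rewrite nmulr_rle0.
Qed.

End density.

(** * Fubini's theorem for bounded functions and finite measures *)

Section fubini.
Context {R : realType} d1 d2 {T1 : measurableType d1} {T2 : measurableType d2}.
Variables (m1 : {finite_measure set T1 -> \bar R}) (m2 : {finite_measure set T2 -> \bar R}).

Lemma fin_num_product : fin_num_fun (m1 \x m2)%E.
Proof.
move=> A mA; rewrite ge0_fin_numE ?measure_ge0//.
apply: (@le_lt_trans _ _ ((m1 \x m2)%E setT)); first by rewrite le_measure ?inE.
rewrite -setXTT product_measure1E// lte_mul_pinfty ?measure_ge0//.
  exact: fin_num_measure.
by rewrite ltey_eq fin_num_measure.
Qed.

Let prodm_fin := Measure_isFinite.Build _ _ _ (m1 \x m2)%E fin_num_product.
Definition prodm : {finite_measure set (T1 * T2)%type -> \bar R} :=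
  HB.pack (m1 \x m2)%E prodm_fin.

Lemma Rintegral_fubini (f : (T1 * T2)%type -> R) M : measurable_fun setT f ->
  (forall x, `|f x| <= M) ->
  [/\ measurable_fun setT (fun x => \int[m2]_y f (x, y)),
      \int[prodm]_z f z = \int[m1]_x (\int[m2]_y f (x, y)) &
      \int[prodm]_z f z = \int[m2]_y (\int[m1]_x f (x, y))].
Proof.
move=> mf fM.
have fi : prodm.-integrable setT (EFin \o f) by exact: bounded_integrable fM.
have i1 x : m2.-integrable setT (EFin \o (fun y => f (x, y))).
  apply: (@bounded_integrable _ _ _ m2 _ M) => //; exact: measurable_fun_pair2.
have i2 y : m1.-integrable setT (EFin \o (fun x => f (x, y))).
  apply: (@bounded_integrable _ _ _ m1 _ M) => //; exact: measurable_fun_pair1.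
have e1 : (fun x => (\int[m2]_y f (x, y))%:E) = fubini_F m2 (EFin \o f).
  apply/funext => x; rewrite /fubini_F /Rintegral fineK//.
  exact: integrable_fin_num (i1 x).
have e2 : (fun y => (\int[m1]_x f (x, y))%:E) = fubini_G m1 (EFin \o f).
  apply/funext => y; rewrite /fubini_G /Rintegral fineK//.
  exact: integrable_fin_num (i2 y).
split.
- by apply/measurable_EFinP; rewrite [_ \o _]e1; exact: measurable_fubini_F fi.
- by rewrite [RHS]/Rintegral e1 integral12_prod_meas1.
- by rewrite [RHS]/Rintegral e2 integral21_prod_meas1.
Qed.

Lemma cint_fubini (g : (T1 * T2)%type -> R[i]) : bmeas g ->
  [/\ bmeas (fun x => cint m2 (fun y => g (x, y))),
      cint prodm g = cint m1 (fun x => cint m2 (fun y => g (x, y))) &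
      cint prodm g = cint m2 (fun y => cint m1 (fun x => g (x, y)))].
Proof.
move=> bg; have [g1 g2 [M gM]] := bg.
have [mR e1 e2] := @Rintegral_fubini (fun z => complex.Re (g z)) M g1
  (fun x => le_trans (normc_Re _) (gM x)).
have [mI e3 e4] := @Rintegral_fubini (fun z => complex.Im (g z)) M g2
  (fun x => le_trans (normc_Im _) (gM x)).
split; [|by rewrite {1}/cint e1 e3|by rewrite {1}/cint e2 e4].
split => //; exists (2 * \int[m2]_y M) => x.
apply: normc_cint_le => //; first exact: (bmeas_comp bg (pair1_measurable x)).
by apply: (@bounded_integrable _ _ _ m2 (fun=> M) `|M|) => //; exact: measurable_cst.
Qed.

End fubini.

Section finite_pushforward.
Context {R : realType} d1 d2 {T1 : measurableType d1} {T2 : measurableType d2}.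
Variables (m : {finite_measure set T1 -> \bar R}) (f : {mfun T1 >-> T2}).

(** A separate name for the push-forward, to which the structure of a finite measure is attached. *)
Definition fpush := pushforward m f.

Let fpush0 : fpush set0 = 0%E. Proof. exact: measure0. Qed.

Let fpush_ge0 A : (0 <= fpush A)%E. Proof. exact: measure_ge0. Qed.

Let fpush_sigma_additive : semi_sigma_additive fpush.
Proof. exact: measure_semi_sigma_additive. Qed.

HB.instance Definition _ := isMeasure.Build _ _ _ fpush
  fpush0 fpush_ge0 fpush_sigma_additive.

Let fpush_fin : fin_num_fun fpush.
Proof.
by move=> A mA; apply: fin_num_measure; rewrite -[X in measurable X]setTI;
  apply: measurable_funPT.
Qed.

HB.instance Definition _ := Measure_isFinite.Build _ _ _ fpush fpush_fin.

End finite_pushforward.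

(** * The spectral law as a Toeplitz determinant *)

Section restricted_lebesgue.
Context {R : realType}.
Local Notation leb := (@lebesgue_measure R).

Lemma lebesgue_pi_ltoo : (leb `](- pi)%R, pi[ < +oo)%E.
Proof. by rewrite lebesgue_measure_itv/=; case: ifP => _; rewrite ltry. Qed.

Local Notation RR := (measurableTypeR R).

Let mpi : measurable (`](- pi)%R, pi[%classic : set RR).
Proof. exact: measurable_itv. Qed.

Let lebpi : {finite_measure set RR -> \bar R} := mfrestr mpi lebesgue_pi_ltoo.

Let mid : measurable_fun [set: RR] (idfun : RR -> R).
Proof. by move=> _ A mA; rewrite setTI. Qed.

Let fid : {mfun RR >-> R} := HB.pack (idfun : RR -> R) (isMeasurableFun.Build _ _ _ _ _ mid).
(** Lebesgue measure on ]-pi, pi[. Pushing forward by the identity moves it from [measurableTypeR R]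
    to the measurable structure of [R], over which tuples are formed. *)
Definition piLeb : {finite_measure set R -> \bar R} := fpush lebpi fid.

Lemma ge0_integral_piLeb (f : R -> \bar R) : measurable_fun setT f ->
  (forall x, (0 <= f x)%E) ->
  (\int[piLeb]_x f x = \int[leb]_(x in `](- pi)%R, pi[) f x)%E.
Proof.
move=> mf f0.
rewrite (@ge0_integral_pushforward _ _ _ _ _ _ mid lebpi)// preimage_setT.
have mC : measurable (~` `](- pi)%R, pi[ : set RR) by exact: measurableC.
rewrite (@ge0_negligible_integral _ _ _ lebpi _ (~` `](- pi)%R, pi[))//; last first.
  by rewrite /lebpi/= /mfrestr /mrestr setICl measure0.
rewrite setTD setCK; apply: eq_measure_integral => A mA AD.
by rewrite /lebpi/= /mfrestr /mrestr setIidl.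
Qed.

Lemma Rintegral_piLeb (f : R -> R) : measurable_fun setT f ->
  \int[piLeb]_x f x = \int[leb]_(x in `](- pi)%R, pi[) f x.
Proof.
move=> mf; have mfe : measurable_fun setT (EFin \o f) by exact/measurable_EFinP.
rewrite /Rintegral [in LHS]integralE [in RHS]integralE.
by rewrite !ge0_integral_piLeb//; [exact: measurable_funeneg|exact: measurable_funepos].
Qed.

End restricted_lebesgue.

Section box_measure.
Context {R : realType}.

Let cons_fun m (z : (R * m.-tuple R)%type) : m.+1.-tuple R := [tuple of z.1 :: z.2].

Lemma measurable_cons_fun m : measurable_fun setT (@cons_fun m).
Proof. exact: measurable_cons. Qed.

Section push.
Variables (m : nat) (nu : {finite_measure set (m.-tuple R) -> \bar R}).

Let mfc := isMeasurableFun.Build _ _ _ _ _ (@measurable_cons_fun m).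
Let fc : {mfun _ >-> _} := HB.pack (@cons_fun m) mfc.
Definition cons_measure : {finite_measure set (m.+1.-tuple R) -> \bar R} :=
  fpush (prodm piLeb nu) fc.

Lemma ge0_integral_cons_measure (f : m.+1.-tuple R -> \bar R) :
  measurable_fun setT f -> (forall t, 0 <= f t)%E ->
  (\int[cons_measure]_t f t =
   \int[piLeb]_x \int[nu]_t f [tuple of x :: t])%E.
Proof.
move=> mf f0; rewrite (@ge0_integral_pushforward _ _ _ _ _ _ (@measurable_cons_fun m))//.
rewrite preimage_setT (@fubini_tonelli1 _ _ _ _ _ piLeb nu (f \o @cons_fun m))//.
  exact: (measurableT_comp mf (@measurable_cons_fun m)).
by move=> z; exact: f0.
Qed.

Lemma cint_cons_measure (g : m.+1.-tuple R -> R[i]) : bmeas g ->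
  cint cons_measure g = cint piLeb (fun x => cint nu (fun t => g [tuple of x :: t])).
Proof.
move=> bg; have bgc : bmeas (g \o @cons_fun m).
  exact: (bmeas_comp bg (@measurable_cons_fun m)).
have [_ <- _] := cint_fubini piLeb nu bgc.
have key (f : m.+1.-tuple R -> R) : measurable_fun setT f ->
    (prodm piLeb nu).-integrable setT (EFin \o (f \o @cons_fun m)) ->
    \int[cons_measure]_t f t = \int[prodm piLeb nu]_z f (cons_fun z).
  move=> mf fi; rewrite /Rintegral.
  rewrite (@integral_pushforward _ _ _ _ _ _ (@measurable_cons_fun m))//.
  exact/measurable_EFinP.
have [g1 g2 _] := bg; rewrite /cint !key//.
- exact: bmeas_Im_integrable bgc.
- exact: bmeas_Re_integrable bgc.
Qed.

End push.

(** Replaces the iterated integral by integration against one finite measure. The factorisation over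
    products of one-variable functions is the only form of Fubini that Andreief's identity
    requires. *)
Lemma box_measure m : exists nu : {finite_measure set (m.-tuple R) -> \bar R},
  (forall f : m.-tuple R -> \bar R, measurable_fun setT f -> (forall t, 0 <= f t)%E ->
    (\int[nu]_t f t = box_integral f)%E) /\
  (forall G : 'I_m -> R -> R[i], (forall j, bmeas (G j)) ->
    cint nu (fun t => \prod_j G j (tnth t j)) = \prod_j cint piLeb (G j)).
Proof.
elim: m => [|m [nu [nu1 nu2]]].
  exists (\d_ ([tuple] : 0.-tuple R)); split => [f mf f0|G bG].
    rewrite integral_dirac//; transitivity (1 * f [tuple])%E; last by rewrite mul1e.
    by congr (_ * _)%E; exact: diracT.
  rewrite big_ord0 (eq_cint _ (h := fun=> 1)).
    by rewrite cint_cst mul1r; congr (_%:C); rewrite -[RHS]/(fine 1%E); congr fine; exact: diracT.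
  by move=> t; rewrite big_ord0.
exists (cons_measure nu); split => [f mf f0|G bG].
  have mfx x : measurable_fun setT (fun t : m.-tuple R => f [tuple of x :: t]).
    apply: (measurableT_comp mf); exact: measurable_cons.
  rewrite ge0_integral_cons_measure// ge0_integral_piLeb.
  - by apply: eq_integral => x _; rewrite nu1.
  - apply: (@measurable_fun_fubini_tonelli_F _ _ _ _ _ nu (f \o @cons_fun m)) => //.
      exact: (measurableT_comp mf (@measurable_cons_fun m)).
    by move=> z; exact: f0.
  - by move=> x; apply: integral_ge0 => t _; exact: f0.
rewrite cint_cons_measure; last first.
  by apply: bmeas_prod => j; exact: (bmeas_comp (bG j) (@measurable_tnth _ _ _ j)).
have e x : cint nu (fun t => \prod_j G j (tnth [tuple of x :: t] j)) =
    (\prod_j cint piLeb (G (lift ord0 j))) * G ord0 x.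
  rewrite (eq_cint _ (h := fun t => G ord0 x * \prod_j G (lift ord0 j) (tnth t j))).
    rewrite cintZ; last first.
      by apply: bmeas_prod => j; exact: (bmeas_comp (bG _) (@measurable_tnth _ _ _ j)).
    by rewrite (nu2 (fun j => G (lift ord0 j)))// mulrC.
  move=> t; rewrite big_ord_recl tnth0; congr (_ * _); apply: eq_bigr => j _.
  by rewrite tnthS.
by rewrite (eq_cint _ e) cintZ// big_ord_recl mulrC.
Qed.

End box_measure.

(** * Andreief's identity for the spectral law *)

Section spectral.
Context {R : realType}.
Implicit Types (p m : nat).

Lemma normc_sqr (z : R[i]) : (normc z ^+ 2)%:C = z * conjc z.
Proof.
case: z => a b /=; rewrite sqr_sqrtr ?addr_ge0 ?sqr_ge0//.
by apply: complex_ext => /=; ring.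
Qed.

Lemma conjc_expi (x : R) : conjc (expi x) = expi (- x).
Proof. by rewrite /expi /= cosN sinN. Qed.

Lemma expiX (x : R) n : expi x ^+ n = expi (n%:R * x).
Proof.
elim: n => [|n IH]; first by rewrite mul0r expi0 expr0.
by rewrite exprS IH -expiD -natr1 mulrDl mul1r addrC.
Qed.

Lemma normc_1subexpi (x : R) : normc (1 - expi x) ^+ 2 = 2 - 2 * cos x.
Proof.
rewrite /expi /= sqr_sqrtr ?addr_ge0 ?sqr_ge0//.
by have := cos2Dsin2 x; nra.
Qed.

Definition fh_weight p (x : R) : R := (2 - 2 * cos x) ^+ p.

Lemma fh_weightE p x : normc (1 - expi x) ^+ (2 * p) = fh_weight p x.
Proof. by rewrite exprM normc_1subexpi. Qed.

Lemma measurable_fh_weight p : measurable_fun setT (fh_weight p).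
Proof.
apply: measurable_funX; apply: measurable_funB; first exact: measurable_cst.
apply: measurable_funM; first exact: measurable_cst.
exact: (continuous_measurable_fun (@continuous_cos R)).
Qed.

Lemma fh_weight_ge0 p x : 0 <= fh_weight p x.
Proof. by rewrite -fh_weightE exprn_ge0// normc_ge0. Qed.

Lemma fh_weight_le p x : `|fh_weight p x| <= 4 ^+ p.
Proof.
rewrite ger0_norm ?fh_weight_ge0// lerXn2r ?nnegrE//.
by have := cos_geN1 x; lra.
Qed.

Lemma bmeas_fh_weight p : bmeas (fun x => (fh_weight p x)%:C).
Proof. exact: (bmeas_real (measurable_fh_weight p) (fh_weight_le p)). Qed.

(** A Fourier coefficient of the symbol without the usual 1/(2 pi), which cancels in ratios of
    determinants. *)
Definition fh_coef p (g : R -> R[i]) (k : int) : R[i] :=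
  cint piLeb (fun x => (fh_weight p x)%:C * g x * expi (- (k%:~R * x))).

(** The squared product of differences is det V times its conjugate for the Vandermonde matrix V;
    both determinants are expanded over permutations, which leaves products of one-variable
    functions. *)
Lemma spectral_weight_det p m (t : m.-tuple R) (g : R -> R[i]) :
  (spectral_weight p t)%:C * \prod_j g (tnth t j) =
  \sum_(s : 'S_m) \sum_(u : 'S_m) (-1) ^+ s * (-1) ^+ u *
   \prod_j ((fh_weight p (tnth t j))%:C * g (tnth t j) *
     expi (- (((u j : nat)%:Z - (s j : nat)%:Z)%:~R * tnth t j))).
Proof.
pose V : 'M[R[i]]_m := \matrix_(j, i) expi (i%:R * tnth t j).
have VE : \det V = \prod_(k < m) \prod_(l < m | (k < l)%N)
    (expi (tnth t l) - expi (tnth t k)).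
  rewrite -det_tr -[RHS](_ : \det (Vandermonde m (\row_j expi (tnth t j))) = _).
    by congr (\det _); apply/matrixP => i j; rewrite !mxE expiX.
  rewrite det_Vandermonde; apply: eq_bigr => k _; apply: eq_bigr => l _.
  by rewrite !mxE.
have -> : (spectral_weight p t)%:C = \det V * conjc (\det V) *
    \prod_j (fh_weight p (tnth t j))%:C.
  rewrite /spectral_weight rmorphM !rmorph_prod; congr (_ * _); last first.
    by apply: eq_bigr => j _; rewrite fh_weightE.
  rewrite VE rmorph_prod -big_split /=; apply: eq_bigr => k _.
  rewrite !rmorph_prod -big_split /=; apply: eq_bigr => l _.
  by rewrite -normc_sqr -normcN opprB.
have -> : conjc (\det V) = \sum_(u : 'S_m) (-1) ^+ u *
    \prod_j expi (- ((u j : nat)%:R * tnth t j)).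
  rewrite rmorph_sum; apply: eq_bigr => u _; rewrite rmorphM rmorphXn rmorphN1.
  rewrite rmorph_prod; congr (_ * _); apply: eq_bigr => j _.
  by rewrite mxE -conjc_expi.
rewrite -!mulrA -big_split /= {1}/determinant mulr_suml.
apply: eq_bigr => s _; rewrite mulr_suml mulr_sumr; apply: eq_bigr => u _.
rewrite mulrA mulrACA -[RHS]mulrA -!mulrA; congr (_ * (_ * _)).
rewrite -!big_split /=; apply: eq_bigr => j _.
rewrite mxE mulrA -expiD [LHS]mulrC; congr (_ * expi _).
by rewrite rmorphB /= -![_%:~R]/(_%:R); ring.
Qed.

(** For fixed u, replacing s by u * s and relabelling the factors turns the inner sum into the same
    determinant, hence m! copies of it. *)
Lemma sum_sum_det m (c : int -> R[i]) :
  \sum_(s : 'S_m) \sum_(u : 'S_m) (-1) ^+ s * (-1) ^+ u *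
   \prod_(j < m) c ((u j : nat)%:Z - (s j : nat)%:Z) = (m`!)%:R * \det (toeplitz c m).
Proof.
rewrite exchange_big /= (eq_bigr (fun=> \det (toeplitz c m))) => [|u _].
  rewrite sumr_const mulr_natl; congr (_ *+ _); rewrite -card_Sn.
  by apply: eq_card => s; rewrite inE.
rewrite /determinant (reindex_inj (mulgI u)) /=; apply: eq_bigr => s _.
rewrite odd_permM signr_addb -mulrA mulrCA mulrA signrMK.
congr (_ * _); rewrite [RHS](reindex_inj (@perm_inj _ u)) /=.
by apply: eq_bigr => j _; rewrite mxE permM.
Qed.

(** The constant, [cst] times m!, does not depend on g: taking g = 1 identifies it later as the
    inverse of a determinant. *)
Lemma spectral_law_cint p m (mu : probability (m.-tuple R) R) :
  is_spectral_law p mu -> exists c : R, forall g : R -> R[i], bmeas g ->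
    cint mu (fun t => \prod_j g (tnth t j)) =
    c%:C * \det (toeplitz (fh_coef p g) m).
Proof.
move=> [cst hmu]; have [nu [nu1 nu2]] := @box_measure R m.
(* Measurability of the weight is read off its own determinantal expansion with g = 1. *)
have bw : bmeas (fun t : m.-tuple R => (spectral_weight p t)%:C).
  pose g (_ : R) : R[i] := 1.
  rewrite (_ : (fun t => _) = fun t : m.-tuple R => (spectral_weight p t)%:C *
     \prod_j g (tnth t j)); last by apply/funext => t; rewrite big1 ?mulr1.
  rewrite (funext (fun t : m.-tuple R => spectral_weight_det p t g)).
  apply: bmeas_sum => s; apply: bmeas_sum => u; apply: bmeasZ; apply: bmeas_prod => j.
  apply: (@bmeas_comp _ _ _ _ _ (fun x => (fh_weight p x)%:C * g x *
    expi (- (((u j : nat)%:Z - (s j : nat)%:Z)%:~R * x))) (fun t => tnth t j)).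
    apply: bmeasM; first by apply: bmeasM; [exact: bmeas_fh_weight|exact: bmeas_cst].
    by apply: bmeas_expi; apply: measurable_funN; apply: measurable_funM.
  exact: measurable_tnth.
have [mw _ _] := bw; rewrite /= in mw.
have w0 t : 0 <= @spectral_weight R p m t.
  rewrite mulr_ge0// prodr_ge0// => i _; last by rewrite exprn_ge0// normc_ge0.
  by rewrite prodr_ge0// => j _; rewrite sqr_ge0.
have nuE A : measurable A -> mu A = (cst%:E * \int[nu]_(t in A) (spectral_weight p t)%:E)%E.
  move=> mA; rewrite hmu// -nu1; last 2 first.
  - apply/measurable_EFinP/measurable_funM => //; exact: measurable_indic.
  - by move=> t; rewrite lee_fin mulr_ge0// indicE.
  congr (_ * _)%E; rewrite [RHS]integral_mkcond; apply: eq_integral => t _.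
  by rewrite patchE indicE; case: ifPn => _; rewrite ?mul1r ?mul0r.
(* A density must be nonnegative; a negative constant would make the total mass at most 0 instead of
   1. *)
have cst0 : 0 <= cst.
  rewrite leNgt; apply/negP => c0.
  have := nuE setT measurableT; rewrite probability_setT => e.
  have : (0 <= \int[nu]_(t in setT) (spectral_weight p t)%:E)%E.
    by apply: integral_ge0 => t _; rewrite lee_fin.
  move=> h; have := @nmule_rle0 _ cst%:E _; rewrite lte_fin => /(_ _ c0) h2.
  have : (cst%:E * \int[nu]_(t in setT) (spectral_weight p t)%:E <= 0)%E by rewrite h2.
  by rewrite -e lee_fin ler10.
have mcw : measurable_fun setT (fun t : m.-tuple R => cst * spectral_weight p t).
  exact: measurable_funM.
have dens A : measurable A -> mu A = (\int[nu]_(t in A) (cst * spectral_weight p t)%:E)%E.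
  move=> mA; rewrite nuE// -ge0_integralZl//.
    exact/measurable_EFinP/measurable_funTS.
  by move=> t _; rewrite lee_fin.
have idens := integral_density mcw (fun t => mulr_ge0 cst0 (w0 t)) dens.
exists (cst * (m`!)%:R) => g bg.
have bG : bmeas (fun t : m.-tuple R => \prod_j g (tnth t j)).
  by apply: bmeas_prod => j; exact: (bmeas_comp bg (@measurable_tnth _ _ _ j)).
have -> : cint mu (fun t => \prod_j g (tnth t j)) =
    cint nu (fun t => cst%:C * ((spectral_weight p t)%:C * \prod_j g (tnth t j))).
  have [G1 G2 _] := bG; apply: complex_ext; rewrite /= /Rintegral idens//;
    congr fine; apply: eq_integral => t _; congr EFin.
  - by case: (\prod_j _) => a b /=; ring.
  - by case: (\prod_j _) => a b /=; ring.
rewrite cintZ; last exact: bmeasM.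
rewrite rmorphM /= -mulrA; congr (_ * _).
rewrite rmorph_nat -sum_sum_det.
rewrite (eq_cint _ (fun t => spectral_weight_det p t g)).
have bS (k : int) : bmeas (fun x => (fh_weight p x)%:C * g x * expi (- (k%:~R * x))).
  apply: bmeasM; first by apply: bmeasM => //; exact: bmeas_fh_weight.
  by apply: bmeas_expi; apply: measurable_funN; apply: measurable_funM.
have bP (u s : 'S_m) : bmeas (fun t : m.-tuple R => \prod_j ((fh_weight p (tnth t j))%:C * g (tnth t j) *
     expi (- (((u j : nat)%:Z - (s j : nat)%:Z)%:~R * tnth t j)))).
  apply: bmeas_prod => j; exact: (bmeas_comp (bS _) (@measurable_tnth _ _ _ j)).
rewrite cint_sum => [|s]; last by apply: bmeas_sum => u; exact: bmeasZ.
apply: eq_bigr => s _; rewrite cint_sum => [|u]; last exact: bmeasZ.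
apply: eq_bigr => u _; rewrite cintZ//; congr (_ * _).
by rewrite (nu2 (fun j x => (fh_weight p x)%:C * g x *
     expi (- (((u j : nat)%:Z - (s j : nat)%:Z)%:~R * x)))).
Qed.

End spectral.

(** * The two-term recurrence for the Fourier coefficients *)

Section derive_rules.
Context {R : realType}.
Implicit Types (f g : R -> R) (x a b : R).

Lemma is_derive1_eq f g x a b : is_derive x 1 f a -> (forall y, f y = g y) -> a = b ->
  is_derive x 1 g b.
Proof. by move=> h /funext <- <-. Qed.

Lemma is_derive1D f g x a b : is_derive x 1 f a -> is_derive x 1 g b ->
  is_derive x 1 (fun y => f y + g y) (a + b).
Proof. by move=> fa gb; exact: (is_deriveD fa gb). Qed.

Lemma is_derive1M f g x a b : is_derive x 1 f a -> is_derive x 1 g b ->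
  is_derive x 1 (fun y => f y * g y) (a * g x + f x * b).
Proof.
move=> fa gb; apply: (is_derive1_eq (is_deriveM fa gb)) => //.
by rewrite addrC [a * _]mulrC.
Qed.

Lemma is_derive1Z k f x a : is_derive x 1 f a -> is_derive x 1 (fun y => k * f y) (k * a).
Proof. by move=> fa; exact: (is_deriveZ k fa). Qed.

Lemma is_derive1X n f x a : is_derive x 1 f a ->
  is_derive x 1 (fun y => f y ^+ n.+1) (n.+1%:R * f x ^+ n * a).
Proof. by move=> fa; apply: (is_derive1_eq (is_deriveX n.+1 fa)) => // y; rewrite exprfctE. Qed.

Lemma is_derive1V f x a : is_derive x 1 f a -> f x != 0 ->
  is_derive x 1 (fun y => (f y)^-1) (- (f x) ^- 2 * a).
Proof. by move=> fa fx; exact: (is_deriveV fx fa). Qed.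

Lemma is_derive1_cst k x : is_derive x (1 : R) (fun=> k) (0 : R).
Proof. exact: (is_derive_cst k x 1). Qed.

Lemma is_derive1_id x : is_derive x (1 : R) (fun y : R => y) (1 : R).
Proof. exact: (is_derive_id x 1). Qed.

Lemma is_derive1_compf f g x a b : is_derive x 1 g b -> is_derive (g x) 1 f a ->
  is_derive x 1 (fun y => f (g y)) (a * b).
Proof. by move=> gb fa; exact: (is_derive1_comp fa gb). Qed.

Lemma is_derive1_continuous f x a : is_derive x 1 f a -> {for x, continuous f}.
Proof. by move=> [fd _]; apply/differentiable_continuous; rewrite -derivable1_diffP. Qed.

End derive_rules.

(** * Integration by parts for the Fisher-Hartwig symbol *)

Section phase.
Context {R : realType}.
Implicit Types (xi eta th k al : R) (p : nat).

Definition fh_phase xi eta th : R :=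
  xi * ln (normc (1 - expi th)) + eta * carg (1 - expi th).

Definition fh_char xi eta th : R[i] := expi (fh_phase xi eta th).

Let Lf th : R := 2^-1 * ln (2 - 2 * cos th).
Let Af th : R := atan (- sin th / (1 - cos th)).

Lemma ln_normc_1subexpi th : ln (normc (1 - expi th)) = Lf th.
Proof.
rewrite /Lf -normc_1subexpi; have := normc_ge0 (1 - expi th).
rewrite le_eqVlt => /predU1P[<-|n0]; first by rewrite expr0n/= ln0// mulr0.
by rewrite lnXn// -(mulr_natl (ln _) 2) mulKf// pnatr_eq0.
Qed.

Lemma carg_1subexpi th : cos th < 1 -> carg (1 - expi th) = Af th.
Proof. by move=> c1; rewrite carg_atan /= ?sub0r// subr_gt0. Qed.

(** At z = 1 the argument is a default value, pi/2, whereas [Af] gives 0 there; the two have to be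
    treated apart. *)
Lemma carg_1subexpi0 th : cos th = 1 -> carg (1 - expi th : R[i]) = carg 0.
Proof.
move=> c1; congr carg; apply: complex_ext; rewrite /= ?c1 ?subrr//.
have : sin th ^+ 2 == 0 by rewrite sin2cos2 c1 expr1n subrr.
by rewrite sqrf_eq0 => /eqP ->; rewrite subr0.
Qed.

Lemma measurable_carg_1subexpi : measurable_fun setT (fun th => carg (1 - expi th) : R).
Proof.
have mc : measurable_fun setT (@cos R) by apply: continuous_measurable_fun; exact: continuous_cos.
have ms : measurable_fun setT (@sin R) by apply: continuous_measurable_fun; exact: continuous_sin.
(* On this branch 1 - cos th is positive, so its inverse is exp (- ln), a composition of measurable
   functions. *)
rewrite (_ : (fun th => _) = fun th => if cos th < 1 then
    atan (- sin th * expR (- ln (1 - cos th))) else carg 0).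
  apply: measurable_fun_ifT => //; first by apply: measurable_fun_ltr.
  apply: (@measurableT_comp _ _ _ _ _ _ (@atan R)).
    by apply: continuous_measurable_fun; exact: continuous_atan.
  apply: measurable_funM; first exact: measurable_funN.
  apply: (measurableT_comp (@measurable_expR R)); apply: measurable_funN.
  apply: (measurableT_comp (@measurable_ln R)); exact: measurable_funB.
apply/funext => th; case: ifPn => c1.
  by rewrite carg_1subexpi// expRN lnK// posrE subr_gt0.
by apply: carg_1subexpi0; apply/eqP; rewrite eq_le cos_le1 leNgt.
Qed.

Lemma measurable_fh_phase xi eta : measurable_fun setT (fh_phase xi eta).
Proof.
apply: measurable_funD; apply: measurable_funM => //; last exact: measurable_carg_1subexpi.
rewrite (_ : (fun th => _) = Lf); last by apply/funext => th; exact: ln_normc_1subexpi.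
apply: measurable_funM => //; apply: (measurableT_comp (@measurable_ln R)).
apply: measurable_funB => //; apply: measurable_funM => //.
by apply: continuous_measurable_fun; exact: continuous_cos.
Qed.

Lemma bmeas_fh_char xi eta : bmeas (fh_char xi eta).
Proof. by apply: bmeas_expi; exact: measurable_fh_phase. Qed.

(** The argument of e^(i al) e^(i psi) z^(-k). The free angle [al] lets one real identity yield both
    the real and the imaginary part of a complex one. *)
Let ph xi eta (k : R) al th := xi * Lf th + eta * Af th - k * th + al.

(** The real part of w (1 - z) e^(i ph). The factor 1 - z links the coefficients of indices k and k
    - 1 and cancels the pole of the derivative of log |1 - z|. *)
Let Ff p xi eta (k : R) al th := fh_weight p th *
  ((1 - cos th) * cos (ph xi eta k al th) + sin th * sin (ph xi eta k al th)).

(** The derivative of [Ff] with the denominators 2 - 2 cos th cancelled: a bounded function times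
    the weight, hence meaningful at 0 too. *)
Let hf p xi eta (k : R) al th := fh_weight p th *
  ((xi / 2 + (p%:R + 1 - k + eta / 2) * sin th + xi / 2 * cos th) * cos (ph xi eta k al th) +
   (p%:R + k - eta / 2 + (p%:R + 1 - k + eta / 2) * cos th - xi / 2 * sin th) * sin (ph xi eta k al th)).

Lemma is_derive_fh_weight p th : is_derive th 1 (fh_weight p.+1)
  (p.+1%:R * 2 * sin th * fh_weight p th).
Proof.
have h : is_derive th 1 (fun y : R => 2 + (-2) * cos y) (0 + (-2) * (- sin th)).
  exact: (is_derive1D (is_derive1_cst _ _) (is_derive1Z _ (is_derive_cos th))).
apply: (is_derive1_eq (is_derive1X p h)) => [y|]; rewrite /fh_weight mulNr//; ring.
Qed.

Lemma is_derive_Lf th : cos th < 1 -> is_derive th 1 Lf (sin th / (2 - 2 * cos th)).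
Proof.
move=> c1; have h : is_derive th 1 (fun y : R => 2 + (-2) * cos y) (0 + (-2) * (- sin th)).
  exact: (is_derive1D (is_derive1_cst _ _) (is_derive1Z _ (is_derive_cos th))).
have h0 : 0 < 2 + (-2) * cos th by lra.
have := is_derive1Z 2^-1 (is_derive1_compf (f := @ln R) h (is_derive1_ln h0)).
move=> /is_derive1_eq; apply => [y|]; first by rewrite /Lf mulNr.
rewrite mulNr; field; lra.
Qed.

(** On ]0, pi[ and ]-pi, 0[ the argument of 1 - z is (th - pi)/2 and (th + pi)/2: a sawtooth of
    slope 1/2. *)
Lemma is_derive_Af th : cos th < 1 -> is_derive th 1 Af 2^-1.
Proof.
move=> c1; have h : is_derive th 1 (fun y : R => 1 + (-1) * cos y) (0 + (-1) * (- sin th)).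
  exact: (is_derive1D (is_derive1_cst _ _) (is_derive1Z _ (is_derive_cos th))).
have h0 : 1 + (-1) * cos th != 0 by apply/eqP; lra.
have hV := is_derive1V h h0.
have hs := is_derive1Z (-1) (is_derive_sin th).
have := is_derive1_compf (f := @atan R) (is_derive1M hs hV) (is_derive1_atan _).
move=> /is_derive1_eq; apply => [y|].
  by rewrite /Af !mulN1r.
move: h0; rewrite !mulN1r => h0.
have s2 : sin th ^+ 2 = 1 - cos th ^+ 2 by rewrite sin2cos2.
have -> : 1 + (- sin th / (1 - cos th)) ^+ 2 = 2 / (1 - cos th).
  by rewrite exprMn sqrrN s2; field; rewrite subr_eq0 eq_sym; apply/eqP; lra.
rewrite invf_div.
have -> : - cos th * (1 - cos th)^-1 + - sin th * (- (1 - cos th) ^- 2 * (0 - - sin th)) =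
  (1 - cos th)^-1.
  transitivity ((- cos th * (1 - cos th) + sin th ^+ 2) * (1 - cos th) ^- 2).
    by field; rewrite subr_eq0 eq_sym; apply/eqP; lra.
  by rewrite s2; field; rewrite subr_eq0 eq_sym; apply/eqP; lra.
by rewrite mulrAC divff ?mul1r.
Qed.

Lemma is_derive_ph xi eta k al th : cos th < 1 ->
  is_derive th 1 (ph xi eta k al) (xi * (sin th / (2 - 2 * cos th)) + eta / 2 - k).
Proof.
move=> c1.
have h := is_derive1D (is_derive1D (is_derive1D
  (is_derive1Z xi (is_derive_Lf c1)) (is_derive1Z eta (is_derive_Af c1)))
  (is_derive1Z (- k) (is_derive1_id th))) (is_derive1_cst al th).
by apply: (is_derive1_eq h) => [y|]; rewrite /ph; ring.
Qed.

Lemma is_derive_Ff p xi eta k al th : cos th < 1 ->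
  is_derive th 1 (Ff p.+1 xi eta k al) (hf p.+1 xi eta k al th).
Proof.
move=> c1; have dph := is_derive_ph xi eta k al c1.
have dc := is_derive1_compf (f := @cos R) dph (is_derive_cos _).
have ds := is_derive1_compf (f := @sin R) dph (is_derive_sin _).
have d1c := is_derive1D (is_derive1_cst 1 th) (is_derive1Z (-1) (is_derive_cos th)).
have h := is_derive1M (is_derive_fh_weight p th)
  (is_derive1D (is_derive1M d1c dc) (is_derive1M (is_derive_sin th) ds)).
apply: (is_derive1_eq h) => [y|]; first by rewrite /Ff mulN1r.
rewrite /hf; move: (ph xi eta k al th) => f.
have s2 : sin th ^+ 2 = 1 - cos th ^+ 2 by rewrite sin2cos2.
rewrite /fh_weight exprS; set w := _ ^+ p.
move: (cos f) (sin f) => x y.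
have c0 : 1 - cos th != 0 by rewrite subr_eq0 eq_sym; apply/eqP; lra.
move: s2 c0; move: (cos th) (sin th) => c s s2 c0.
rewrite -natr1; set q := (_ %:R : R).
transitivity (w * (
  ((q + 1) * 2 * s * (1 - c) + (2 - 2 * c) * s +
   s * ((xi * s + (2 - 2 * c) * (eta / 2 - k)))) * x +
  ((q + 1) * 2 * s ^+ 2 - (1 - c) * (xi * s + (2 - 2 * c) * (eta / 2 - k))
    + (2 - 2 * c) * c) * y)).
  by field; rewrite (_ : 2 - 2 * c = 2 * (1 - c)) ?mulf_neq0 ?pnatr_eq0//; ring.
rewrite (_ : s * (xi * s + (2 - 2 * c) * (eta / 2 - k)) = xi * s ^+ 2 +
  s * (2 - 2 * c) * (eta / 2 - k)); last by ring.
by rewrite s2; field.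
Qed.

Lemma cos_lt1 th : - pi <= th <= pi -> th != 0 -> cos th < 1.
Proof.
move=> /andP[tl tr] t0; rewrite lt_neqAle cos_le1 andbT.
have -> : cos th = cos `|th| by case: (ger0P th) => // _; rewrite cosN.
rewrite lt_eqF// -(@cos0 R) ltr_cos ?normr_gt0// in_itv/= ?lexx ?pi_ge0//.
by rewrite normr_ge0 ler_norml tl.
Qed.

Lemma fh_weight0 p : fh_weight p.+1 (0 : R) = 0.
Proof. by rewrite /fh_weight cos0 mulr1 subrr expr0n. Qed.

Lemma cvg_fh_weight0 p : fh_weight p.+1 x @[x --> (0:R)] --> (0:R).
Proof.
rewrite -[X in _ --> X](fh_weight0 p).
exact: is_derive1_continuous (is_derive_fh_weight p 0).
Qed.

(** With a positive exponent the weight vanishes at 0 and absorbs the jump and the oscillation of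
    the symbol there. *)
Lemma cvg_weight_bounded p (f : R -> R) M : (forall x, `|f x| <= M) ->
  fh_weight p.+1 x * f x @[x --> (0:R)] --> (0:R).
Proof.
move=> fM; apply: norm_cvg0.
have h : fh_weight p.+1 x * M @[x --> (0:R)] --> (0:R).
  by rewrite -[X in _ --> X](mul0r M); apply: cvgM; [exact: cvg_fh_weight0|exact: cvg_cst].
apply: (squeeze_cvgr _ (cvg_cst 0) h); apply: nearW => x.
by rewrite normr_ge0 normrM (ger0_norm (fh_weight_ge0 _ _)) ler_wpM2l ?fh_weight_ge0.
Qed.

Lemma cvg_Ff0 p xi eta k al : {for 0, continuous (Ff p.+1 xi eta k al)}.
Proof.
have F0 : Ff p.+1 xi eta k al 0 = 0 by rewrite /Ff fh_weight0 mul0r.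
rewrite /prop_for /continuous_at F0.
apply: (@cvg_weight_bounded _ _ 3) => x.
rewrite (le_trans (ler_normD _ _))// !normrM.
have h1 : `|1 - cos x| <= 2 by rewrite ler_norml; have := cos_le1 x; have := cos_geN1 x; lra.
have h2 y : `|sin y| <= 1 by rewrite ler_norml sin_le1 sin_geN1.
have h3 y : `|cos y| <= 1 by rewrite ler_norml cos_le1 cos_geN1.
rewrite (_ : 3 = 2 * 1 + 1 * 1); last by ring.
apply: lerD; apply: ler_pM; rewrite ?h2 ?h3//; exact: normr_ge0.
Qed.

Lemma cvg_hf0 p xi eta k al : {for 0, continuous (hf p.+1 xi eta k al)}.
Proof.
have h0 : hf p.+1 xi eta k al 0 = 0 by rewrite /hf fh_weight0 mul0r.
rewrite /prop_for /continuous_at h0.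
pose A := `|xi / 2| + `|p.+1%:R + 1 - k + eta / 2| + `|xi / 2|.
pose B := `|p.+1%:R + k - eta / 2| + `|p.+1%:R + 1 - k + eta / 2| + `|xi / 2|.
apply: (@cvg_weight_bounded _ _ (A * 1 + B * 1)) => x.
have h2 y : `|sin y| <= 1 by rewrite ler_norml sin_le1 sin_geN1.
have h3 y : `|cos y| <= 1 by rewrite ler_norml cos_le1 cos_geN1.
have hM (u v : R) : `|v| <= 1 -> `|u * v| <= `|u| by move=> v1; rewrite normrM ler_piMr.
apply: (le_trans (ler_normD _ _)); rewrite [X in X + _]normrM [X in _ + X]normrM.
apply: lerD; apply: ler_pM; rewrite ?h2 ?h3 ?normr_ge0//.
  rewrite (le_trans (ler_normD _ _))// lerD ?hM//.
  by rewrite (le_trans (ler_normD _ _))// lerD ?hM.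
rewrite (le_trans (ler_normB _ _))// lerD ?hM//.
by rewrite (le_trans (ler_normD _ _))// lerD ?hM.
Qed.

Lemma continuous_hf p xi eta k al th : cos th < 1 ->
  {for th, continuous (hf p.+1 xi eta k al)}.
Proof.
move=> c1; have dph := is_derive_ph xi eta k al c1.
have dc := is_derive1_compf (f := @cos R) dph (is_derive_cos _).
have ds := is_derive1_compf (f := @sin R) dph (is_derive_sin _).
have e1 := is_derive1D (is_derive1D (is_derive1_cst (xi / 2) th)
  (is_derive1Z (p.+1%:R + 1 - k + eta / 2) (is_derive_sin th)))
  (is_derive1Z (xi / 2) (is_derive_cos th)).
have e2 := is_derive1D (is_derive1D (is_derive1_cst (p.+1%:R + k - eta / 2) th)
  (is_derive1Z (p.+1%:R + 1 - k + eta / 2) (is_derive_cos th)))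
  (is_derive1Z (- (xi / 2)) (is_derive_sin th)).
apply: (is_derive1_continuous (is_derive1_eq (is_derive1M (is_derive_fh_weight p th)
  (is_derive1D (is_derive1M e1 dc) (is_derive1M e2 ds))) _ erefl)) => y.
by rewrite /hf mulNr.
Qed.

Lemma within_continuous_hf p xi eta k al a b : - pi <= a -> b <= pi ->
  {within `[a, b], continuous (hf p.+1 xi eta k al)}.
Proof.
move=> pa bp; apply: continuous_in_subspaceT => x; rewrite inE/= in_itv/= => /andP[ax xb].
have [->|x0] := eqVneq x 0; first exact: cvg_hf0.
apply: continuous_hf; apply: cos_lt1 => //.
by rewrite (le_trans pa ax) (le_trans xb bp).
Qed.

Lemma Ff_continuous p xi eta k al th : - pi <= th <= pi ->
  {for th, continuous (Ff p.+1 xi eta k al)}.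
Proof.
move=> tpi; have [->|x0] := eqVneq th 0; first exact: cvg_Ff0.
exact: is_derive1_continuous (is_derive_Ff p xi eta k al (cos_lt1 tpi x0)).
Qed.

Lemma Rintegral_hf p xi eta k al a b : - pi <= a -> a < b -> b <= pi ->
  (0 \notin `]a, b[%R) ->
  \int[lebesgue_measure]_(x in `[a, b]) hf p.+1 xi eta k al x =
  Ff p.+1 xi eta k al b - Ff p.+1 xi eta k al a.
Proof.
move=> pa ab bp ab0; rewrite /Rintegral.
have d x : x \in `]a, b[%R -> is_derive x 1 (Ff p.+1 xi eta k al) (hf p.+1 xi eta k al x).
  move=> xab; apply: is_derive_Ff; apply: cos_lt1.
    move: xab; rewrite in_itv/= => /andP[ax xb].
    by rewrite (le_trans pa (ltW ax)) (le_trans (ltW xb) bp).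
  by apply: contraNneq ab0 => <-.
rewrite (@continuous_FTC2 _ _ (Ff p.+1 xi eta k al))//.
- exact: within_continuous_hf.
- split.
  + by move=> x /d [].
  + by apply: cvg_at_right_filter; apply: Ff_continuous; rewrite pa (le_trans (ltW ab)).
  + by apply: cvg_at_left_filter; apply: Ff_continuous; rewrite bp (le_trans pa (ltW ab)).
- by move=> x /d [_ <-]; rewrite derive1E.
Qed.

Lemma expi_int2pi (k : int) : expi (k%:~R * (pi *+ 2)) = 1 :> R[i].
Proof.
have h (n : nat) : expi (n%:R * (pi *+ 2)) = 1 :> R[i].
  by rewrite -expiX (_ : expi (pi *+ 2) = 1) ?expr1n// /expi cos2pi sin2pi.
case: k => n; first exact: h.
rewrite NegzE mulrNz mulNr -[LHS]mulr1 -[X in _ * X](h n.+1) -expiD addNr.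
exact: expi0.
Qed.

Lemma Rintegral_piLeb_hf p xi eta (k : int) al :
  measurable_fun setT (hf p.+1 xi eta k%:~R al) ->
  \int[piLeb]_x hf p.+1 xi eta k%:~R al x = 0.
Proof.
move=> mh; rewrite Rintegral_piLeb//.
have ih : lebesgue_measure.-integrable `[- pi, pi]
    (EFin \o hf p.+1 xi eta k%:~R al).
  apply: continuous_compact_integrable; first exact: segment_compact.
  exact: within_continuous_hf.
have pi0 := @pi_gt0 R.
have sub u v : - pi <= u -> v <= pi ->
    lebesgue_measure.-integrable `[u, v] (EFin \o hf p.+1 xi eta k%:~R al).
  move=> piu vpi; apply: integrableS ih => //; apply: subset_itv; rewrite bnd_simp//.
have -> : \int[lebesgue_measure]_(x in `]- pi, pi[) hf p.+1 xi eta k%:~R al x =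
    \int[lebesgue_measure]_(x in `[- pi, pi]) hf p.+1 xi eta k%:~R al x.
  rewrite Rintegral_itv_bndo_bndc; last first.
    by apply: integrableS ih => //; apply: subset_itv; rewrite bnd_simp.
  rewrite Rintegral_itv_obnd_cbnd//.
  by apply: integrableS ih => //; apply: subset_itv; rewrite bnd_simp.
(* [Ff] need not be differentiable at 0, so the integral is split there; continuity of [Ff] at 0
   makes the two inner boundary terms cancel. *)
have := @Rintegral_itvB R (hf p.+1 xi eta k%:~R al) (BLeft (- pi)) (BRight pi) 0 ih.
rewrite !bnd_simp oppr_le0 (ltW pi0) => /(_ isT isT) /eqP.
rewrite subr_eq => /eqP ->.
rewrite Rintegral_itv_obnd_cbnd; last first.
  by apply: integrableS ih => //; apply: subset_itv; rewrite bnd_simp// oppr_le0 ltW.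
rewrite !Rintegral_hf ?lexx ?oppr_lt0 ?oppr_le0 ?(ltW pi0)//; last 2 first.
  by rewrite in_itv/= ltxx andbF.
  by rewrite in_itv/= ltxx.
rewrite addrA subrK; apply/eqP; rewrite subr_eq0; apply/eqP.
rewrite /Ff /fh_weight cosN sinN cospi sinpi oppr0 !mul0r !addr0 /ph.
congr (_ * (_ * _)).
have -> : Lf (- pi) = Lf pi by rewrite /Lf cosN.
have -> : Af (- pi) = Af pi by rewrite /Af cosN sinN sinpi !oppr0.
set A := _ + _ * Af pi.
(* The phases at pi and -pi differ by a multiple of 2 pi because k is an integer, so the outer
   boundary terms cancel as well. *)
have e : A - k%:~R * pi + al = (A - k%:~R * - pi + al) + (- k)%:~R * (pi *+ 2).
  by rewrite mulrNz mulr2n; ring.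
have := expiD (A - k%:~R * - pi + al) ((- k)%:~R * (pi *+ 2)) : _ = _ :> R[i].
by rewrite -e expi_int2pi mulr1 => -[].
Qed.

Lemma bmeas_fh_term p xi eta (k : int) :
  bmeas (fun x => (fh_weight p x)%:C * fh_char xi eta x * expi (- (k%:~R * x))).
Proof.
apply: bmeasM; first by apply: bmeasM; [exact: bmeas_fh_weight|exact: bmeas_fh_char].
by apply: bmeas_expi; apply: measurable_funN; apply: measurable_funM.
Qed.

(* [hf] is the real part of -i e^(i al) times the integrand of the two-term
   recurrence; it vanishes where [carg (1 - expi th)] and [Af th] differ. *)
Lemma hf_Re p xi eta (k : int) al th : hf p.+1 xi eta k%:~R al th =
  complex.Re (expi (al - pi / 2) *
  ((k%:~R + ((p.+1%:R - eta / 2) +i* (xi / 2))) *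
    ((fh_weight p.+1 th)%:C * fh_char xi eta th * expi (- (k%:~R * th))) +
   (1 - k%:~R + ((p.+1%:R + eta / 2) +i* (xi / 2))) *
    ((fh_weight p.+1 th)%:C * fh_char xi eta th * expi (- ((k - 1)%:~R * th))))).
Proof.
have [c1|c1] := ltP (cos th) 1; last first.
  have w0 : fh_weight p.+1 th = 0.
    have e1 : cos th = 1 by apply/eqP; rewrite eq_le cos_le1.
    by rewrite /fh_weight e1 (_ : 2 - _ = 0) ?expr0n//; lra.
  by rewrite /hf w0 rmorph0 !mul0r !mulr0 addr0 mulr0.
have -> : expi (- ((k - 1)%:~R * th)) = expi (- (k%:~R * th)) * expi th :> R[i].
  by rewrite -expiD; congr expi; rewrite rmorphB /=; ring.
pose f := ph xi eta k%:~R al th.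
have ef : expi (al - pi / 2) * (fh_char xi eta th * expi (- (k%:~R * th))) =
    sin f +i* (- cos f) :> R[i].
  rewrite /fh_char -!expiD /fh_phase ln_normc_1subexpi carg_1subexpi//.
  transitivity (expi (f - pi / 2) : R[i]); first by congr expi; rewrite /f /ph; ring.
  by rewrite /expi cosBpihalf sinBpihalf.
set K := (k%:~R : R[i]).
have -> : K = (k%:~R)%:C by rewrite rmorph_int.
set E := expi (al - pi / 2); set G := fh_char xi eta th; set H := expi (- _).
rewrite -/G -/H -/E in ef.
rewrite (_ : _ * _ = (fh_weight p.+1 th)%:C * (E * (G * H)) *
  (((k%:~R)%:C + ((p.+1%:R - eta / 2) +i* (xi / 2))) +
   (1 - (k%:~R)%:C + ((p.+1%:R + eta / 2) +i* (xi / 2))) * expi th)); last by ring.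
by rewrite ef /hf -/f /=; ring.
Qed.

Lemma fh_coef_rec p xi eta (k : int) :
  (k%:~R + ((p.+1%:R - eta / 2) +i* (xi / 2))) * fh_coef p.+1 (fh_char xi eta) k =
  (k%:~R - 1 - ((p.+1%:R + eta / 2) +i* (xi / 2))) *
     fh_coef p.+1 (fh_char xi eta) (k - 1) :> R[i].
Proof.
set u := k%:~R + _; set v := _ - _.
pose G th : R[i] := u * ((fh_weight p.+1 th)%:C * fh_char xi eta th * expi (- (k%:~R * th))) +
   (- v) * ((fh_weight p.+1 th)%:C * fh_char xi eta th * expi (- ((k - 1)%:~R * th))).
have bG : bmeas G by apply: bmeasD; apply: bmeasZ; exact: bmeas_fh_term.
suff G0 : cint piLeb G = 0.
  move: G0; rewrite cintD; [|by apply: bmeasZ; exact: bmeas_fh_term..].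
  rewrite !cintZ; [|exact: bmeas_fh_term..].
  by rewrite mulNr => /eqP; rewrite subr_eq0 => /eqP.
(* Every rotation of the integral of [G] has real part 0; al = pi/2 gives its real part and al = 0
   its imaginary part. *)
have key al : complex.Re (expi (al - pi / 2) * cint piLeb G) = 0.
  rewrite -cintZ// -[LHS]/(\int[piLeb]_x complex.Re (expi (al - pi / 2) * G x)).
  have e : (fun x => complex.Re (expi (al - pi / 2) * G x)) = hf p.+1 xi eta k%:~R al.
    apply/funext => x; rewrite hf_Re /G; congr (complex.Re (_ * (_ + _ * _))).
    by rewrite /v; ring.
  rewrite e Rintegral_piLeb_hf// -e.
  by have [] := bmeasZ (expi (al - pi / 2)) bG.
have := key (pi / 2); rewrite subrr expi0 mul1r => k1.
have e := cReM (expi (0 - pi / 2)) (cint piLeb G).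
move: e; rewrite key k1 mulr0 !sub0r [complex.Im (expi _)]/= sinN sin_pihalf.
rewrite mulN1r opprK => k2.
by apply: complex_ext.
Qed.

End phase.

(** * Elementary bounds *)

Section elementary_bounds.
Context {R : realType}.
Implicit Types (x y : R) (z w : R[i]).

Lemma le_norm_MVT (f df : R -> R) (M : R) x : (forall t : R, is_derive t (1 : R) f (df t)) ->
  (forall t, `|t| <= `|x| -> `|df t| <= M) -> `|f x - f 0| <= M * `|x|.
Proof.
move=> fd dM.
have cf a b : {within `[a, b], continuous f}.
  by apply: continuous_subspaceT => t; exact: is_derive1_continuous (fd t).
have [x0|x0] := leP 0 x.
  have [c /[!in_itv]/= /andP[c0 cx] ->] := MVT_segment x0 (fun t _ => fd t) (@cf _ _).
  by rewrite subr0 normrM ler_wpM2r// dM// !ger0_norm.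
have [c /[!in_itv]/= /andP[c0 cx] e] := MVT_segment (ltW x0) (fun t _ => fd t) (@cf _ _).
rewrite distrC e sub0r normrM normrN ler_wpM2r// dM//.
by rewrite !ler0_norm ?lerN2// ltW.
Qed.

Lemma norm_sin_le x : `|sin x| <= `|x|.
Proof.
have := @le_norm_MVT (@sin R) (@cos R) 1 x (fun t => is_derive_sin t).
rewrite sin0 subr0 mul1r; apply => t _.
by rewrite ler_norml cos_le1 cos_geN1.
Qed.

Lemma norm_atan_le x : `|atan x| <= `|x|.
Proof.
have := @le_norm_MVT (@atan R) _ 1 x (fun t => is_derive1_atan t).
rewrite atan0 subr0 mul1r; apply => t _.
rewrite ger0_norm ?invr_ge0 ?addr_ge0 ?sqr_ge0// invf_le1.
  by rewrite lerDl sqr_ge0.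
by rewrite ltr_pwDl// sqr_ge0.
Qed.

Lemma subr1_cos x : 1 - cos x = 2 * sin (x / 2) ^+ 2.
Proof.
have -> : cos x = cos (x / 2 + x / 2) by congr cos; rewrite -splitr.
rewrite cosD -!expr2; have := cos2Dsin2 (x / 2); lra.
Qed.

Lemma subr1_cos_le x : 1 - cos x <= x ^+ 2 / 2.
Proof.
rewrite subr1_cos -[sin _ ^+ 2]real_normK ?num_real//.
have h := norm_sin_le (x / 2); have h0 := normr_ge0 (sin (x / 2)).
have : `|sin (x / 2)| ^+ 2 <= `|x / 2| ^+ 2 by rewrite lerXn2r ?nnegrE.
rewrite [`|x / 2| ^+ 2]real_normK ?num_real// => h2.
rewrite (_ : x ^+ 2 / 2 = 2 * (x / 2) ^+ 2); last by field.
by rewrite ler_wpM2l.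
Qed.

Lemma normc_expi_sub1 x : normc (expi x - 1) <= `|x|.
Proof.
rewrite -(@ler_pXn2r _ 2) ?nnegrE ?normc_ge0//.
rewrite -normcN opprB normc_1subexpi real_normK ?num_real//.
by have := subr1_cos_le x; lra.
Qed.

Lemma norm_sin_subr_le x : `|sin x - x| <= x ^+ 2 * `|x|.
Proof.
have d (t : R) : is_derive t (1 : R) (fun y => sin y + (-1) * y) (cos t + (-1) * 1).
  exact: (is_derive1D (is_derive_sin t) (is_derive1Z (-1) (is_derive1_id t))).
have := @le_norm_MVT _ _ (x ^+ 2) x d; rewrite /= sin0 mulr0 addr0 subr0 !mulN1r.
apply => t tx; rewrite distrC ger0_norm ?subr_ge0 ?cos_le1//.
apply: (le_trans (subr1_cos_le t)).
have : `|t| ^+ 2 <= `|x| ^+ 2 by rewrite lerXn2r ?nnegrE.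
rewrite !real_normK ?num_real//; have := sqr_ge0 t; lra.
Qed.

Lemma expR_le_div1B x : x < 1 -> expR x <= (1 - x)^-1.
Proof.
move=> x1; rewrite -[x in expR x]opprK expRN lef_pV2 ?posrE ?expR_gt0 ?subr_gt0//.
by have := expR_ge1Dx (- x).
Qed.

Lemma expR_bounds x : `|x| <= 2^-1 ->
  [/\ expR x <= 2, `|expR x - 1| <= 2 * `|x| & `|expR x - 1 - x| <= 2 * x ^+ 2].
Proof.
move=> x2; have x2' := x2; rewrite ler_norml in x2'.
have /andP[xl xr] := x2'.
have x1 : x < 1 by lra.
have p1 : 0 < 1 - x by lra.
have h1 := expR_le_div1B x1; have h2 := expR_ge1Dx x.
have h3 : (1 - x)^-1 <= 2 by rewrite invf_ple ?posrE//; lra.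
have h4 : (1 - x)^-1 - 1 - x <= 2 * x ^+ 2.
  rewrite (_ : (1 - x)^-1 - 1 - x = (1 - x)^-1 * x ^+ 2); first by rewrite ler_wpM2r ?sqr_ge0.
  by field; lra.
have h5 : `|expR x - 1 - x| <= 2 * x ^+ 2 by rewrite ger0_norm; lra.
split => //; first exact: le_trans h1 h3.
have -> : expR x - 1 = (expR x - 1 - x) + x by rewrite subrK.
rewrite (le_trans (ler_normD _ _))// (_ : 2 * `|x| = `|x| + `|x|); last by ring.
rewrite lerD2r (le_trans h5)// -real_normK ?num_real//.
by have := normr_ge0 x; nra.
Qed.

Lemma normc_cexp_sub z : normc z <= 2^-1 ->
  normc (cexp z - 1 - z) <= 9 * normc z ^+ 2.
Proof.
case: z => x y zn; have xn := le_trans (normc_Re _) zn; have yn := le_trans (normc_Im _) zn.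
rewrite /= in xn yn; have [e1 e2 e3] := expR_bounds xn.
have -> : normc (x +i* y) ^+ 2 = `|x| ^+ 2 + `|y| ^+ 2.
  by rewrite /= sqr_sqrtr ?addr_ge0 ?sqr_ge0// !real_normK ?num_real.
rewrite (le_trans (normc_leD _))//.
have -> : complex.Re (cexp (x +i* y) - 1 - (x +i* y)) = expR x * cos y - 1 - x.
  by rewrite /cexp /expi /=; ring.
have -> : complex.Im (cexp (x +i* y) - 1 - (x +i* y)) = expR x * sin y - y.
  by rewrite /cexp /expi /=; ring.
have s1 := norm_sin_subr_le y; have s2 := norm_sin_le y.
have c1 := subr1_cos_le y; have c0 := cos_le1 y.
rewrite -real_normK ?num_real// in e3.
rewrite -real_normK ?num_real// in s1.
rewrite -[y ^+ 2]real_normK ?num_real// in c1.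
have -> : expR x * cos y - 1 - x = (expR x - 1 - x) - expR x * (1 - cos y) by ring.
have -> : expR x * sin y - y = (expR x - 1) * sin y + (sin y - y) by ring.
have a1 := ler_normB (expR x - 1 - x) (expR x * (1 - cos y)).
have a2 := ler_normD ((expR x - 1) * sin y) (sin y - y).
rewrite [X in _ <= _ + X]ger0_norm in a1; last by rewrite mulr_ge0 ?expR_ge0 ?subr_ge0.
rewrite [X in _ <= X + _]normrM in a2.
have a3 : expR x * (1 - cos y) <= 2 * (`|y| ^+ 2 / 2).
  by rewrite ler_pM ?expR_ge0 ?subr_ge0.
have a4 : `|expR x - 1| * `|sin y| <= 2 * `|x| * `|y| by rewrite ler_pM.
have x0 := normr_ge0 x; have y0 := normr_ge0 y.
apply: (le_trans (lerD a1 a2)).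
have b3 : `|y| ^+ 2 * `|y| <= `|y| ^+ 2 * 2^-1 by rewrite ler_wpM2l ?sqr_ge0.
have ab := sqr_ge0 (`|x| - `|y|); rewrite sqrrB in ab.
have a2' := sqr_ge0 `|x|; have b2' := sqr_ge0 `|y|.
move: a3 a4 e3 s1 b3 ab a2' b2'; move: `|x| `|y| => a b; lra.
Qed.

(** Bounds of the form e^d - 1 are stable under products, because (e^d - 1) e^D + (e^D - 1) =
    e^(d+D) - 1; they can therefore be iterated over a double product. *)
Lemma normc_prod_sub1 (I : Type) (r : seq I) (F : I -> R[i]) (d : I -> R) :
  (forall i, normc (F i - 1) <= expR (d i) - 1) ->
  normc (\prod_(i <- r) F i - 1) <= expR (\sum_(i <- r) d i) - 1.
Proof.
move=> Fd; elim: r => [|i r IH].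
  by rewrite !big_nil expR0 !subrr normc0.
rewrite !big_cons expRD; set P := \prod_(j <- r) _ in IH *; set E := expR (\sum_(j <- r) _) in IH *.
rewrite (_ : F i * P - 1 = (F i - 1) * P + (P - 1)); last by ring.
rewrite (le_trans (le_normcD _ _))// normcM.
have nP : normc P <= E.
  have -> : P = (P - 1) + 1 by rewrite subrK.
  by rewrite (le_trans (le_normcD _ _))// normc1; lra.
rewrite (_ : _ * E - 1 = (expR (d i) - 1) * E + (E - 1)); last by ring.
by rewrite lerD// ler_pM ?normc_ge0.
Qed.

Lemma normc_le_expR z x : normc z <= x -> normc z <= expR x - 1.
Proof. by move=> zx; have := expR_ge1Dx x; lra. Qed.

Lemma cexpN z : cexp (- z) * cexp z = 1.
Proof. by rewrite -cexpD addNr cexp0. Qed.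

(** Compares 1 + u with e^z: the first-order gap u - z, the cross term u z, and the Taylor remainder
    9 |z|^2 multiplied by |1 + u| <= 2, whence 18. *)
Lemma normc_mul_cexp_sub1 (u z : R[i]) : normc z <= 2^-1 -> normc u <= 1 ->
  normc ((1 + u) * cexp (- z) - 1) <= normc (u - z) + normc u * normc z + 18 * normc z ^+ 2.
Proof.
move=> z2 u1; have zN : normc (- z) <= 2^-1 by rewrite normcN.
have h := normc_cexp_sub zN; rewrite normcN in h.
rewrite (_ : (1 + u) * cexp (- z) - 1 =
  (u - z) - u * z + (1 + u) * (cexp (- z) - 1 - - z)); last by ring.
rewrite (le_trans (le_normcD _ _))// lerD//.
  by rewrite (le_trans (le_normcD _ _))// normcN normcM.
rewrite normcM (_ : 18 * _ = 2 * (9 * normc z ^+ 2)); last by ring.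
rewrite ler_pM ?normc_ge0// (le_trans (le_normcD _ _))// normc1; lra.
Qed.

End elementary_bounds.

(** * Shifting the exponent of the weight *)

Section complex_cvg_inv.
Context {R : realType}.

Lemma ccvgV (u : nat -> R[i]) l : l != 0 -> ccvg u l -> ccvg (fun n => (u n)^-1) l^-1.
Proof.
move=> l0 [h1 h2].
pose D z : R := complex.Re z ^+ 2 + complex.Im z ^+ 2.
have VE z : z^-1 = (complex.Re z / D z) +i* (- (complex.Im z / D z)) by case: z.
have D0 : D l != 0.
  apply: contra l0; rewrite /D paddr_eq0 ?sqr_ge0// !sqrf_eq0 => /andP[/eqP a /eqP b].
  by apply/eqP; exact: complex_ext.
have Dl : D (u n) @[n --> \oo] --> D l.
  by apply: cvgD; rewrite !expr2; apply: cvgM.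
rewrite VE; split => /=.
- under eq_fun do rewrite VE /=.
  by apply: cvgM => //; exact: cvgV.
- under eq_fun do rewrite VE /=.
  by apply: cvgN; apply: cvgM => //; exact: cvgV.
Qed.

Lemma normc_cvg_le (u : nat -> R[i]) l B : ccvg u l ->
  (\forall n \near \oo, normc (u n) <= B) -> normc l <= B.
Proof.
move=> /normc_ccvg ul uB.
have h : B + normc (u n - l) @[n --> \oo] --> B + 0 by apply: cvgD => //; exact: cvg_cst.
rewrite addr0 in h; apply: (@ler_cvg_to _ _ _ _ (fun=> normc l) _ _ _ (cvg_cst _) h).
apply: filterS uB => n uB; rewrite [leLHS](_ : _ = normc (u n - (u n - l))); last by congr normc; ring.
by rewrite (le_trans (le_normcD _ _))// normcN lerD2r.
Qed.

End complex_cvg_inv.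

(** * The zeroth Fourier coefficient as a function of the exponent *)

Section zeroth_coefficient.
Context {R : realType}.
Implicit Types (xi eta : R) (p : nat).

Definition fh_a p xi eta : R[i] := (p%:R + eta / 2) +i* (xi / 2).
Definition fh_b p xi eta : R[i] := (p%:R - eta / 2) +i* (xi / 2).
(* c_0 of the symbol, and its value at (xi, eta) = (0, 0). *)
Definition fhc p xi eta : R[i] := fh_coef p (fh_char xi eta) 0.
Definition fhK p : R := \int[piLeb]_x fh_weight p x.

Lemma fh_abD p xi eta : fh_a p xi eta + fh_b p xi eta = (2 * p)%:R + (0 +i* xi).
Proof.
rewrite -(rmorph_nat (real_complex R)).
by apply: complex_ext; rewrite /= ?natrM; field.
Qed.

Lemma fh_aD p j xi eta : fh_a (p + j) xi eta = fh_a p xi eta + j%:R.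
Proof.
rewrite -(rmorph_nat (real_complex R)).
by apply: complex_ext; rewrite /= ?natrD; ring.
Qed.

Lemma fh_bD p j xi eta : fh_b (p + j) xi eta = fh_b p xi eta + j%:R.
Proof.
rewrite -(rmorph_nat (real_complex R)).
by apply: complex_ext; rewrite /= ?natrD; ring.
Qed.

Lemma fh_a_neq0 p xi eta i : `|eta| <= 1 -> i.+1%:R + fh_a p xi eta != 0.
Proof.
move=> e1; apply/eqP => /(congr1 (@complex.Re R)).
rewrite cReD -(rmorph_nat (real_complex R)) /= => /eqP; apply/negP.
rewrite gt_eqF//; rewrite -natr1; have := ler0n R i; have := ler0n R p.
by move: e1; rewrite ler_norml; lra.
Qed.

Lemma fh_b_neq0 p xi eta i : `|eta| <= 1 -> i.+1%:R + fh_b p xi eta != 0.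
Proof.
move=> e1; apply/eqP => /(congr1 (@complex.Re R)).
rewrite cReD -(rmorph_nat (real_complex R)) /= => /eqP; apply/negP.
rewrite gt_eqF//; rewrite -natr1; have := ler0n R i; have := ler0n R p.
by move: e1; rewrite ler_norml; lra.
Qed.

Lemma fh_weightS p (x : R) : (fh_weight p.+1 x)%:C = (fh_weight p x)%:C * (2 - expi x - expi (- x)).
Proof.
have -> : 2 - expi x - expi (- x) = (2 - 2 * cos x)%:C.
  rewrite -(rmorph_nat (real_complex R)).
  by rewrite /expi cosN sinN; apply: complex_ext => /=; ring.
by rewrite -rmorphM /fh_weight exprSr.
Qed.

(** Multiplying the weight by 2 - z - 1/z gives 2 c_0 - c_1 - c_(-1), and the two-term recurrence
    expresses both neighbours through c_0. *)
Lemma fhc_shift p xi eta : `|eta| <= 1 ->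
  (1 + fh_a p.+1 xi eta) * (1 + fh_b p.+1 xi eta) * fhc p.+2 xi eta =
  (fh_a p.+1 xi eta + fh_b p.+1 xi eta + 1) *
  (fh_a p.+1 xi eta + fh_b p.+1 xi eta + 2) * fhc p.+1 xi eta.
Proof.
move=> e1.
have -> : fhc p.+2 xi eta = 2 * fhc p.+1 xi eta +
   ((-1) * fh_coef p.+1 (fh_char xi eta) 1 + (-1) * fh_coef p.+1 (fh_char xi eta) (-1)).
  have bt k := bmeas_fh_term p.+1 xi eta k.
  rewrite /fhc /fh_coef -!cintZ; [|exact: bt..].
  rewrite -cintD; [|by apply: bmeasZ; exact: bt..].
  rewrite -cintD; [|by apply: bmeasZ; exact: bt|by apply: bmeasD; apply: bmeasZ; exact: bt].
  apply: eq_cint => x; rewrite fh_weightS.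
  have -> : - (0%:~R * x) = 0 :> R by rewrite mul0r oppr0.
  have -> : - (1%:~R * x) = - x :> R by rewrite mul1r.
  have -> : - ((-1)%:~R * x) = x :> R by rewrite mulrNz mulN1r opprK.
  by rewrite expi0; ring.
have r1 := fh_coef_rec p xi eta 1; have r2 := fh_coef_rec p xi eta 0.
rewrite -/(fh_a _ _ _) -/(fh_b _ _ _) in r1 r2.
rewrite subrr subrr sub0r in r1; rewrite !sub0r add0r in r2.
have a1 := fh_a_neq0 p.+1 xi 0 e1; have b1 := fh_b_neq0 p.+1 xi 0 e1.
rewrite -/(fhc _ _ _) in r1 r2.
have a1' : - 1 - fh_a p.+1 xi eta != 0 by rewrite -opprD oppr_eq0.
move: r1 r2 a1 b1 a1'; rewrite /fhc.
move: (fh_coef _ _ 0) (fh_coef _ _ 1) (fh_coef _ _ (-1)) (fh_a _ _ _) (fh_b _ _ _).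
move=> c0 c1 cm a b r1 r2 a1 b1 a1'.
have -> : c1 = - a * c0 / (1 + b) by rewrite -r1 mulrC mulKf.
have -> : cm = b * c0 / (- 1 - a) by rewrite r2 mulrC mulKf.
by field; rewrite a1' b1.
Qed.

Lemma fhcK p : fhc p 0 0 = (fhK p)%:C.
Proof.
rewrite /fhK -cint_real; apply: eq_cint => x.
by rewrite /fh_char /fh_phase !mul0r addr0 oppr0 expi0 !mulr1.
Qed.

Lemma fhK_ge0 p : 0 <= fhK p.
Proof. by apply: Rintegral_ge0 => x _; exact: fh_weight_ge0. Qed.

Lemma fhK_shift p : p.+2%:R ^+ 2 * fhK p.+2 = (2 * p.+1 + 1)%:R * (2 * p.+1 + 2)%:R * fhK p.+1.
Proof.
have := @fhc_shift p 0 0; rewrite normr0 => /(_ ler01); rewrite fh_abD !fhcK.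
have -> : fh_a p.+1 0 0 = (p.+1%:R)%:C :> R[i] by apply: complex_ext; rewrite /= !mul0r ?addr0.
have -> : fh_b p.+1 0 0 = (p.+1%:R)%:C :> R[i] by apply: complex_ext; rewrite /= !mul0r ?subr0.
have -> : 0 +i* 0 = 0 :> R[i] by [].
rewrite addr0 !rmorph_nat => e; apply: (@complexI R).
rewrite expr2 !rmorphM !rmorph_nat !(natrD _ (2 * p.+1)) -e.
by rewrite -[p.+2%:R]nat1r.
Qed.

Lemma fhK_gt0 p N : 0 < fhK p.+1 -> 0 < fhK (p.+1 + N).
Proof.
move=> K0; elim: N => [|N IH]; first by rewrite addn0.
have e := fhK_shift (p + N); rewrite addSn in IH; rewrite addSn addnS.
have h : 0 < (p + N).+2%:R ^+ 2 * fhK (p + N).+2.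
  by rewrite e !mulr_gt0 ?ltr0n// addn_gt0 orbT.
by rewrite pmulr_rgt0 ?exprn_gt0 in h.
Qed.

(** As (1 + cos x)/2 = 1 - (2 - 2 cos x)/4, the integral reduces to consecutive values of [fhK]. The
    resulting factor 1/(2(p+2)) measures how the weight concentrates at the angles -pi and pi as p
    grows. *)
Lemma Rintegral_fhK_q p :
  \int[piLeb]_x (fh_weight p.+1 x * ((1 + cos x) / 2)) = fhK p.+1 / (2 * p.+2%:R).
Proof.
have iW q : (@piLeb R).-integrable setT (EFin \o fh_weight q).
  exact: (bounded_integrable _ (measurable_fh_weight q) (fh_weight_le q)).
have -> : \int[@piLeb R]_x (fh_weight p.+1 x * ((1 + cos x) / 2)) =
    \int[@piLeb R]_x (fh_weight p.+1 x - 4^-1 * fh_weight p.+2 x).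
  congr (Rintegral _ _ _); apply/funext => x; rewrite /fh_weight [_ ^+ p.+2]exprS.
  by set w := _ ^+ p.+1; field.
have iZ : (@piLeb R).-integrable setT (EFin \o (fun x => 4^-1 * fh_weight p.+2 x)).
  by apply: integrable_scaler; exact: iW.
rewrite RintegralB// RintegralZl//.
rewrite -!/(fhK _).
have p2 : p.+2%:R != 0 :> R by rewrite pnatr_eq0.
have -> : fhK p.+2 = (2 * p.+1 + 1)%:R * (2 * p.+1 + 2)%:R * fhK p.+1 / p.+2%:R ^+ 2.
  by rewrite -fhK_shift mulrC mulKf// sqrf_eq0.
rewrite (_ : (2 * p.+1 + 2)%:R = 2 * p.+2%:R :> R); last by rewrite -natrM; congr (_%:R); lia.
rewrite (_ : (2 * p.+1 + 1)%:R = 2 * p.+2%:R - 1 :> R); last first.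
  by rewrite -natrM -[1 in RHS]/(1%:R) -natrB//; congr (_%:R); lia.
by field.
Qed.

(** Put q = (1 + cos x)/2. If cos x > 0 then q >= 1/2 and the trivial bound 2 is below 4 q.
    Otherwise log |1 - z| - ln 2 is of order q, while the argument is only of order sqrt q, which
    costs the additive eps. *)
Lemma fh_char_bound xi eta eps x : 0 < eps ->
  normc (fh_char xi eta x * expi (- (xi * ln 2)) - 1) <=
  eps + (4 + `|xi| + eta ^+ 2 / (2 * eps)) * ((1 + cos x) / 2).
Proof.
move=> e0; set q := (1 + cos x) / 2.
have q0 : 0 <= q by have := cos_geN1 x; rewrite /q; lra.
have E0 : 0 <= eta ^+ 2 / (2 * eps) by rewrite divr_ge0 ?sqr_ge0// mulr_ge0// ltW.
rewrite /fh_char -expiD.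
have [c0|c0] := ltP 0 (cos x).
  have h : normc (expi (fh_phase xi eta x - xi * ln 2) - 1) <= 2.
    by rewrite (le_trans (le_normcD _ _))// normcN normc1 normc_expi.
  rewrite (le_trans h)//.
  have q2 : 2^-1 <= q by rewrite /q; lra.
  have : 0 <= (`|xi| + eta ^+ 2 / (2 * eps)) * q by rewrite mulr_ge0// addr_ge0.
  rewrite -addrA mulrDl; lra.
apply: (le_trans (normc_expi_sub1 _)).
have c1 : cos x < 1 by lra.
rewrite /fh_phase ln_normc_1subexpi carg_1subexpi//.
set A := atan _.
have -> : xi * (2^-1 * ln (2 - 2 * cos x)) + eta * A - xi * ln 2 =
    xi * (2^-1 * ln (2 - 2 * cos x) - ln 2) + eta * A by ring.
rewrite (le_trans (ler_normD _ _))// !normrM.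
have q12 : q <= 2^-1 by rewrite /q; lra.
have L1 : `|2^-1 * ln (2 - 2 * cos x) - ln 2| <= q.
  have -> : 2^-1 * ln (2 - 2 * cos x) - ln 2 = 2^-1 * ln (1 - q).
    rewrite (_ : 2 - 2 * cos x = 2 ^+ 2 * (1 - q)); last by rewrite /q; field.
    rewrite lnM ?posrE ?exprn_gt0//; last by lra.
    by rewrite lnXn// mulr2n; field.
  have h1 : ln (1 - q) <= 0 by apply: ln_le0; lra.
  have p1 : 0 < 1 - q by lra.
  have h2 : - ln (1 - q) <= 2 * q.
    rewrite -lnV ?posrE// (_ : (1 - q)^-1 = 1 + q / (1 - q)); last by field; lra.
    have : -1 < q / (1 - q) by rewrite (@lt_le_trans _ _ 0)// divr_ge0// ltW.
    move=> /le_ln1Dx /le_trans; apply; rewrite ler_pdivrMr//; nra.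
  by rewrite ler_norml; lra.
have A2 : A ^+ 2 <= 2 * q.
  have : `|A| ^+ 2 <= `|- sin x / (1 - cos x)| ^+ 2.
    by rewrite lerXn2r ?nnegrE// norm_atan_le.
  rewrite !real_normK ?num_real// => /le_trans; apply.
  have s2 : sin x ^+ 2 = 1 - cos x ^+ 2 by rewrite sin2cos2.
  rewrite exprMn sqrrN s2 exprVn ler_pdivrMr ?exprn_gt0//; last by lra.
  rewrite /q; nra.
(* Arithmetic-geometric mean, |eta A| <= eps + (eta A)^2 / (4 eps), followed by A^2 <= 2 q. *)
have hA : `|eta| * `|A| <= eps + eta ^+ 2 / (2 * eps) * q.
  rewrite -normrM.
  have : `|eta * A| <= eps + (eta * A) ^+ 2 / (4 * eps).
    have e4 : 0 < 4 * eps by rewrite mulr_gt0.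
    rewrite -[(eta * A) ^+ 2]real_normK ?num_real//.
    rewrite (_ : eps + _ = (4 * eps ^+ 2 + `|eta * A| ^+ 2) / (4 * eps)); last by field; lra.
    by rewrite ler_pdivlMr//; have := sqr_ge0 (`|eta * A| - 2 * eps); nra.
  move=> /le_trans; apply; rewrite lerD2l exprMn.
  rewrite (_ : eta ^+ 2 / (2 * eps) * q = eta ^+ 2 * (2 * q) / (4 * eps)); last by field; lra.
  rewrite ler_pM2r ?invr_gt0 ?mulr_gt0//.
  by rewrite ler_wpM2l ?sqr_ge0.
have hx : `|xi| * `|2^-1 * ln (2 - 2 * cos x) - ln 2| <= `|xi| * q by rewrite ler_wpM2l.
have := lerD hx hA.
by rewrite !mulrDl; lra.
Qed.

Lemma fhc_bound p xi eta eps : 0 < eps ->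
  normc (fhc p.+1 xi eta * expi (- (xi * ln 2)) - (fhK p.+1)%:C) <=
  2 * (fhK p.+1 * (eps + (4 + `|xi| + eta ^+ 2 / (2 * eps)) / (2 * p.+2%:R))).
Proof.
move=> e0; set D := 4 + _ + _.
have bt := bmeas_fh_term p.+1 xi eta 0.
pose g x : R[i] := (fh_weight p.+1 x)%:C * (fh_char xi eta x * expi (- (xi * ln 2)) - 1).
have bg : bmeas g.
  apply: bmeasM; first exact: bmeas_fh_weight.
  apply: bmeasD; last exact: bmeas_cst.
  apply: bmeasM; [exact: bmeas_fh_char|exact: bmeas_cst].
have -> : fhc p.+1 xi eta * expi (- (xi * ln 2)) - (fhK p.+1)%:C = cint piLeb g.
  rewrite mulrC /fhc /fh_coef -cintZ// /fhK -cint_real -[- cint _ _]mulN1r.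
  rewrite -(cintZ _ _ (bmeas_fh_weight p.+1)).
  rewrite -cintD; [|exact: bmeasZ|by apply: bmeasZ; exact: bmeas_fh_weight].
  by apply: eq_cint => x; rewrite /g mul0r oppr0 expi0; ring.
have iW : (@piLeb R).-integrable setT (EFin \o fh_weight p.+1).
  exact: (bounded_integrable _ (measurable_fh_weight _) (fh_weight_le _)).
have mq : measurable_fun setT (fun x : R => fh_weight p.+1 x * ((1 + cos x) / 2)).
  apply: measurable_funM; first exact: measurable_fh_weight.
  apply: measurable_funM => //; apply: measurable_funD => //.
  by apply: continuous_measurable_fun; exact: continuous_cos.
have iq : (@piLeb R).-integrable setT (EFin \o (fun x : R => fh_weight p.+1 x * ((1 + cos x) / 2))).
  apply: (@bounded_integrable _ _ _ piLeb _ (4 ^+ p.+1)) => // x; rewrite normrM.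
  apply: le_trans (fh_weight_le p.+1 x); rewrite ler_piMr// ger0_norm.
    by have := cos_le1 x; lra.
  by have := cos_geN1 x; lra.
have := @normc_cint_le _ _ _ piLeb g
  (fun x => eps * fh_weight p.+1 x + D * (fh_weight p.+1 x * ((1 + cos x) / 2))) bg.
rewrite RintegralD//; [|exact: integrable_scaler..].
rewrite !RintegralZl// Rintegral_fhK_q -/(fhK _) => h.
rewrite (_ : fhK p.+1 * _ = eps * fhK p.+1 + D * (fhK p.+1 / (2 * p.+2%:R))); last first.
  have : p.+2%:R != 0 :> R by rewrite pnatr_eq0.
  by move: (p.+2%:R) => y y0; field.
apply: h.
  by apply: integrable_addr; exact: integrable_scaler.
move=> x; rewrite /g normcM normcR ger0_norm ?fh_weight_ge0//.
rewrite mulrCA -[eps * _]mulrC -mulrDr ler_wpM2l ?fh_weight_ge0//.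
exact: fh_char_bound.
Qed.

End zeroth_coefficient.

(** * The factors of the infinite product *)

Section factor_bounds.
Context {R : realType}.
Implicit Types (k P xi eta : R) (z w : R[i]).

Lemma normc_im xi : normc (0 +i* xi) = `|xi| :> R.
Proof. by rewrite /= expr0n add0r sqrtr_sqr. Qed.

Lemma normc_div_le z w A B : normc z <= A -> 0 < B -> B <= normc w ->
  normc (z / w) <= A / B.
Proof.
move=> zA B0 Bw; rewrite normcM normcV ler_pM ?normc_ge0 ?invr_ge0 ?normc_ge0//.
by rewrite lef_pV2 ?posrE// (lt_le_trans B0).
Qed.

Lemma le_normc_shift x xi : 0 <= x -> x <= normc (x%:C + (0 +i* xi)).
Proof.
move=> x0; apply: le_trans (normc_Re _); rewrite /= addr0.
exact: ler_norm.
Qed.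

Definition fh_kappa P xi eta : R[i] := (- (xi ^+ 2 + eta ^+ 2) / 4) +i* (P * xi).

(* The k-th rational factor of the determinant at (0, 0) over the one at (xi, eta). *)
Definition fh_factor (k P xi eta : R) : R[i] :=
  (k%:C + ((P + eta / 2) +i* (xi / 2))) * (k%:C + ((P - eta / 2) +i* (xi / 2))) *
  (k + 2 * P)%:C / ((k + P)%:C ^+ 2 * ((k + 2 * P)%:C + (0 +i* xi))).

(** Numerator minus denominator: the terms s (k + P)(k + 2P) and s (k + P)^2 nearly cancel, which
    leaves a deviation of order 1/k^2 with leading coefficient s P + t = kappa. *)
Lemma fh_factorE k P xi eta : 1 <= k -> 1 <= P ->
  let s := 0 +i* xi in let t := (- (xi ^+ 2 + eta ^+ 2) / 4)%:C in
  fh_factor k P xi eta = 1 + (s * P%:C * (k + P)%:C + t * (k + 2 * P)%:C) /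
    ((k + P)%:C ^+ 2 * ((k + 2 * P)%:C + s)).
Proof.
move=> k1 P1 s t; rewrite /fh_factor.
have d1 : (k + P)%:C != 0 :> R[i] by rewrite -normc_eq0 normcR normr_eq0 gt_eqF//; lra.
have d2 : (k + 2 * P)%:C + s != 0.
  rewrite -normc_eq0 gt_eqF//; apply: (@lt_le_trans _ _ (k + 2 * P)); first by lra.
  by apply: le_normc_shift; lra.
apply: (mulIf (mulf_neq0 (expf_neq0 2 d1) d2)).
rewrite mulfVK ?mulf_neq0 ?expf_neq0//.
rewrite [RHS]mulrDl mul1r mulfVK ?mulf_neq0 ?expf_neq0//.
by rewrite /s /t; apply: complex_ext; rewrite /=; field.
Qed.

(** With u the deviation of the factor from 1 and z = kappa / (k (k + 1)), u - z is of order d / k^3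
    and the quadratic terms are smaller. Here 21 = 8 + 13 bounds the two parts of u - z, and 19 = 1
    + 18 comes from [normc_mul_cexp_sub1]. *)
Lemma fh_factor_bound k P xi eta : 1 <= k -> 1 <= P ->
  (P + 1) * (`|xi| + `|eta|) <= 1 ->
  normc (fh_factor k P xi eta * cexp (- (fh_kappa P xi eta / (k * (k + 1))%:C)) - 1) <=
  (21 * P ^+ 3 + 19 * (P + 1)) * (`|xi| + `|eta|) / k ^+ 3.
Proof.
move=> k1 P1; set d := `|xi| + `|eta| => d1.
have k0 : 0 < k by lra.
have d0 : 0 <= d by rewrite addr_ge0.
have xd : `|xi| <= d by rewrite lerDl.
have d12 : d <= 2^-1 by nra.
set s : R[i] := 0 +i* xi; set t := (- (xi ^+ 2 + eta ^+ 2) / 4)%:C.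
have sd : normc s <= d by rewrite normc_im.
have td : normc t <= d.
  rewrite normcR mulNr normrN ger0_norm; last by rewrite divr_ge0// addr_ge0 ?sqr_ge0.
  rewrite -[xi ^+ 2]real_normK ?num_real// -[eta ^+ 2]real_normK ?num_real//.
  have x0 := normr_ge0 xi; have e0 := normr_ge0 eta; rewrite /d in d0 d12 *.
  by rewrite ler_pdivrMr//; move: x0 e0 d12; move: `|xi| `|eta| => x y; nra.
have kE : fh_kappa P xi eta = s * P%:C + t by apply: complex_ext; rewrite /=; ring.
rewrite fh_factorE// -/s -/t; clearbody t.
set u := _ / (_ * _); set z := fh_kappa P xi eta / _.
have kk : normc (fh_kappa P xi eta) <= (P + 1) * d.
  rewrite kE (le_trans (le_normcD _ _))// normcM normcR ger0_norm; last by lra.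
  by nra.
have zb : normc z <= (P + 1) * d / k ^+ 2.
  apply: normc_div_le => //; first by rewrite exprn_gt0.
  by rewrite normcR ger0_norm; nra.
have k2 : 1 <= k ^+ 2 by rewrite exprn_ege1.
have ub : normc u <= (P + 1) * d / k ^+ 2.
  apply: (@le_trans _ _ ((d * P * (k + P) + d * (k + 2 * P)) / ((k + P) ^+ 2 * (k + 2 * P)))).
    apply: normc_div_le.
    - rewrite (le_trans (le_normcD _ _))// !normcM !normcR !ger0_norm; try lra.
      have a1 : normc s * P * (k + P) <= d * P * (k + P).
        by rewrite !ler_wpM2r//; lra.
      have a2 : normc t * (k + 2 * P) <= d * (k + 2 * P) by rewrite ler_wpM2r//; lra.
      exact: (lerD a1 a2).
    - by rewrite mulr_gt0 ?exprn_gt0//; lra.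
    - rewrite normcM normcX normcR ger0_norm; last by lra.
      by rewrite ler_wpM2l ?sqr_ge0//; apply: le_normc_shift; lra.
  have -> : (d * P * (k + P) + d * (k + 2 * P)) / ((k + P) ^+ 2 * (k + 2 * P)) =
      d * P / ((k + P) * (k + 2 * P)) + d / (k + P) ^+ 2.
    by field; apply/andP; split; rewrite gt_eqF//; lra.
  have -> : (P + 1) * d / k ^+ 2 = d * P / k ^+ 2 + d / k ^+ 2 by ring.
  apply: lerD.
    apply: ler_wpM2l; first by rewrite mulr_ge0//; lra.
    by rewrite lef_pV2 ?posrE ?mulr_gt0 ?exprn_gt0//; nra.
  by apply: ler_wpM2l => //; rewrite lef_pV2 ?posrE ?exprn_gt0//; nra.
have zh : normc z <= 2^-1.
  have zb' : normc z <= (P + 1) * d / (k * (k + 1)).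
    apply: normc_div_le => //; first by nra.
    by rewrite normcR ger0_norm; nra.
  apply: (le_trans zb'); rewrite ler_pdivrMr; nra.
have uz : normc (u - z) <= 21 * P ^+ 3 * d / k ^+ 3.
  have d1' : (k + P)%:C != 0 :> R[i] by rewrite -normc_eq0 normcR normr_eq0 gt_eqF//; lra.
  have d2' : (k + 2 * P)%:C + s != 0.
    rewrite -normc_eq0 gt_eqF//; apply: (@lt_le_trans _ _ (k + 2 * P)); first by lra.
    by apply: le_normc_shift; lra.
  have d3' : k%:C != 0 :> R[i] by rewrite -normc_eq0 normcR normr_eq0 gt_eqF//; lra.
  have d4' : (k + 1)%:C != 0 :> R[i] by rewrite -normc_eq0 normcR normr_eq0 gt_eqF//; lra.
  (* Numerators of u - z over a common denominator, for the coefficients s P and t. The top powers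
     of k cancel, leaving degrees 1 over 4 and 2 over 5. *)
  pose n1 := (k - 3 * P * k - 2 * P ^+ 2)%:C - s * (k + P)%:C.
  pose n2 := ((k + 2 * P) * (k - 2 * P * k - P ^+ 2))%:C - s * ((k + P) ^+ 2)%:C.
  have -> : u - z =
     s * P%:C * (n1 / (((k + P) * (k * (k + 1)))%:C * ((k + 2 * P)%:C + s))) +
     t * (n2 / (((k + P) ^+ 2 * (k * (k + 1)))%:C * ((k + 2 * P)%:C + s))).
    rewrite /u /z kE /n1 /n2.
    move: d1' d2' d3' d4'.
    rewrite !(rmorphM, rmorphD, rmorphB, rmorphXn, rmorph1, rmorph_nat).
    move=> d1' d2' d3' d4'.
    by field; apply/and4P; split; [exact: d2'|exact: d4'|exact: d3'|exact: d1'].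
  have b1 : normc (n1 / (((k + P) * (k * (k + 1)))%:C * ((k + 2 * P)%:C + s))) <=
      8 * P ^+ 2 / k ^+ 3.
    have -> : 8 * P ^+ 2 / k ^+ 3 = 8 * P ^+ 2 * k / k ^+ 4 by field; lra.
    apply: normc_div_le.
    - rewrite (le_trans (le_normcD _ _))// normcN normcM !normcR.
      have -> : `|k - 3 * P * k - 2 * P ^+ 2| = 3 * P * k + 2 * P ^+ 2 - k.
        by rewrite ler0_norm; nra.
      rewrite [`|k + P|]ger0_norm; last by lra.
      have q1 : normc s * (k + P) <= 2^-1 * (k + P) by rewrite ler_wpM2r//; lra.
      have q2 : P <= P ^+ 2 by rewrite ler_eXnr.
      have q3 : P * k <= P ^+ 2 * k by rewrite ler_wpM2r// ltW.
      have q4 : P ^+ 2 <= P ^+ 2 * k by rewrite ler_peMr// sqr_ge0.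
      move: q1 q2 q3 q4; rewrite -!mulrA; lra.
    - by rewrite exprn_gt0.
    - rewrite normcM normcR ger0_norm; last by nra.
      have h : k + 2 * P <= normc ((k + 2 * P)%:C + s) by apply: le_normc_shift; lra.
      rewrite exprSr ler_pM ?exprn_ge0 ?(ltW k0)//; last by lra.
      rewrite !exprS expr0 mulr1 ler_pM//; [by lra|by nra|by lra|by nra].
  have b2 : normc (n2 / (((k + P) ^+ 2 * (k * (k + 1)))%:C * ((k + 2 * P)%:C + s))) <=
      13 * P ^+ 3 / k ^+ 3.
    have -> : 13 * P ^+ 3 / k ^+ 3 = 13 * P ^+ 3 * k ^+ 2 / k ^+ 5 by field; lra.
    have kP : k + P <= 2 * (P * k) by nra.
    have kP2 : k + 2 * P <= 3 * (P * k) by nra.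
    apply: normc_div_le.
    - rewrite (le_trans (le_normcD _ _))// normcN normcM !normcR normrM.
      rewrite [`|k + 2 * P|]ger0_norm; last by lra.
      rewrite [`|(k + P) ^+ 2|]ger0_norm ?sqr_ge0//.
      have e1 : `|k - 2 * P * k - P ^+ 2| <= 3 * P ^+ 2 * k.
        by rewrite ler_norml; apply/andP; split; nra.
      have e2 : (k + 2 * P) * `|k - 2 * P * k - P ^+ 2| <= 3 * (P * k) * (3 * P ^+ 2 * k).
        by rewrite ler_pM//; lra.
      have e3 : (k + P) ^+ 2 <= (2 * (P * k)) ^+ 2.
        by rewrite lerXn2r ?nnegrE//; nra.
      have e4 : normc s * (k + P) ^+ 2 <= 1 * (2 * (P * k)) ^+ 2.
        by rewrite ler_pM ?normc_ge0 ?sqr_ge0//; lra.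
      have e5 : (2 * (P * k)) ^+ 2 <= 4 * P ^+ 3 * k ^+ 2.
        have : P ^+ 2 * k ^+ 2 <= P ^+ 3 * k ^+ 2.
          by rewrite ler_wpM2r ?sqr_ge0// ler_weXn2l.
        by rewrite !exprMn; lra.
      apply: (le_trans (lerD e2 e4)); rewrite mul1r.
      rewrite (_ : 3 * (P * k) * (3 * P ^+ 2 * k) = 9 * (P ^+ 3 * k ^+ 2)); last by ring.
      move: e5; rewrite -!mulrA; lra.
    - by rewrite exprn_gt0.
    - rewrite normcM normcR ger0_norm; last by rewrite mulr_ge0 ?sqr_ge0//; nra.
      have h : k + 2 * P <= normc ((k + 2 * P)%:C + s) by apply: le_normc_shift; lra.
      rewrite exprSr ler_pM ?exprn_ge0 ?(ltW k0)//; last by lra.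
      rewrite (_ : k ^+ 4 = k ^+ 2 * (k * k)); last by ring.
      rewrite ler_pM ?sqr_ge0 ?lerXn2r ?nnegrE//; nra.
  rewrite (le_trans (le_normcD _ _))// (normcM (s * _)) (normcM s) (normcM t) normcR ger0_norm;
    last by lra.
  have g1 : normc s * P * normc (n1 / (((k + P) * (k * (k + 1)))%:C * ((k + 2 * P)%:C + s)))
      <= d * P * (8 * P ^+ 2 / k ^+ 3).
    apply: ler_pM => //; [by rewrite mulr_ge0 ?normc_ge0//; lra|exact: normc_ge0|].
    by rewrite ler_wpM2r//; lra.
  have g2 : normc t * normc (n2 / (((k + P) ^+ 2 * (k * (k + 1)))%:C * ((k + 2 * P)%:C + s)))
      <= d * (13 * P ^+ 3 / k ^+ 3).
    by apply: ler_pM; rewrite ?normc_ge0.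
  apply: (le_trans (lerD g1 g2)).
  rewrite [leLHS](_ : _ = 21 * P ^+ 3 * d / k ^+ 3)//.
  by field; lra.
have ub1 : normc u <= 1.
  apply: (le_trans ub); rewrite ler_pdivrMr; nra.
apply: (le_trans (normc_mul_cexp_sub1 zh ub1)).
(* A common bound for |u| and |z|. Since (P + 1) d <= 1, the square m * m is still at most (P + 1) d
   / k^3. *)
pose m := (P + 1) * d / k ^+ 2.
have m0 : 0 <= m by rewrite /m divr_ge0 ?exprn_ge0 ?mulr_ge0//; lra.
have m1 : m * m <= (P + 1) * d / k ^+ 3.
  have -> : m * m = ((P + 1) * d) * ((P + 1) * d) / k ^+ 4 by rewrite /m; field; lra.
  have m1 : 0 <= (P + 1) * d by rewrite mulr_ge0//; lra.
  apply: ler_pM; rewrite ?invr_ge0 ?exprn_ge0 ?mulr_ge0 ?(ltW k0)//; try lra.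
    by rewrite ler_piMr.
  by rewrite lef_pV2 ?posrE ?exprn_gt0// ler_weXn2l.
have c1 : normc u * normc z <= m * m by rewrite ler_pM ?normc_ge0.
have c2 : normc z ^+ 2 <= m * m by rewrite expr2 ler_pM ?normc_ge0.
rewrite [leRHS](_ : _ = 21 * P ^+ 3 * d / k ^+ 3 + 19 * ((P + 1) * d / k ^+ 3)); last by ring.
lra.
Qed.

Lemma ln_step_bounds k : 1 <= k -> (k + 1)^-1 <= ln (k + 1) - ln k <= k^-1.
Proof.
move=> k1; have k0 : 0 < k by lra.
have kp : 0 < k + 1 by lra.
have e1 : ln (k + 1) - ln k = ln (1 + k^-1).
  by rewrite -ln_div ?posrE//; congr ln; field; lra.
have e2 : - (ln (k + 1) - ln k) = ln (1 + - (k + 1)^-1).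
  by rewrite opprB -ln_div ?posrE//; congr ln; field; lra.
have i0 : 0 < k^-1 by rewrite invr_gt0.
have i1 : (k + 1)^-1 < 1 by rewrite invf_lt1//; lra.
have h1 : ln (1 + k^-1) <= k^-1 by apply: le_ln1Dx; lra.
have h2 : ln (1 + - (k + 1)^-1) <= - (k + 1)^-1 by apply: le_ln1Dx; lra.
by apply/andP; split; lra.
Qed.

(** 1 + i xi / (k + 2P) is compared with ((k + 1)/k)^(i xi), whose products telescope exactly. *)
Lemma fh_shift_bound k P xi : 1 <= k -> 1 <= P -> `|xi| <= 2^-1 ->
  normc ((1 + (0 +i* xi) / (k + 2 * P)%:C) *
     cexp (- (0 +i* (xi * (ln (k + 1) - ln k)))) - 1) <= (2 * P + 19) / k ^+ 2.
Proof.
move=> k1 P1 x2; have /andP[l1 l2] := ln_step_bounds k1; set L := ln (k + 1) - ln k in l1 l2 *.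
have k0 : 0 < k by lra.
have i1 : k^-1 <= 1 by rewrite invf_le1.
have i0 : 0 < k^-1 by rewrite invr_gt0.
have L0 : 0 <= L by rewrite (le_trans _ l1)// invr_ge0; lra.
set u := _ / _; set z := 0 +i* _.
have uE : u = 0 +i* (xi / (k + 2 * P)).
  rewrite /u -fmorphV /=; apply: complex_ext => /=; ring.
have zb : normc z <= `|xi| * k^-1 by rewrite normc_im normrM ler_wpM2l// ger0_norm.
have kP : 0 < k + 2 * P by lra.
have uk : (k + 2 * P)^-1 <= k^-1 by rewrite lef_pV2 ?posrE//; lra.
have uk1 : (k + 2 * P)^-1 <= (k + 1)^-1 by rewrite lef_pV2 ?posrE//; lra.
have ui : 0 < (k + 2 * P)^-1 by rewrite invr_gt0.
have ub : normc u <= `|xi| * k^-1.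
  by rewrite uE normc_im normrM ler_wpM2l// ger0_norm// ltW.
have zh : normc z <= 2^-1 by apply: (le_trans zb); nra.
have u1 : normc u <= 1 by apply: (le_trans ub); nra.
apply: (le_trans (normc_mul_cexp_sub1 zh u1)).
have uz : normc (u - z) <= 2 * P / k ^+ 2.
  have -> : u - z = 0 +i* (xi * ((k + 2 * P)^-1 - L)).
    by rewrite uE /z; apply: complex_ext => /=; ring.
  rewrite normc_im normrM.
  have hd : `|(k + 2 * P)^-1 - L| <= k^-1 - (k + 2 * P)^-1 by rewrite ler_norml; lra.
  have he : k^-1 - (k + 2 * P)^-1 <= 2 * P / k ^+ 2.
    rewrite (_ : k^-1 - _ = 2 * P / (k * (k + 2 * P))); last by field; lra.
    by rewrite ler_pM2l ?lef_pV2 ?posrE; nra.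
  have x1 : `|xi| <= 1 by lra.
  apply: (le_trans (ler_wpM2r (normr_ge0 _) x1)); lra.
have m2 : `|xi| * k^-1 <= k^-1 by have := normr_ge0 xi; nra.
have uk' := le_trans ub m2; have zk' := le_trans zb m2.
have c1 : normc u * normc z <= k^-1 * k^-1 by rewrite ler_pM ?normc_ge0.
have c2 : normc z ^+ 2 <= k^-1 * k^-1 by rewrite expr2 ler_pM ?normc_ge0.
rewrite [leRHS](_ : _ = 2 * P / k ^+ 2 + 19 * (k^-1 * k^-1)); last by field; lra.
lra.
Qed.

End factor_bounds.

(** * The infinite product *)

Section product_formula.
Context {R : realType}.
Implicit Types (xi eta : R) (p N m i : nat).

Definition fhW p xi eta i : R[i] := fh_factor i.+1%:R p%:R xi eta.

(** The ratio of a factor a + b + j of [fhc_shift] to its value at (0, 0), where a + b = 2p + i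
    xi. *)
Definition fhv p xi i : R[i] := 1 + (0 +i* xi) / (i.+1%:R + 2 * p%:R)%:C.

Lemma shift_neq0 n xi : (0 < n)%N -> n%:R + (0 +i* xi) != 0 :> R[i].
Proof.
move=> n0; apply/eqP => /(congr1 (@complex.Re R)).
rewrite cReD -(rmorph_nat (real_complex R)) /= addr0 => /eqP; apply/negP.
by rewrite pnatr_eq0 -lt0n.
Qed.

Lemma fhWE p xi eta i : fhW p xi eta i =
  (i.+1%:R + fh_a p xi eta) * (i.+1%:R + fh_b p xi eta) * (i.+1 + 2 * p)%:R /
  ((i.+1 + p)%:R ^+ 2 * ((i.+1 + 2 * p)%:R + (0 +i* xi))).
Proof.
rewrite /fhW /fh_factor -/(fh_a _ _ _) -/(fh_b _ _ _).
by rewrite -!natrM -!natrD !rmorph_nat.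
Qed.

Lemma fhvE p xi i : fhv p xi i = ((i.+1 + 2 * p)%:R + (0 +i* xi)) / (i.+1 + 2 * p)%:R.
Proof.
rewrite /fhv -natrM -natrD rmorph_nat mulrDl divff// pnatr_eq0.
Qed.

(** Iterates [fhc_shift] against [fhK_shift]. Each step produces the two factors v_(2N) and v_(2N+1)
    on the right, while W_N v_N is free of xi-shifts in its denominator; hence N factors on one side
    and 2N on the other. *)
Lemma fhc_prod p xi eta N : `|eta| <= 1 ->
  fhc (p.+1 + N) xi eta * (fhK p.+1)%:C * \prod_(i < N) fhW p.+1 xi eta i *
    \prod_(i < N) fhv p.+1 xi i =
  fhc p.+1 xi eta * (fhK (p.+1 + N))%:C * \prod_(i < N.*2) fhv p.+1 xi i.
Proof.
move=> e1; elim: N => [|N IH]; first by rewrite !big_ord0 !mulr1 addn0.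
rewrite doubleS !big_ord_recr /= addnS.
set X := \prod_(i < N) fhW _ _ _ _ in IH *.
set Y := \prod_(i < N) fhv _ _ _ in IH *.
set Z := \prod_(i < N.*2) fhv _ _ _ in IH *.
have h1 := fhc_shift (p + N) xi e1; have h2 := @fhK_shift R (p + N).
rewrite -addSn in h1 h2.
set A := fhc (p.+1 + N) xi eta in IH h1; set A' := fhc (p.+1 + N).+1 xi eta in h1 *.
have a0 := fh_a_neq0 (p.+1 + N) xi 0 e1; have b0 := fh_b_neq0 (p.+1 + N) xi 0 e1.
have A'E : A' = (fh_a (p.+1 + N) xi eta + fh_b (p.+1 + N) xi eta + 1) *
  (fh_a (p.+1 + N) xi eta + fh_b (p.+1 + N) xi eta + 2) * A /
  ((1 + fh_a (p.+1 + N) xi eta) * (1 + fh_b (p.+1 + N) xi eta)).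
  by rewrite -h1 mulrC mulKf// mulf_neq0.
have K'E : (fhK (p.+1 + N).+1)%:C = (2 * (p.+1 + N) + 1)%:R * (2 * (p.+1 + N) + 2)%:R *
   (fhK (p.+1 + N))%:C / (p.+1 + N).+1%:R ^+ 2 :> R[i].
  have n0 : (p.+1 + N).+1%:R ^+ 2 != 0 :> R[i] by rewrite expf_neq0// pnatr_eq0.
  apply: (mulIf n0); rewrite divfK//.
  rewrite -!(rmorph_nat (real_complex R)) -rmorphXn -!rmorphM; congr (_%:C).
  by rewrite [LHS]mulrC h2 -natrM.
rewrite A'E K'E fhWE !fhvE fh_abD.
have -> : N.+1%:R + fh_a p.+1 xi eta = 1 + fh_a (p.+1 + N) xi eta.
  by rewrite fh_aD -natr1; ring.
have -> : N.+1%:R + fh_b p.+1 xi eta = 1 + fh_b (p.+1 + N) xi eta.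
  by rewrite fh_bD -natr1; ring.
move: a0 b0; move: (fh_a (p.+1 + N) xi eta) (fh_b (p.+1 + N) xi eta) => a b a0 b0.
set s := 0 +i* xi.
have d1 : (N.+1 + 2 * p.+1)%:R + s != 0 by apply: shift_neq0.
have d2 : (N.+1 + 2 * p.+1)%:R != 0 :> R[i] by rewrite pnatr_eq0.
have d3 : (N.+1 + p.+1)%:R != 0 :> R[i] by rewrite pnatr_eq0.
have -> : (2 * (p.+1 + N) + 1)%:R = (N.*2.+1 + 2 * p.+1)%:R :> R[i].
  by congr (_%:R); lia.
have -> : (2 * (p.+1 + N) + 2)%:R = (N.*2.+2 + 2 * p.+1)%:R :> R[i].
  by congr (_%:R); lia.
have -> : (p.+1 + N).+1%:R = (N.+1 + p.+1)%:R :> R[i] by congr (_%:R); lia.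
have d4 : (N.*2.+1 + 2 * p.+1)%:R != 0 :> R[i] by rewrite pnatr_eq0.
have d5 : (N.*2.+2 + 2 * p.+1)%:R != 0 :> R[i] by rewrite pnatr_eq0.
have -> : (2 * (p.+1 + N))%:R + s + 1 = (N.*2.+1 + 2 * p.+1)%:R + s.
  by rewrite addrAC natr1; congr (_%:R + _); lia.
have -> : (2 * (p.+1 + N))%:R + s + 2 = (N.*2.+2 + 2 * p.+1)%:R + s.
  by rewrite addrAC -natrD; congr (_%:R + _); lia.
move: d1 d2 d3 d4 d5; move: ((N.+1 + 2 * p.+1)%:R) ((N.+1 + p.+1)%:R)
  ((N.*2.+1 + 2 * p.+1)%:R) ((N.*2.+2 + 2 * p.+1)%:R) => n1 n2 n3 n4 d1 d2 d3 d4 d5.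
transitivity ((A * (fhK p.+1)%:C * X * Y) * ((n3 + s) * (n4 + s) / n2 ^+ 2)).
  by field; rewrite a0 b0 d1 d2 d3.
by rewrite IH; field; rewrite d3 d4 d5.
Qed.

Lemma prod_cexp_ln_step xi N M :
  \prod_(N <= i < M) cexp (0 +i* (xi * (ln (i.+1%:R + 1) - ln i.+1%:R))) =
  cexp (0 +i* (xi * \sum_(N <= i < M) (ln (i.+1%:R + 1) - ln i.+1%:R))).
Proof.
elim/big_rec2: _ => [|i x y _ ->].
  by rewrite mulr0 -[0 +i* 0]/(0 : R[i]) cexp0.
by rewrite -cexpD; congr cexp; apply: complex_ext; rewrite ?cReD ?cImD /= ?addr0 ?mulrDr.
Qed.

Lemma sum_ln_step N M : (N <= M)%N ->
  \sum_(N <= i < M) (ln (i.+1%:R + 1) - ln i.+1%:R) = ln M.+1%:R - ln N.+1%:R :> R.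
Proof.
move=> NM; rewrite (eq_bigr (fun i => ln i.+2%:R - ln i.+1%:R : R)); last first.
  by move=> i _; rewrite natr1.
by rewrite (telescope_sumr (fun i => ln i.+1%:R)).
Qed.

Lemma cexp_im (x : R) : cexp (0 +i* x) = expi x.
Proof. by rewrite /cexp /= expR0 mul1r. Qed.

Lemma cvg_inv_nat (C : R) : C / n.+1%:R @[n --> \oo] --> 0.
Proof.
rewrite -[X in _ --> X](mulr0 C); apply: cvgM; first exact: cvg_cst.
exact: (@cvg_harmonic R).
Qed.

Lemma cvg_expR_sub1 (u : nat -> R) : u n @[n --> \oo] --> 0 ->
  expR (u n) - 1 @[n --> \oo] --> 0.
Proof.
move=> u0; rewrite -[X in _ --> X](subrr 1) -[X in X - _]expR0.
apply: cvgB; last exact: cvg_cst.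
by apply: (cvg_comp u expR u0); exact: continuous_expR.
Qed.

(** Up to a total error of order 1/N, the block from N to 2N equals ((2N + 1)/(N + 1))^(i xi). *)
Lemma ccvg_fhv p xi : `|xi| <= 2^-1 ->
  ccvg (fun N => \prod_(N <= i < N.*2) fhv p.+1 xi i) (expi (xi * ln 2)).
Proof.
move=> x2; pose C : R := 2 * p.+1%:R + 19.
pose z i := 0 +i* (xi * (ln (i.+1%:R + 1) - ln i.+1%:R)) : R[i].
have hb i : normc (fhv p.+1 xi i * cexp (- z i) - 1) <= C / i.+1%:R ^+ 2.
  by apply: fh_shift_bound => //; rewrite ler1n.
have C0 : 0 <= C by rewrite /C; have := ler0n R p.+1; lra.
pose y N := \prod_(N <= i < N.*2) (fhv p.+1 xi i * cexp (- z i)).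
have yb N : normc (y N - 1) <= expR (C / N.+1%:R) - 1.
  apply: (le_trans (normc_prod_sub1 _ (fun i => normc_le_expR (hb i)))).
  rewrite lerD2r ler_expR.
  apply: (@le_trans _ _ (\sum_(N <= i < N.*2) (C / N.+1%:R ^+ 2))).
    rewrite big_nat_cond [leRHS]big_nat_cond; apply: ler_sum => i /andP[/andP[Ni _] _].
    rewrite ler_wpM2l// lef_pV2 ?posrE ?exprn_gt0 ?ltr0n//.
    by rewrite lerXn2r ?nnegrE ?ler0n// ler_nat ltnS.
  rewrite sumr_const_nat -addnn addnK -[_ *+ N]mulr_natr.
  rewrite -mulrA ler_wpM2l// expr2 invfM -mulrA ler_piMr ?invr_ge0 ?ler0n//.
  by rewrite mulrC ler_pdivrMr ?ltr0n// mul1r ler_nat.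
have y1 : ccvg y 1.
  apply: ccvg_normc; apply: (squeeze_cvgr _ (cvg_cst 0) (cvg_expR_sub1 (cvg_inv_nat C))).
  by apply: nearW => N; rewrite normc_ge0 yb.
have -> : (fun N => \prod_(N <= i < N.*2) fhv p.+1 xi i) =
    (fun N => y N * expi (xi * (ln N.*2.+1%:R - ln N.+1%:R))).
  apply/funext => N; rewrite -cexp_im -sum_ln_step; last by rewrite -addnn leq_addr.
  rewrite -prod_cexp_ln_step /y -[RHS]big_split /=; apply: eq_bigr => i _.
  by rewrite -mulrA cexpN mulr1.
rewrite -[X in ccvg _ X]mul1r; apply: ccvgM => //.
have cl : xi * (ln N.*2.+1%:R - ln N.+1%:R) @[N --> \oo] --> xi * ln 2.
  apply: cvgM; first exact: cvg_cst.
  have -> : (fun N => ln N.*2.+1%:R - ln N.+1%:R) = (fun N => ln (2 - 1 / N.+1%:R : R)).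
    apply/funext => N; rewrite -ln_div ?posrE ?ltr0n//; congr ln.
    have n0 : N.+1%:R != 0 :> R by rewrite pnatr_eq0.
    apply: (mulIf n0); rewrite divfK// mulrBl divfK// -natrM -[1]/(1%:R) -natrB; last by lia.
    by congr (_%:R); lia.
  apply: (@cvg_comp _ _ _ (fun N => 2 - 1 / N.+1%:R : R) (@ln R) _ (nbhs (2 : R))).
    have := cvgB (cvg_cst (2 : R) (F := \oo)) (cvg_inv_nat 1).
    by rewrite subr0; apply.
  exact: (continuous_ln (ltr0n R 2)).
split => /=.
  by apply: (cvg_comp _ (@cos R) cl); exact: continuous_cos.
by apply: (cvg_comp _ (@sin R) cl); exact: continuous_sin.
Qed.

(** Laplace-type concentration of the weight at z = -1, where the symbol equals 2^(i xi). *)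
Lemma ccvg_fhc p xi eta : 0 < fhK (R := R) p.+1 ->
  ccvg (fun N => fhc (p.+1 + N) xi eta / (fhK (p.+1 + N))%:C) (expi (xi * ln 2)).
Proof.
move=> K0.
suff h : ccvg (fun N => fhc (p.+1 + N) xi eta / (fhK (p.+1 + N))%:C *
    expi (- (xi * ln 2))) 1.
  have -> : (fun N => fhc (p.+1 + N) xi eta / (fhK (p.+1 + N))%:C) =
    (fun N => fhc (p.+1 + N) xi eta / (fhK (p.+1 + N))%:C * expi (- (xi * ln 2)) * expi (xi * ln 2)).
    by apply/funext => N; rewrite -mulrA -expiD addNr expi0 mulr1.
  by rewrite -[X in ccvg _ X]mul1r; apply: ccvgM => //; exact: ccvg_cst.
apply: ccvg_normc; apply/cvgrPdist_lt => e e0.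
(* [fhc_bound] will give less than 2 (eps + eps) = e / 2, relative to [fhK]. *)
pose eps := e / 8; have eps0 : 0 < eps by rewrite divr_gt0.
pose D := 4 + `|xi| + eta ^+ 2 / (2 * eps).
have hD : D / n.+1%:R @[n --> \oo] --> 0 by exact: cvg_inv_nat.
move/cvgrPdist_lt: hD => /(_ _ eps0); apply: filterS => N.
have D0 : 0 <= D.
  rewrite /D !addr_ge0// divr_ge0 ?sqr_ge0// mulr_ge0// ltW//.
rewrite !sub0r !normrN => DN.
have KN := fhK_gt0 N K0.
have KN0 : (fhK (p.+1 + N))%:C != 0 :> R[i].
  by rewrite -normc_eq0 normcR normr_eq0 gt_eqF.
have -> : fhc (p.+1 + N) xi eta / (fhK (p.+1 + N))%:C * expi (- (xi * ln 2)) - 1 =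
   (fhc (p.+1 + N) xi eta * expi (- (xi * ln 2)) - (fhK (p.+1 + N))%:C) / (fhK (p.+1 + N))%:C.
  by field; rewrite KN0.
rewrite ger0_norm ?normc_ge0// normcM normcV normcR ger0_norm ?(ltW KN)//.
rewrite ltr_pdivrMr// addSn.
apply: (le_lt_trans (fhc_bound (p + N) xi eta eps0)).
rewrite -/D mulrCA [ltRHS]mulrC -addSn ltr_pM2l//.
move: DN; rewrite ger0_norm ?divr_ge0 ?ler0n// => DN.
have : D / (2 * (p.+1 + N).+1%:R) <= D / N.+1%:R.
  rewrite ler_wpM2l// lef_pV2 ?posrE ?mulr_gt0 ?ltr0n// -natrM ler_nat; lia.
move=> h; move: (le_lt_trans h DN); rewrite /eps.
by move: (D / (2 * (p.+1 + N).+1%:R)) => u; lra.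
Qed.

(* Limit of fhc_prod, in which the factors 2^(i xi) of the two sides cancel. *)
Lemma ccvg_prod_fhW p xi eta : 0 < fhK (R := R) p.+1 -> `|xi| <= 2^-1 -> `|eta| <= 1 ->
  ccvg (fun N => \prod_(i < N) fhW p.+1 xi eta i) (fhc p.+1 xi eta / (fhK p.+1)%:C).
Proof.
move=> K0 x2 e1.
have hG := ccvg_fhc xi eta K0; have hS := ccvg_fhv p x2.
have g0 : expi (xi * ln 2) != 0 :> R[i] by rewrite -normc_eq0 normc_expi oner_neq0.
have hGV := ccvgV g0 hG.
have := ccvgM (ccvgM (ccvg_cst (fhc p.+1 xi eta / (fhK p.+1)%:C)) hS) hGV.
rewrite mulfK//; apply: near_eq_ccvg.
(* The limit has modulus 1, so [fhc] is nonzero for large exponents and may be divided out. *)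
have : \forall n \near \oo, normc (fhc (p.+1 + n) xi eta / (fhK (p.+1 + n))%:C - expi (xi * ln 2)) < 1.
  have := normc_ccvg hG => /cvgrPdist_lt /(_ 1 ltr01); apply: filterS => n.
  by rewrite sub0r normrN ger0_norm ?normc_ge0.
apply: filterS => N GN.
have GN0 : fhc (p.+1 + N) xi eta / (fhK (p.+1 + N))%:C != 0.
  by apply/eqP => e; move: GN; rewrite e sub0r normcN normc_expi ltxx.
have KN := fhK_gt0 N K0.
have KN0 : (fhK (p.+1 + N))%:C != 0 :> R[i].
  by rewrite -normc_eq0 normcR normr_eq0 gt_eqF.
have KP0 : (fhK p.+1)%:C != 0 :> R[i].
  by rewrite -normc_eq0 normcR normr_eq0 gt_eqF.
have A0 : fhc (p.+1 + N) xi eta != 0.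
  by apply: contraNneq GN0 => ->; rewrite mul0r.
have V0 : \prod_(i < N) fhv p.+1 xi i != 0.
  apply/prodf_neq0 => i _; rewrite fhvE; apply: mulf_neq0; first exact: shift_neq0.
  by rewrite invr_eq0 pnatr_eq0.
have := fhc_prod p xi N e1.
have -> : \prod_(i < N.*2) fhv p.+1 xi i =
    \prod_(i < N) fhv p.+1 xi i * \prod_(N <= i < N.*2) fhv p.+1 xi i.
  rewrite -!(big_mkord xpredT (fhv p.+1 xi)) (big_cat_nat _ _ (n := N))//.
  by rewrite -addnn leq_addr.
move: A0 KN0 KP0 V0; move: (fhc _ _ _) (fhK _)%:C (\prod_(i < N) fhv _ _ _) => A B V A0 B0 K0' V0.
move=> e.
apply: (mulIf A0); apply: (mulIf K0'); apply: (mulIf V0).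
transitivity (fhc p.+1 xi eta * B * (V * \prod_(N <= i < N.*2) fhv p.+1 xi i)).
  by field; rewrite A0 B0 K0'.
by rewrite -e; ring.
Qed.

End product_formula.

(** * Asymptotics of the determinant *)

Section determinant_asymptotics.
Context {R : realType}.
Implicit Types (xi eta : R) (p N m i j : nat).

(** The determinant at (xi, eta) over the one at (0, 0), as [det_toeplitz_fh] shows. Once c_0 is an
    infinite product of the W_i, dividing by the first j of them leaves the tail from j on. *)
Definition fh_ratio p m xi eta : R[i] :=
  \prod_(j < m) (fhc p xi eta / (fhK p)%:C / \prod_(i < j) fhW p xi eta i).

Lemma mulr_prod (I : Type) (r : seq I) (Q : pred I) (F G : I -> R[i]) :
  (\prod_(i <- r | Q i) F i) * (\prod_(i <- r | Q i) G i) =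
  \prod_(i <- r | Q i) (F i * G i).
Proof. by rewrite big_split. Qed.

Lemma fhW_neq0 p xi eta i : `|eta| <= 1 -> fhW p xi eta i != 0.
Proof.
move=> e1; have a0 := fh_a_neq0 p xi i e1; have b0 := fh_b_neq0 p xi i e1.
rewrite fhWE !mulf_neq0 ?pnatr_eq0// invr_eq0 mulf_neq0 ?expf_neq0 ?pnatr_eq0//.
exact: shift_neq0.
Qed.

Lemma det_toeplitz_fh p m xi eta : `|eta| <= 1 -> 0 < fhK (R := R) p.+1 ->
  \det (toeplitz (fh_coef p.+1 (fh_char xi eta)) m) =
  \det (toeplitz (fh_coef p.+1 (fh_char 0 0)) m) * fh_ratio p.+1 m xi eta.
Proof.
move=> e1 K0.
have h x y : `|y| <= 1 -> \det (toeplitz (fh_coef p.+1 (fh_char x y)) m) =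
   fhc p.+1 x y ^+ m * \prod_(j < m) \prod_(i < j)
    (i.+1%:R * (i.+1%:R + fh_a p.+1 x y + fh_b p.+1 x y) /
     ((i.+1%:R + fh_a p.+1 x y) * (i.+1%:R + fh_b p.+1 x y))).
  move=> y1; apply: det_toeplitz => [k|i|i].
  - exact: fh_coef_rec.
  - exact: fh_a_neq0.
  - exact: fh_b_neq0.
rewrite !h// ?normr0 ?ler01// fhcK /fh_ratio.
have pw (z : R[i]) : z ^+ m = \prod_(j < m) z by rewrite prodr_const card_ord.
rewrite !pw !mulr_prod; apply: eq_bigr => j _.
rewrite -prodfV.
have KN : (fhK p.+1)%:C != 0 :> R[i] by rewrite -normc_eq0 normcR normr_eq0 gt_eqF.
set Y := \prod_(i < j) (_ * (_ + fh_a _ 0 0 + _) / _); set V := \prod_(i < j) _^-1.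
have -> : (fhK p.+1)%:C * Y * (fhc p.+1 xi eta / (fhK p.+1)%:C * V) =
   fhc p.+1 xi eta * (Y * V) by field.
rewrite mulr_prod; congr (_ * _); apply: eq_bigr => i _.
rewrite fhWE.
have -> : fh_a p.+1 0 0 = p.+1%:R :> R[i].
  by rewrite -(rmorph_nat (real_complex R)); apply: complex_ext; rewrite /= !mul0r ?addr0.
have -> : fh_b p.+1 0 0 = p.+1%:R :> R[i].
  by rewrite -(rmorph_nat (real_complex R)); apply: complex_ext; rewrite /= !mul0r ?subr0.
have -> : i.+1%:R + fh_a p.+1 xi eta + fh_b p.+1 xi eta =
   (i.+1 + 2 * p.+1)%:R + (0 +i* xi) by rewrite -addrA fh_abD natrD addrA.
have a0 := fh_a_neq0 p.+1 xi i e1; have b0 := fh_b_neq0 p.+1 xi i e1.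
have s0 : (i.+1 + 2 * p.+1)%:R + (0 +i* xi) != 0 by exact: shift_neq0.
have -> : i.+1%:R + p.+1%:R + p.+1%:R = (i.+1 + 2 * p.+1)%:R :> R[i].
  by rewrite -!natrD; congr (_%:R); lia.
rewrite -natrD.
have d1 : (i.+1 + p.+1)%:R != 0 :> R[i] by rewrite pnatr_eq0.
have d2 : (i.+1 + 2 * p.+1)%:R != 0 :> R[i] by rewrite pnatr_eq0.
move: d1 d2 s0 a0 b0; move: (_ + _)%:R ((_ + 2 * _)%:R).
move=> n1 n2; move: (n2 + _) (_ + fh_a _ _ _) (_ + fh_b _ _ _) => s a b n10 n20 s0 a0 b0.
by field; rewrite n10 n20 s0 a0 b0.
Qed.

Lemma ccvg_prod m (u : nat -> nat -> R[i]) l :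
  (forall j, ccvg (u j) (l j)) ->
  ccvg (fun N => \prod_(j < m) u j N) (\prod_(j < m) l j).
Proof.
move=> ul; elim: m => [|m IH].
  by under eq_fun do rewrite big_ord0; rewrite big_ord0; exact: ccvg_cst.
under eq_fun do rewrite big_ord_recr; rewrite big_ord_recr /=.
exact: ccvgM.
Qed.

Lemma ccvg_fh_ratio p m xi eta :
  0 < fhK (R := R) p.+1 -> `|xi| <= 2^-1 -> `|eta| <= 1 ->
  ccvg (fun N => \prod_(j < m) \prod_(j <= i < N) fhW p.+1 xi eta i)
    (fh_ratio p.+1 m xi eta).
Proof.
move=> K0 x1 e1; apply: (@ccvg_prod m (fun j N => \prod_(j <= i < N) fhW p.+1 xi eta i)
  (fun j => fhc p.+1 xi eta / (fhK p.+1)%:C / \prod_(i < j) fhW p.+1 xi eta i)) => j.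
have := ccvgM (ccvg_prod_fhW K0 x1 e1) (ccvg_cst (\prod_(i < j) fhW p.+1 xi eta i)^-1).
apply: near_eq_ccvg; exists j => // N /= jN.
have n0 : \prod_(i < j) fhW p.+1 xi eta i != 0.
  by apply/prodf_neq0 => i _; exact: fhW_neq0.
apply: (mulIf n0); rewrite mulfVK//.
rewrite -!(big_mkord xpredT (fhW p.+1 xi eta)) mulrC.
by rewrite (big_cat_nat _ _ (n := j)).
Qed.

Lemma sum_inv_pronic j N : (j <= N)%N ->
  \sum_(j <= i < N) (i.+1%:R * (i.+1%:R + 1))^-1 = j.+1%:R^-1 - N.+1%:R^-1 :> R.
Proof.
move=> jN; rewrite (@telescope_sumr_eq _ _ _ (fun i => - i.+1%:R^-1))// ?opprK 1?addrC//.
move=> i _; have := ltr0n R i.+1; have := ltr0n R i.+2; rewrite -(natr1 i.+1).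
by move: (i.+1%:R) => k a b; field; rewrite !gt_eqF.
Qed.

(** Telescoping majorant: 1/k^3 <= 2/k^2 - 2/(k + 1)^2. The next lemma uses 2/k^2 <= 4/k - 4/(k + 1)
    likewise. *)
Lemma sum_inv_cube_le j N : (j <= N)%N ->
  \sum_(j <= i < N) (i.+1%:R ^+ 3)^-1 <= 2 / j.+1%:R ^+ 2 :> R.
Proof.
move=> jN; pose f i : R := - (2 / i.+1%:R ^+ 2).
apply: (@le_trans _ _ (\sum_(j <= i < N) (f i.+1 - f i))).
  rewrite big_nat_cond [leRHS]big_nat_cond; apply: ler_sum => i _; rewrite /f.
  have k1 : 1 <= i.+1%:R :> R by rewrite ler1n.
  rewrite -(natr1 i.+1); move: (i.+1%:R) k1 => k k1.
  have k0 : k != 0 by lra.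
  have kp : k + 1 != 0 by lra.
  rewrite -subr_ge0.
  have -> : - (2 / (k + 1) ^+ 2) - - (2 / k ^+ 2) - (k ^+ 3)^-1 =
    (3 * k ^+ 2 - 1) / (k ^+ 3 * (k + 1) ^+ 2) by field; rewrite k0 kp.
  by rewrite divr_ge0 ?mulr_ge0 ?exprn_ge0//; nra.
rewrite telescope_sumr// /f opprK addrC gerDl oppr_le0 divr_ge0// exprn_ge0//.
Qed.

Lemma sum_inv_square_le m : \sum_(j < m) 2 / j.+1%:R ^+ 2 <= 4 :> R.
Proof.
rewrite -(big_mkord xpredT (fun j => 2 / j.+1%:R ^+ 2)).
pose f i : R := - (4 / i.+1%:R).
apply: (@le_trans _ _ (\sum_(0 <= i < m) (f i.+1 - f i))).
  apply: ler_sum => i _; rewrite /f.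
  have k1 : 1 <= i.+1%:R :> R by rewrite ler1n.
  rewrite -(natr1 i.+1); move: (i.+1%:R) k1 => k k1.
  have k0 : k != 0 by lra.
  have kp : k + 1 != 0 by lra.
  rewrite -subr_ge0.
  have -> : - (4 / (k + 1)) - - (4 / k) - 2 / k ^+ 2 =
    2 * (k - 1) / (k ^+ 2 * (k + 1)) by field; rewrite k0 kp.
  by rewrite divr_ge0 ?mulr_ge0 ?exprn_ge0//; lra.
rewrite telescope_sumr// /f opprK divr1 addrC gerDl oppr_le0 divr_ge0//.
Qed.

Definition harmonic_sum m : R := \sum_(j < m) j.+1%:R^-1.

Lemma cexp_prod (I : Type) (r : seq I) (F : I -> R[i]) :
  \prod_(i <- r) cexp (F i) = cexp (\sum_(i <- r) F i).
Proof. by rewrite (big_morph _ (@cexpD R) (@cexp0 R)). Qed.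

Lemma ccvg_cexp (u : nat -> R[i]) l : ccvg u l -> ccvg (fun n => cexp (u n)) (cexp l).
Proof.
move=> [u1 u2].
have e1 : expR (complex.Re (u n)) @[n --> \oo] --> expR (complex.Re l).
  by apply: (cvg_comp _ (@expR R) u1); exact: continuous_expR.
have e2 : cos (complex.Im (u n)) @[n --> \oo] --> cos (complex.Im l).
  by apply: (cvg_comp _ (@cos R) u2); exact: continuous_cos.
have e3 : sin (complex.Im (u n)) @[n --> \oo] --> sin (complex.Im l).
  by apply: (cvg_comp _ (@sin R) u2); exact: continuous_sin.
split; rewrite /cexp /=; under eq_fun do rewrite mul0r ?subr0 ?addr0.
  by rewrite mul0r subr0; exact: cvgM.
by rewrite mul0r addr0; exact: cvgM.
Qed.

(** The errors C D / (i + 1)^3, summed over i >= j and then over j < m, are at most 4 C D whatever m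
    is; the main terms add up to kappa H_m. *)
Lemma fh_ratio_bound p m xi eta :
  0 < fhK (R := R) p.+1 -> (p.+1%:R + 1) * (`|xi| + `|eta|) <= 1 ->
  normc (fh_ratio p.+1 m xi eta *
    cexp (- (fh_kappa p.+1%:R xi eta * (harmonic_sum m)%:C)) - 1) <=
  expR (4 * ((21 * p.+1%:R ^+ 3 + 19 * (p.+1%:R + 1)) * (`|xi| + `|eta|))) - 1.
Proof.
move=> K0 d1; set P : R := p.+1%:R; set k := fh_kappa _ _ _.
have P1 : 1 <= P by rewrite ler1n.
set C := 21 * _ + _; set D := `|xi| + _ in d1 *.
have D0 : 0 <= D by rewrite addr_ge0.
have D1 : 2 * D <= 1 by apply: le_trans d1; rewrite ler_wpM2r//; rewrite /P in P1; lra.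
have [x0 e0] := (normr_ge0 xi, normr_ge0 eta).
have x1 : `|xi| <= 2^-1 by rewrite /D in D1; lra.
have e1 : `|eta| <= 1 by rewrite /D in D1; lra.
have CD0 : 0 <= C * D.
  by rewrite mulr_ge0 ?addr_ge0 ?mulr_ge0 ?exprn_ge0//; lra.
pose y i := fhW p.+1 xi eta i * cexp (- (k / (i.+1%:R * (i.+1%:R + 1))%:C)).
have hy i : normc (y i - 1) <= expR (C * D / i.+1%:R ^+ 3) - 1.
  by apply: normc_le_expR; apply: fh_factor_bound => //; rewrite ler1n.
have sE j N : (j <= N)%N -> \sum_(j <= i < N) - (k / (i.+1%:R * (i.+1%:R + 1))%:C) =
   - (k * (j.+1%:R^-1 - N.+1%:R^-1)%:C).
  move=> jN; rewrite sumrN; congr (- _); rewrite -sum_inv_pronic// rmorph_sum mulr_sumr.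
  by apply: eq_bigr => i _; rewrite fmorphV.
(* Stopped at N, the exponent is kappa (H_m - m / (N + 1)); the correction disappears as N grows
   with m fixed. *)
have hN N : (m <= N)%N -> normc ((\prod_(j < m) \prod_(j <= i < N) fhW p.+1 xi eta i) *
    cexp (- (k * (\sum_(j < m) (j.+1%:R^-1 - N.+1%:R^-1))%:C)) - 1) <= expR (4 * (C * D)) - 1.
  move=> mN.
  have -> : (\prod_(j < m) \prod_(j <= i < N) fhW p.+1 xi eta i) *
    cexp (- (k * (\sum_(j < m) (j.+1%:R^-1 - N.+1%:R^-1))%:C)) =
    \prod_(j < m) \prod_(j <= i < N) y i.
    rewrite rmorph_sum mulr_sumr -sumrN -cexp_prod mulr_prod.
    apply: eq_bigr => j _; rewrite /y -mulr_prod cexp_prod sE//.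
    by rewrite (leq_trans _ mN)// ltnW.
  apply: (le_trans (normc_prod_sub1 _ (d := fun j : 'I_m => \sum_(j <= i < N) C * D / i.+1%:R ^+ 3) _)).
    by move=> j; exact: normc_prod_sub1.
  rewrite lerD2r ler_expR.
  apply: (@le_trans _ _ (\sum_(j < m) C * D * (2 / j.+1%:R ^+ 2))).
    apply: ler_sum => j _; rewrite -mulr_sumr ler_wpM2l// sum_inv_cube_le//.
    by rewrite (leq_trans _ mN)// ltnW.
  by rewrite -mulr_sumr mulrC ler_wpM2r// sum_inv_square_le.
apply: (@normc_cvg_le _ (fun N => (\prod_(j < m) \prod_(j <= i < N) fhW p.+1 xi eta i) *
    cexp (- (k * (\sum_(j < m) (j.+1%:R^-1 - N.+1%:R^-1))%:C)) - 1)); last first.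
  by exists m.
apply: ccvgD; last exact: ccvg_cst.
apply: ccvgM; first exact: ccvg_fh_ratio.
apply: ccvg_cexp; rewrite -[X in ccvg _ X]mulN1r; under eq_fun do rewrite -mulN1r.
apply: ccvgM; first exact: ccvg_cst.
apply: ccvgM; first exact: ccvg_cst.
split => /=; last exact: cvg_cst.
have -> : (fun N => \sum_(j < m) (j.+1%:R^-1 - N.+1%:R^-1)) =
   (fun N => harmonic_sum m - m%:R / N.+1%:R).
  by apply/funext => N; rewrite sumrB sumr_const card_ord mulr_natl.
rewrite -[X in _ --> X]subr0; apply: cvgB; first exact: cvg_cst.
exact: cvg_inv_nat.
Qed.

End determinant_asymptotics.

(** * The logarithmic scale *)

Section logarithmic_scale.
Context {R : realType}.
Implicit Types (s t : R) (p n m : nat).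

Lemma harmonic_sum_ln m : 0 <= harmonic_sum m - ln (m.+1%:R : R) <= 1.
Proof.
(* The sharper upper bound is what the induction preserves: a step adds at most 1/(m + 1) - 1/(m +
   2). *)
have h : 0 <= harmonic_sum m - ln (m.+1%:R : R) <= 1 - m.+1%:R^-1.
  elim: m => [|m IH]; first by rewrite /harmonic_sum big_ord0 ln1 invr1 !subrr lexx.
  have k1 : 1 <= m.+1%:R :> R by rewrite ler1n.
  rewrite /harmonic_sum big_ord_recr -/(harmonic_sum m) /= -(natr1 m.+1).
  have := ln_step_bounds k1; move: IH.
  move: (ln _) (ln _) (_^-1) (_^-1) => a b c d; lra.
have : 0 <= m.+1%:R^-1 :> R by rewrite invr_ge0.
by move: h; move: (_ - _) (_^-1) => a b; lra.
Qed.

(** With m = n - (p + 1), one has m + 1 <= n <= (m + 1)(p + 1): dropping the fixed eigenvalues costs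
    a bounded amount. *)
Lemma harmonic_sum_subn p n : (p < n)%N ->
  `|harmonic_sum (n - p.+1) - ln (n%:R : R)| <= 1 + ln p.+1%:R.
Proof.
move=> pn; have := harmonic_sum_ln (n - p.+1); set m := (n - p.+1)%N.
have nE : n = (m + p.+1)%N by rewrite /m subnK.
have l1 : ln m.+1%:R <= ln n%:R :> R.
  by rewrite ler_ln ?posrE ?ltr0n ?ler_nat; lia.
have l2 : ln n%:R <= ln m.+1%:R + ln p.+1%:R :> R.
  rewrite -lnM ?posrE ?ltr0n// -natrM ler_ln ?posrE ?ltr0n ?ler_nat; nia.
by rewrite ler_norml; lra.
Qed.

(** For n <= 1 the logarithm is 0 and the inverse defaults to 0, so [ln_mul_rsln] holds for every
    n. *)
Definition rsln n : R := (Num.sqrt (ln n%:R))^-1.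

Lemma rsln_ge0 n : 0 <= rsln n.
Proof. by rewrite invr_ge0 sqrtr_ge0. Qed.

Lemma cvg_rsln : rsln n @[n --> \oo] --> 0.
Proof.
apply/cvgrPdist_lt => e e0; near=> n.
rewrite sub0r normrN ger0_norm ?rsln_ge0// /rsln.
have h : e ^- 2 < ln n%:R.
  rewrite -[X in X < _]expRK ltr_ln ?posrE ?expR_gt0//.
    by near: n; exact: nbhs_infty_gtr.
  by rewrite ltr0n; near: n; exists 1%N.
have ep : 0 < e^-1 by rewrite invr_gt0.
have : e^-1 < Num.sqrt (ln n%:R).
  by rewrite -[X in X < _]ger0_norm ?(ltW ep)// -sqrtr_sqr ltr_sqrt ?exprVn// (lt_trans _ h)// invr_gt0 exprn_gt0.
move=> h2; rewrite -(invrK e) ltf_pV2 ?posrE//; exact: lt_trans h2.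
Unshelve. all: by end_near. Qed.

Lemma ln_mul_rsln n : ln n%:R * rsln n = Num.sqrt (ln n%:R) :> R.
Proof.
have n0 : 0 <= ln n%:R :> R.
  by case: n => [|n]; [rewrite ln0|rewrite ln_ge0// ler1n].
rewrite /rsln; have [->|s0] := eqVneq (Num.sqrt (ln n%:R : R)) 0.
  by rewrite invr0 mulr0.
by rewrite -{1}(sqr_sqrtr n0) expr2 mulfK.
Qed.

Lemma cvg_mul_bounded (u v : nat -> R) B :
  (\forall n \near \oo, `|u n| <= B) -> v n @[n --> \oo] --> 0 ->
  u n * v n @[n --> \oo] --> 0.
Proof.
move=> uB v0.
have h : B * `|v n| @[n --> \oo] --> 0.
  rewrite -[X in _ --> X](mulr0 B); apply: cvgM; first exact: cvg_cst.
  by rewrite -[X in _ --> X](@normr0 _ R); exact: cvg_norm.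
have h' : - (B * `|v n|) @[n --> \oo] --> 0 by rewrite -oppr0; exact: cvgN.
apply: (squeeze_cvgr _ h' h); apply: filterS uB => n un.
by rewrite -ler_norml normrM ler_wpM2r.
Qed.

(** Two limits suffice: H rsln^2 -> 1 turns the real part of kappa H into - (s^2 + t^2)/4, and (H -
    ln n) rsln -> 0 lets the centring cancel its imaginary part. *)
Lemma ccvg_fh_ratio_ln p s t : 0 < fhK (R := R) p.+1 ->
  ccvg (fun n => expi (- (p.+1%:R * s * Num.sqrt (ln n%:R))) *
     fh_ratio p.+1 (n - p.+1) (s * rsln n) (t * rsln n))
   (expR (- (s ^+ 2 + t ^+ 2) / 4))%:C.
Proof.
move=> K0; set P : R := p.+1%:R.
pose H n : R := harmonic_sum (n - p.+1).
pose kH n := fh_kappa P (s * rsln n) (t * rsln n) * (H n)%:C.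
pose D := `|s| + `|t|.
have DE n : `|s * rsln n| + `|t * rsln n| = D * rsln n.
  by rewrite !normrM (ger0_norm (rsln_ge0 n)) mulrDl.
have c0 (c : R) : c * rsln n @[n --> \oo] --> 0.
  by rewrite -[X in _ --> X](mulr0 c); apply: cvgM; [exact: cvg_cst|exact: cvg_rsln].
have hW : ccvg (fun n => fh_ratio p.+1 (n - p.+1) (s * rsln n) (t * rsln n) * cexp (- kH n)) 1.
  apply: ccvg_normc.
  have h := cvg_expR_sub1 (c0 (4 * ((21 * P ^+ 3 + 19 * (P + 1)) * D))).
  apply: (squeeze_cvgr _ (cvg_cst 0) h).
  have := c0 ((P + 1) * D) => /cvgr_lt /(_ 1 ltr01); apply: filterS => n hn.
  rewrite normc_ge0 /=; apply: (le_trans (fh_ratio_bound _ K0 _)).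
    by rewrite DE mulrA ltW.
  by rewrite DE !mulrA.
have hB : \forall n \near \oo, `|H n - ln n%:R| <= 1 + ln p.+1%:R.
  by exists p.+1 => // n /= pn; exact: harmonic_sum_subn.
have e1 : (H n - ln n%:R) * rsln n @[n --> \oo] --> 0.
  exact: cvg_mul_bounded hB cvg_rsln.
have e2 : H n * rsln n ^+ 2 @[n --> \oo] --> (1 : R).
  have : (H n - ln n%:R) * rsln n * rsln n + 1 @[n --> \oo] --> (0 * 0 + 1 : R).
    apply: cvgD; last exact: cvg_cst.
    by apply: cvgM => //; exact: cvg_rsln.
  rewrite mul0r add0r; apply: cvg_trans; apply: near_eq_cvg.
  exists 2%N => // n /= n2.
  have l0 : 0 < ln n%:R :> R by rewrite ln_gt0// ltr1n.
  have : ln n%:R * rsln n * rsln n = 1.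
    by rewrite ln_mul_rsln mulfV// gt_eqF// sqrtr_gt0.
  by move: (ln _) => l l1; rewrite -[X in _ + X]l1; ring.
have e3 : ccvg (fun n => cexp (kH n) * expi (- (P * s * Num.sqrt (ln n%:R))))
    (expR (- (s ^+ 2 + t ^+ 2) / 4))%:C.
  have -> : (expR (- (s ^+ 2 + t ^+ 2) / 4))%:C = cexp ((- (s ^+ 2 + t ^+ 2) / 4)%:C).
    by rewrite /cexp /= expi0 mulr1.
  under eq_fun do rewrite -cexp_im -cexpD.
  apply: ccvg_cexp; split => /=.
    under eq_fun do rewrite mulr0 subr0 addr0.
    have -> : (fun n => - ((s * rsln n) ^+ 2 + (t * rsln n) ^+ 2) / 4 * H n) =
       (fun n => (- (s ^+ 2 + t ^+ 2) / 4) * (H n * rsln n ^+ 2)).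
      by apply/funext => n; ring.
    have := cvgM (cvg_cst (- (s ^+ 2 + t ^+ 2) / 4) (F := \oo)) e2.
    by rewrite mulr1; apply.
  under eq_fun do rewrite mulr0 add0r.
  have -> : (fun n => P * (s * rsln n) * H n - P * s * Num.sqrt (ln n%:R)) =
     (fun n => P * s * ((H n - ln n%:R) * rsln n)).
    by apply/funext => n; rewrite -ln_mul_rsln; ring.
  have := cvgM (cvg_cst (P * s) (F := \oo)) e1.
  by rewrite mulr0; apply.
have := ccvgM hW e3; rewrite mul1r; apply: near_eq_ccvg; apply: nearW => n.
rewrite mulrA -[X in X * expi _]mulrA cexpN mulr1 mulrC//.
Qed.

End logarithmic_scale.

(** * The Gaussian characteristic function *)

Section truncated_gaussian_transform.
Context {R : realType}.
Local Notation leb := (@lebesgue_measure R).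
Implicit Types (s t al x : R) (n : nat).

Definition gaussf x : R := expR (- (x ^+ 2 / 2)).

Lemma normal_pdf01E x : normal_pdf 0 1 x = normal_peak 1 * gaussf x :> R.
Proof.
rewrite normal_pdfE ?oner_neq0// /normal_fun /gaussf subr0 expr1n mulNr.
by rewrite mulr2n.
Qed.

Lemma is_derive_gaussf x : is_derive x 1 gaussf (- x * gaussf x).
Proof.
have h := is_derive1Z (- 2^-1) (is_derive1X 1 (is_derive1_id x)).
apply: (is_derive1_eq (is_derive1_compf (f := @expR R) h (is_derive_expR _))) => [y|].
  by rewrite /gaussf; congr expR; ring.
rewrite /gaussf expr1; have -> : - 2^-1 * x ^+ 2 = - (x ^+ 2 / 2) by ring.
by field.
Qed.

Lemma is_derive_linear s al x : is_derive x (1 : R) (fun y : R => s * y + al) s.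
Proof.
apply: (is_derive1_eq (is_derive1D (is_derive1Z s (is_derive1_id x)) (is_derive1_cst al x))) => //.
by rewrite mulr1 addr0.
Qed.

Lemma gaussf_continuous : continuous gaussf.
Proof. by move=> x; exact: is_derive1_continuous (is_derive_gaussf x). Qed.

Lemma gaussf_ge0 x : 0 <= gaussf x. Proof. exact: expR_ge0. Qed.

Lemma gaussf_le1 x : gaussf x <= 1.
Proof.
by rewrite /gaussf -[leRHS]expR0 ler_expR oppr_le0 divr_ge0 ?sqr_ge0.
Qed.

Lemma cos_linear_continuous s al : continuous (fun x => cos (s * x + al)).
Proof.
by move=> x; exact: is_derive1_continuous
  (is_derive1_compf (f := @cos R) (is_derive_linear s al x) (is_derive_cos _)).
Qed.

Lemma sin_linear_continuous s al : continuous (fun x => sin (s * x + al)).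
Proof.
by move=> x; exact: is_derive1_continuous
  (is_derive1_compf (f := @sin R) (is_derive_linear s al x) (is_derive_sin _)).
Qed.

Lemma integrable_itv_continuous (f : R -> R) a b : continuous f ->
  leb.-integrable `[a, b] (EFin \o f).
Proof.
move=> cf; apply: continuous_compact_integrable; first exact: segment_compact.
exact: continuous_subspaceT.
Qed.

(** Truncated to a compact interval, so that differentiation under the integral and integration by
    parts need no control at infinity. *)
Definition gaussJ n al s : R :=
  \int[leb]_(x in `[- n%:R, n%:R]) (cos (s * x + al) * gaussf x).

Lemma Rintegral_deriv (F f : R -> R) a b : a < b -> continuous f ->
  (forall x, is_derive x 1 F (f x)) -> \int[leb]_(x in `[a, b]) f x = F b - F a.
Proof.
move=> ab cf dF; rewrite /Rintegral (@continuous_FTC2 _ f F a b ab)//.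
- exact: continuous_subspaceT.
- split.
  + by move=> x _; have [] := dF x.
  + by apply: cvg_at_right_filter; exact: is_derive1_continuous (dF a).
  + by apply: cvg_at_left_filter; exact: is_derive1_continuous (dF b).
- by move=> x _; rewrite derive1E; have [_ ->] := dF x.
Qed.

(** The differential equation J' = - s J of the Gaussian transform, up to the boundary term left by
    truncation. *)
Lemma is_derive_gaussJ n al s : (0 < n)%N -> is_derive s 1 (gaussJ n al)
  ((sin (s * n%:R + al) - sin (s * - n%:R + al)) * gaussf n%:R - s * gaussJ n al s).
Proof.
move=> n0; pose f t x : R := cos (t * x + al) * gaussf x.
pose B : set (measurableTypeR R) := `[- n%:R, n%:R].
have mB : measurable B by exact: measurable_itv.
have cf t : continuous (f t).
  by move=> x; apply: cvgM; [exact: cos_linear_continuous|exact: gaussf_continuous].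
have df t x : is_derive t 1 (f^~ x) (- x * sin (t * x + al) * gaussf x).
  have h : is_derive t 1 (fun u : R => u * x + al) x.
    apply: (is_derive1_eq (is_derive_linear x al t)) => // y.
    by rewrite mulrC.
  have hc := is_derive1_compf (f := @cos R) h (is_derive_cos _).
  apply: (is_derive1_eq (is_derive1M hc (is_derive1_cst (gaussf x) t))) => //.
  by rewrite mulr0 addr0; ring.
have pE t x : partial1of2 f t x = - x * sin (t * x + al) * gaussf x.
  by rewrite /partial1of2 derive1E; have [_ ->] := df t x.
pose I : set R := `]s - 1, s + 1[.
have Is : I s by rewrite /I/= in_itv/=; lra.
have intf x : I x -> leb.-integrable B (EFin \o f x).
  by move=> _; exact: integrable_itv_continuous.
have derf1 x y : I x -> B y -> derivable (f ^~ y) x 1.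
  by move=> _ _; have [] := df x y.
have G0 (y : measurableTypeR R) : 0 <= (n%:R : R) by [].
have intG : leb.-integrable B (EFin \o (fun=> n%:R)).
  by apply: integrable_itv_continuous => x; exact: cvg_cst.
have Gub x y : I x -> B y -> `|partial1of2 f x y| <= n%:R.
  move=> _; rewrite /B/= in_itv/= => /andP[y1 y2].
  rewrite pE !normrM normrN (ger0_norm (gaussf_ge0 _)).
  have yn : `|y| <= n%:R by rewrite ler_norml y1.
  rewrite -[leRHS]mulr1 ler_pM ?mulr_ge0 ?gaussf_ge0 ?gaussf_le1//.
  by rewrite -[leRHS]mulr1 ler_pM// ler_norml sin_le1 sin_geN1.
have d1 := derivable_under_integral mB Is intf derf1 G0 intG Gub.
have d2 := differentiation_under_integral mB Is intf derf1 G0 intG Gub.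
split; first exact: d1.
rewrite -derive1E [LHS]d2.
have cs : continuous (fun x => - x * sin (s * x + al) * gaussf x).
  move=> x; apply: cvgM; last exact: gaussf_continuous.
  by apply: cvgM; [apply: cvgN; exact: cvg_id|exact: sin_linear_continuous].
have cc : continuous (fun x => s * (cos (s * x + al) * gaussf x)).
  by move=> x; apply: cvgM; [exact: cvg_cst|exact: cf].
under eq_Rintegral do rewrite pE.
have -> : s * gaussJ n al s = \int[leb]_(x in B) (s * (cos (s * x + al) * gaussf x)).
  by rewrite RintegralZl//; exact: (intf s Is).
apply/eqP; rewrite eq_sym subr_eq -RintegralD//; last 2 first.
- exact: (@integrable_itv_continuous _ (- n%:R) n%:R cs).
- exact: (@integrable_itv_continuous _ (- n%:R) n%:R cc).
have gE : gaussf (- n%:R) = gaussf n%:R by rewrite /gaussf sqrrN.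
rewrite mulrBl -[in X in _ - X]gE; apply/eqP/esym.
(* The integrands of J' and s J add up to the derivative of sin (s x + al) gaussf x. *)
apply: (Rintegral_deriv (F := fun x => sin (s * x + al) * gaussf x)).
- by rewrite ltrNl gtrN// ltr0n.
- by move=> x; apply: cvgD; [exact: cs|exact: cc].
- move=> x; have hs := is_derive1_compf (f := @sin R) (is_derive_linear s al x) (is_derive_sin _).
  by apply: (is_derive1_eq (is_derive1M hs (is_derive_gaussf x))) => //; ring.
Qed.

(** After multiplication by the integrating factor e^(s^2/2), the derivative reduces to the boundary
    term, of size [gaussf n]. *)
Lemma gaussJ_bound n al s : (0 < n)%N ->
  `|gaussJ n al s * expR (s ^+ 2 / 2) - gaussJ n al 0| <=
  2 * gaussf n%:R * expR (s ^+ 2 / 2) * `|s|.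
Proof.
move=> n0.
have de t : is_derive t 1 (fun u : R => expR (u ^+ 2 / 2)) (t * expR (t ^+ 2 / 2)).
  have h := is_derive1Z 2^-1 (is_derive1X 1 (is_derive1_id t)).
  apply: (is_derive1_eq (is_derive1_compf (f := @expR R) h (is_derive_expR _))) => [y|].
    by congr expR; ring.
  by rewrite expr1 (_ : 2^-1 * t ^+ 2 = t ^+ 2 / 2) 1?mulrC//; field.
have dh t : is_derive t 1 (fun u => gaussJ n al u * expR (u ^+ 2 / 2))
  ((sin (t * n%:R + al) - sin (t * - n%:R + al)) * gaussf n%:R * expR (t ^+ 2 / 2)).
  apply: (is_derive1_eq (is_derive1M (is_derive_gaussJ al t n0) (de t))) => //; ring.
have := @le_norm_MVT _ _ _ (2 * gaussf n%:R * expR (s ^+ 2 / 2)) s dh.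
rewrite expr0n/= mul0r expR0 mulr1; apply => t ts.
rewrite !normrM (ger0_norm (gaussf_ge0 _)) (ger0_norm (expR_ge0 _)).
rewrite ler_pM ?mulr_ge0 ?gaussf_ge0 ?expR_ge0//.
  rewrite ler_wpM2r ?gaussf_ge0// (le_trans (ler_normB _ _))// (_ : 2 = 1 + 1)// lerD//;
    by rewrite ler_norml sin_le1 sin_geN1.
by rewrite ler_expR ler_wpM2r// -(real_normK (num_real t)) -(real_normK (num_real s)) lerXn2r ?nnegrE.
Qed.

End truncated_gaussian_transform.

Section normal_characteristic_function.
Context {R : realType} d (T : measurableType d) (P : probability T R) (N : {RV P >-> R}).
Hypothesis hN : is_normal 0 1 N.
Local Notation leb := (@lebesgue_measure R).

Lemma Rintegral_normal (f : R -> R) : measurable_fun setT f ->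
  (exists M, forall x, `|f x| <= M) ->
  \int[P]_w f (N w) = \int[leb]_x (f x * normal_pdf 0 1 x).
Proof.
move=> mf [M fM].
(* The same function, with values in the space that carries Lebesgue measure and the normal
   density. *)
pose N' : T -> measurableTypeR R := N.
have mN' : measurable_fun setT N' by have mN : measurable_fun setT N by []; move=> mT A mA; exact: (mN mT A mA).
pose fN : {mfun T >-> measurableTypeR R} := HB.pack N' (isMeasurableFun.Build _ _ _ _ _ mN').
pose mu : {finite_measure set (measurableTypeR R) -> \bar R} := fpush P fN.
have hd (A : set (measurableTypeR R)) : measurable A ->
    mu A = (\int[leb]_(x in A) (normal_pdf 0 1 x)%:E)%E.
  by move=> mA; exact: (hN mA).
have := @integral_density _ _ (measurableTypeR R) leb mu (normal_pdf 0 1)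
  (@measurable_normal_pdf _ 0 1) (normal_pdf_ge0 0 1) hd f mf.
rewrite /Rintegral => <-; congr fine.
rewrite [RHS](@integral_pushforward _ _ _ _ _ _ mN' P)//.
- exact/measurable_EFinP.
- rewrite preimage_setT; apply: (@bounded_integrable _ _ _ P (f \o N) M) => [|x]; last exact: fM.
  exact: measurableT_comp.
Qed.

Lemma Rintegral_normal_itv n al s :
  \int[P]_w (cos (s * N w + al) * \1_(`[- n%:R, n%:R]%classic : set R) (N w)) =
  normal_peak 1 * gaussJ n al s.
Proof.
have mB : measurable (`[- n%:R, n%:R]%classic : set R) by exact: measurable_itv.
have cf : continuous (fun x => cos (s * x + al) * gaussf x).
  by move=> x; apply: cvgM; [exact: cos_linear_continuous|exact: gaussf_continuous].
rewrite (@Rintegral_normal (fun x => cos (s * x + al) * \1_(`[- n%:R, n%:R]%classic : set R) x)).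
- rewrite /gaussJ -RintegralZl//; last exact: (@integrable_itv_continuous _ _ _ _ cf).
  rewrite [RHS]Rintegral_mkcond; apply: eq_Rintegral => x _.
  rewrite normal_pdf01E patchE indicE; case: (x \in _); rewrite /=; first by ring.
  by rewrite mulr0 mul0r.
- apply: measurable_funM; last exact: measurable_indic.
  by apply: continuous_measurable_fun; exact: cos_linear_continuous.
- exists 1 => x; rewrite normrM -[leRHS]mulr1 ler_pM//.
    by rewrite ler_norml cos_le1 cos_geN1.
  by rewrite indicE; case: (x \in _); rewrite ?normr1 ?normr0.
Qed.

Lemma cvg_Rintegral_normal_itv al s :
  normal_peak 1 * gaussJ n al s @[n --> \oo] --> \int[P]_w cos (s * N w + al).
Proof.
pose ind n x : R := \1_(`[- n%:R, n%:R]%classic : set R) x.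
have mc : measurable_fun setT (fun w => cos (s * N w + al)).
  apply: (measurableT_comp (f := fun x : R => cos (s * x + al))) => //.
  by apply: continuous_measurable_fun; exact: cos_linear_continuous.
have mi n : measurable_fun setT (fun w => ind n (N w)).
  apply: (measurableT_comp (f := ind n)) => //.
  by apply: measurable_indic; exact: measurable_itv.
have c1 x : `|cos x| <= 1 :> R by rewrite ler_norml cos_le1 cos_geN1.
have i1 n x : `|ind n x| <= 1.
  by rewrite /ind indicE; case: (x \in _); rewrite ?normr1 ?normr0.
have ci n w : `|cos (s * N w + al) * ind n (N w)| <= 1.
  by rewrite normrM -[leRHS]mulr1 ler_pM.
have := @cint_cvg _ _ _ P (fun n w => (cos (s * N w + al) * ind n (N w))%:C)
  (fun w => (cos (s * N w + al))%:C) 1.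
move=> /(_ (fun n => bmeas_real (measurable_funM mc (mi n)) (ci n)) (bmeas_real mc (fun=> c1 _))).
have hn n w : normc (cos (s * N w + al) * ind n (N w))%:C <= 1 by rewrite normcR.
move=> /(_ hn); have hc w : ccvg (fun n => (cos (s * N w + al) * ind n (N w))%:C) (cos (s * N w + al))%:C.
  apply: near_eq_ccvg (ccvg_cst _).
  have [k _ hk] := nbhs_infty_ger `|N w|.
  exists k => // n /= /hk/= nw; congr (_%:C).
  by rewrite /ind indicE mem_set ?mulr1//= in_itv/= -ler_norml.
move=> /(_ hc) [/= h _]; move: h; apply: cvg_trans; apply: near_eq_cvg.
by apply: nearW => n; exact: Rintegral_normal_itv.
Qed.

Lemma cvg_gaussf_nat : gaussf n%:R @[n --> \oo] --> (0 : R).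
Proof.
apply: (squeeze_cvgr _ (cvg_cst 0) (cvg_inv_nat 2)); apply: nearW => n.
rewrite gaussf_ge0 /gaussf expRN /=.
have n0 : 0 <= n%:R :> R by [].
have h : (n.+1%:R / 2 : R) <= expR (n%:R ^+ 2 / 2).
  apply: le_trans (expR_ge1Dx _); rewrite -natr1; have := sqr_ge0 (n%:R - 1 : R); nra.
by rewrite -[leRHS]invf_div lef_pV2 ?posrE ?expR_gt0 ?divr_gt0.
Qed.

Lemma Rintegral_cos_normal al s :
  \int[P]_w cos (s * N w + al) = cos al * expR (- (s ^+ 2 / 2)).
Proof.
set E := expR (s ^+ 2 / 2).
(* At s = 0 the cosine is constant, so the initial value comes from the total mass of the law and
   not from a Gaussian integral. *)
have h0 : normal_peak 1 * gaussJ n al 0 @[n --> \oo] --> cos al.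
  have := @cvg_Rintegral_normal_itv al 0.
  under eq_Rintegral do rewrite mul0r add0r.
  have PT : fine (P setT) = 1 by rewrite probability_setT.
  by rewrite Rintegral_cst// (_ : fine _ = 1) ?mulr1//; exact: PT.
have hs : normal_peak 1 * gaussJ n al s * E @[n --> \oo] --> (\int[P]_w cos (s * N w + al)) * E.
  by apply: cvgM; [exact: cvg_Rintegral_normal_itv|exact: cvg_cst].
suff hd : normal_peak 1 * gaussJ n al s * E - normal_peak 1 * gaussJ n al 0 @[n --> \oo] --> (0 : R).
  have h2 : normal_peak 1 * gaussJ n al s * E @[n --> \oo] --> cos al.
    have h : normal_peak 1 * gaussJ n al s * E - normal_peak 1 * gaussJ n al 0 +
        normal_peak 1 * gaussJ n al 0 @[n --> \oo] --> 0 + cos al by exact: cvgD.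
    rewrite add0r in h; apply: cvg_trans h.
    by apply: near_eq_cvg; apply: nearW => n /=; rewrite subrK.
  by rewrite -(cvg_unique _ hs h2)// expRN -/E mulfK// gt_eqF ?expR_gt0.
have hb : normal_peak 1 * (2 * E * `|s|) * gaussf n%:R @[n --> \oo] --> (0 : R).
  by have := cvgM (cvg_cst (normal_peak 1 * (2 * E * `|s|)) (F := \oo)) cvg_gaussf_nat; rewrite mulr0; apply.
apply: norm_cvg0; apply: (squeeze_cvgr _ (cvg_cst 0) hb); exists 1%N => // n /= n0.
rewrite normr_ge0 /= -mulrA -mulrBr normrM ger0_norm ?normal_peak_ge0//.
rewrite -mulrA ler_wpM2l ?normal_peak_ge0//.
by apply: (le_trans (gaussJ_bound al s n0)); rewrite -/E le_eqVlt; apply/orP; left; apply/eqP; ring.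
Qed.

Lemma cint_expi_normal s : cint P (fun w => expi (s * N w)) = (expR (- (s ^+ 2 / 2)))%:C.
Proof.
apply: complex_ext => /=.
  have := Rintegral_cos_normal 0 s; rewrite cos0 mul1r => <-.
  by apply: eq_Rintegral => w _; rewrite addr0.
have := Rintegral_cos_normal (- (pi / 2)) s; rewrite cosN cos_pihalf mul0r => <-.
by apply: eq_Rintegral => w _; rewrite cosBpihalf.
Qed.

End normal_characteristic_function.

(** * Trigonometric approximation *)

Section bernstein.
Context {R : realType}.
Implicit Types (u v a b c : R) (phi psi : nat -> R).

(* The recursive form of \sum_k 'C(N, k) u^k (1 - u)^(N - k) phi k. *)
Fixpoint bern (N : nat) phi u : R :=
  if N is N'.+1 then (1 - u) * bern N' phi u + u * bern N' (fun k => phi k.+1) u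
  else phi 0%N.

Lemma bern_le N phi psi u : 0 <= u <= 1 -> (forall k, (k <= N)%N -> phi k <= psi k) ->
  bern N phi u <= bern N psi u.
Proof.
move=> u01; elim: N phi psi => [|N IH] phi psi h /=; first exact: h.
move/andP: (u01) => [u0 u1]; apply: lerD; rewrite ler_wpM2l ?subr_ge0// IH// => k kN.
  by apply: h; rewrite (leq_trans kN).
exact: h.
Qed.

(** The mean N u and the variance N u (1 - u) of the binomial law. *)
Lemma bern_quad N a b c u : bern N (fun k => a + b * (k%:R - c) ^+ 2) u =
  a + b * ((N%:R * u - c) ^+ 2 + N%:R * u * (1 - u)).
Proof.
elim: N c => [|N IH] c /=; first by ring.
have -> : (fun k => a + b * (k.+1%:R - c) ^+ 2) = (fun k => a + b * (k%:R - (c - 1)) ^+ 2).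
  by apply/funext => k; rewrite -natr1; ring.
by rewrite !IH -natr1; ring.
Qed.

Lemma bern_bound N (h : nat -> nat -> R) M u v : 0 <= u <= 1 -> 0 <= v <= 1 ->
  (forall j k, `|h j k| <= M) -> `|bern N (fun j => bern N (h j) v) u| <= M.
Proof.
move=> u01 v01 hM.
have cst m x : bern N (fun=> m) x = m.
  rewrite -[RHS](addr0 m) -[X in _ + X](mul0r ((N%:R * x - 0) ^+ 2 + N%:R * x * (1 - x))).
  rewrite -bern_quad; congr bern.
  by apply/funext => k; rewrite mul0r addr0.
have hM' j k := hM j k; rewrite ler_norml -(cst (- M) u) -{2}(cst M u).
apply/andP; split; apply: bern_le => // j _.
  rewrite -(cst (- M) v); apply: bern_le => // k _.
  by have := hM j k; rewrite ler_norml => /andP[].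
rewrite -(cst M v); apply: bern_le => // k _.
by have := hM j k; rewrite ler_norml => /andP[].
Qed.

(** Chebyshev's argument: [bern] is monotone, a quadratic bound on the values averages to the
    binomial variances, and these sum to at most N. *)
Lemma bern_approx N (h : nat -> nat -> R) F A B u v : 0 <= u <= 1 -> 0 <= v <= 1 -> 0 <= B ->
  (forall j k, (j <= N)%N -> (k <= N)%N ->
    `|h j k - F| <= A + B * ((j%:R - N%:R * u) ^+ 2 + (k%:R - N%:R * v) ^+ 2)) ->
  `|bern N (fun j => bern N (h j) v) u - F| <= A + B * N%:R.
Proof.
move=> u01 v01 B0 hF.
have key b : `|b| = B -> forall a, bern N (fun j => bern N (fun k =>
    (a + b * (j%:R - N%:R * u) ^+ 2) + b * (k%:R - N%:R * v) ^+ 2) v) u =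
    a + b * (N%:R * u * (1 - u) + N%:R * v * (1 - v)).
  move=> _ a.
  have -> : (fun j => bern N (fun k => (a + b * (j%:R - N%:R * u) ^+ 2) + b * (k%:R - N%:R * v) ^+ 2) v) =
    (fun j => (a + b * (N%:R * v * (1 - v))) + b * (j%:R - N%:R * u) ^+ 2).
    by apply/funext => j; rewrite bern_quad subrr; ring.
  by rewrite bern_quad subrr; ring.
have NB : B * (N%:R * u * (1 - u) + N%:R * v * (1 - v)) <= B * N%:R.
  rewrite ler_wpM2l//; move: u01 v01; have : 0 <= N%:R :> R by [].
  move: (N%:R) => n n0 /andP[u0 u1] /andP[v0 v1].
  have hu : u * (1 - u) <= 2^-1 by have := sqr_ge0 (u - 2^-1); nra.
  have hv : v * (1 - v) <= 2^-1 by have := sqr_ge0 (v - 2^-1); nra.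
  rewrite (_ : n * u * (1 - u) + _ = n * (u * (1 - u) + v * (1 - v))); last by ring.
  by rewrite ler_piMr//; lra.
have hle j k jN kN := hF j k jN kN.
rewrite ler_norml; apply/andP; split.
  rewrite lerBrDr; apply: (@le_trans _ _ (F - A + (- B) * (N%:R * u * (1 - u) + N%:R * v * (1 - v)))).
    by rewrite mulNr; lra.
  rewrite -key; last by rewrite normrN ger0_norm.
  apply: bern_le => // j jN; apply: bern_le => // k kN.
  by have := hle j k jN kN; rewrite ler_norml => /andP[+ _]; rewrite !mulNr mulrDr; lra.
rewrite lerBlDr; apply: (@le_trans _ _ (F + A + B * (N%:R * u * (1 - u) + N%:R * v * (1 - v)))); last by lra.
rewrite -key; last by rewrite ger0_norm.
apply: bern_le => // j jN; apply: bern_le => // k kN.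
by have := hle j k jN kN; rewrite ler_norml => /andP[_ +]; rewrite mulrDr; lra.
Qed.

End bernstein.

(** * Trigonometric polynomials in two variables *)

Section trigonometric_polynomials.
Context {R : realType}.
Implicit Types (g h : R -> R -> R[i]).

(** Coefficient and two real frequencies per term. Frequencies are not restricted to a lattice, so
    the box can be scaled at will and every term is a character. *)
Definition tpoly g := exists s : seq (R[i] * R * R), forall x y,
  g x y = \sum_(c <- s) c.1.1 * expi (c.1.2 * x + c.2 * y).

Lemma eq_tpoly g h : (forall x y, g x y = h x y) -> tpoly g -> tpoly h.
Proof. by move=> gh [s sE]; exists s => x y; rewrite -gh. Qed.

Lemma tpoly_expi (k : R[i]) (a b : R) : tpoly (fun x y => k * expi (a * x + b * y)).
Proof. by exists [:: (k, a, b)] => x y; rewrite big_seq1. Qed.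

Lemma tpoly_cst (k : R[i]) : tpoly (fun=> fun=> k).
Proof.
by apply: eq_tpoly (tpoly_expi k 0 0) => x y; rewrite !mul0r addr0 expi0 mulr1.
Qed.

Lemma tpolyD g h : tpoly g -> tpoly h -> tpoly (fun x y => g x y + h x y).
Proof. by move=> [s sE] [t tE]; exists (s ++ t) => x y; rewrite big_cat sE tE. Qed.

Lemma tpolyM g h : tpoly g -> tpoly h -> tpoly (fun x y => g x y * h x y).
Proof.
move=> [s sE] [t tE].
exists [seq (c.1.1 * e.1.1, c.1.2 + e.1.2, c.2 + e.2) | c <- s, e <- t] => x y.
rewrite sE tE mulr_suml big_allpairs_dep; apply: eq_bigr => c _.
rewrite mulr_sumr; apply: eq_bigr => e _ /=.
rewrite mulrACA -expiD; congr (_ * _ * expi _); ring.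
Qed.

Lemma tpoly_sin (a b : R) : tpoly (fun x y => (sin (a * x + b * y))%:C).
Proof.
apply: eq_tpoly (tpolyD (tpoly_expi (0 -i* 2^-1) a b) (tpoly_expi (0 +i* 2^-1) (- a) (- b))).
move=> x y; have -> : - a * x + - b * y = - (a * x + b * y) by ring.
by apply: complex_ext; rewrite ?cReD ?cImD /= ?cosN ?sinN; field.
Qed.

Lemma tpoly_bern N (phi : nat -> R -> R -> R) (u : R -> R -> R) :
  tpoly (fun x y => (u x y)%:C) -> (forall k, tpoly (fun x y => (phi k x y)%:C)) ->
  tpoly (fun x y => (bern N (fun k => phi k x y) (u x y))%:C).
Proof.
move=> tu; elim: N phi => [|N IH] phi tphi /=; first exact: tphi.
have t1u : tpoly (fun x y => 1 + (- 1) * (u x y)%:C).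
  by apply: tpolyD; [exact: tpoly_cst|apply: tpolyM => //; exact: tpoly_cst].
apply: eq_tpoly (tpolyD (tpolyM t1u (IH phi tphi))
  (tpolyM tu (IH (fun k => phi k.+1) (fun k => tphi k.+1)))) => x y.
by rewrite mulN1r rmorphD !rmorphM rmorphB rmorph1.
Qed.

End trigonometric_polynomials.

Section uniform_approximation.
Context {R : realType}.
Implicit Types (F : R -> R -> R) (x y : R).

Definition continuous2 F := forall x y e, 0 < e -> exists2 d, 0 < d &
  forall x' y', `|x - x'| < d -> `|y - y'| < d -> `|F x y - F x' y'| < e.

Lemma continuous2_unif F A e : continuous2 F -> 0 < e -> exists2 d, 0 < d &
  forall x y x' y', `|x| <= A -> `|y| <= A -> `|x - x'| < d -> `|y - y'| < d ->
  `|F x y - F x' y'| < e.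
Proof.
move=> cF e0.
have cK : compact ((`[- A, A]%classic : set R) `*` (`[- A, A]%classic : set R)).
  by apply: compact_setX; exact: segment_compact.
move: cK; rewrite compact_near_coveringP.
(* Near-covering form of compactness: every point of the box has its own radius, and a common one is
   extracted. The second point may lie outside the box. *)
move=> /(_ R (0^'+) (fun d z => forall x' y', `|z.1 - x'| < d -> `|z.2 - y'| < d ->
  `|F z.1 z.2 - F x' y'| < e) _)[|d [/= d0 hd]].
  move=> [x y] _; have [d d0 hd] := cF x y _ (divr_gt0 e0 (ltr0n R 2)).
  exists ([set z | ball (x, y) (d / 2) z], [set r | r < d / 2]) => [|[z r] [/= [z1 z2] rd] x' y' zx zy].
    split => /=; first by apply: nbhsx_ballx; rewrite divr_gt0.
    by apply: nbhs_right_lt; rewrite divr_gt0.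
  have h1 : `|F x y - F z.1 z.2| < e / 2.
    apply: hd; [apply: lt_le_trans z1 _|apply: lt_le_trans z2 _]; lra.
  have h2 : `|F x y - F x' y'| < e / 2.
    apply: hd.
      have : ball x (d / 2) z.1 by [].
      rewrite /ball/= => b1; have -> : x - x' = (x - z.1) + (z.1 - x') by ring.
      by rewrite (le_lt_trans (ler_normD _ _))//; lra.
    have : ball y (d / 2) z.2 by [].
    rewrite /ball/= => b1; have -> : y - y' = (y - z.2) + (z.2 - y') by ring.
    by rewrite (le_lt_trans (ler_normD _ _))//; lra.
  have -> : F z.1 z.2 - F x' y' = - (F x y - F z.1 z.2) + (F x y - F x' y') by ring.
  by rewrite (le_lt_trans (ler_normD _ _))// normrN; lra.
have d20 : 0 < d / 2 by rewrite divr_gt0.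
exists (d / 2) => // x y x' y' xA yA; apply: (hd (d / 2) _ _ (x, y)) => //=.
  by rewrite /= sub0r normrN gtr0_norm// ltr_pdivrMr//; lra.
by split; rewrite /= in_itv/= -ler_norml.
Qed.

Lemma ler_cos_pi x y : 0 <= x -> x <= y -> y <= pi -> cos y <= cos x :> R.
Proof.
move=> x0 xy ypi; have [y0 xpi] := (le_trans x0 xy, le_trans xy ypi).
by rewrite leNgt ltr_cos ?in_itv/= -?leNgt// ?x0 ?y0.
Qed.

(** With midpoint m and half-distance d, the difference is 2 cos m sin d, and |m| <= pi/2 - d gives
    cos m >= sin d. This is a quantitative injectivity of the sine. *)
Lemma sin_sep a b : - (pi / 2) <= a <= pi / 2 -> - (pi / 2) <= b <= pi / 2 -> a <= b ->
  1 - cos (b - a) <= sin b - sin a :> R.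
Proof.
move=> /andP[a1 a2] /andP[b1 b2] ab.
pose m := (a + b) / 2; pose d := (b - a) / 2.
have -> : b = m + d by rewrite /m /d; field.
have -> : a = m - d by rewrite /m /d; field.
have -> : m + d - (m - d) = d + d by ring.
rewrite sinD sinB cosD.
have c2 : cos d ^+ 2 = 1 - sin d ^+ 2 by rewrite cos2sin2.
have -> : 1 - (cos d * cos d - sin d * sin d) = 2 * sin d ^+ 2.
  by rewrite -!expr2 c2; ring.
have -> : sin m * cos d + cos m * sin d - (sin m * cos d - cos m * sin d) =
  2 * (cos m * sin d) by ring.
have d0 : 0 <= d by rewrite divr_ge0// subr_ge0.
have dpi : d <= pi / 2 by rewrite /d; lra.
have s0 : 0 <= sin d by apply: sin_ge0_pi; rewrite d0 /=; have := @pi_ge0 R; lra.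
rewrite ler_wpM2l// expr2 ler_wpM2r//.
have mm : cos m = cos `|m| by case: (ger0P m) => // _; rewrite cosN.
have md : `|m| <= pi / 2 - d by rewrite ler_norml /m /d; apply/andP; split; lra.
have -> : sin d = cos (pi / 2 - d) by rewrite -cosBpihalf -cosN opprB.
rewrite mm; apply: ler_cos_pi; rewrite ?normr_ge0//; have := @pi_ge0 R; lra.
Qed.

Lemma sin_sep_norm a b d : - (pi / 2) <= a <= pi / 2 -> - (pi / 2) <= b <= pi / 2 ->
  0 <= d -> d <= `|a - b| -> 1 - cos d <= `|sin a - sin b| :> R.
Proof.
have key x y : - (pi / 2) <= x <= pi / 2 -> - (pi / 2) <= y <= pi / 2 ->
    0 <= d -> d <= y - x -> x <= y -> 1 - cos d <= `|sin y - sin x| :> R.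
  move=> hx hy d0 dxy xy; apply: le_trans (ler_norm _); apply: le_trans (sin_sep hx hy xy).
  rewrite lerD2l lerN2; apply: ler_cos_pi => //.
  by move: hx hy => /andP[? ?] /andP[? ?]; lra.
move=> ha hb d0 dab; have [ab|ab] := leP a b.
  by rewrite distrC; apply: key => //; move: dab; rewrite distrC ger0_norm ?subr_ge0.
by apply: key => //; [move: dab; rewrite gtr0_norm ?subr_gt0|exact: ltW].
Qed.

(* Bernstein approximation in the variables (1 + sin (x / L)) / 2, which map
   the box onto [0, 1]^2 and are trigonometric polynomials in x. *)
Lemma tpoly_approx F M L e : continuous2 F -> (forall x y, `|F x y| <= M) ->
  0 < L -> 0 < e -> exists q : R -> R -> R,
  [/\ tpoly (fun x y => (q x y)%:C), (forall x y, `|q x y| <= M) &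
   forall x y, `|x| <= L * (pi / 2) -> `|y| <= L * (pi / 2) -> `|q x y - F x y| <= e].
Proof.
move=> cF FM L0 e0; have M0 : 0 <= M by exact: le_trans (FM 0 0).
have [d d0 hd] := continuous2_unif (L * (pi / 2)) cF (divr_gt0 e0 (ltr0n R 2)).
pose d' := Num.min (d / L) pi.
have d'0 : 0 < d' by rewrite lt_min divr_gt0//= pi_gt0.
pose eta := 1 - cos d'.
have eta0 : 0 < eta.
  rewrite subr_gt0 -(@cos0 R) ltr_cos ?in_itv/= ?lexx ?pi_ge0 ?(ltW d'0)//.
  by rewrite /d' ge_min lexx orbT.
(* Chosen so that the quadratic term exceeds 2 M once the sines differ by [eta]; the 4 comes from
   sin = 2 U - 1. *)
pose B0 := 2 * M / eta ^+ 2 * 4.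
have B00 : 0 <= B0 by rewrite /B0 !mulr_ge0 ?invr_ge0 ?exprn_ge0// ltW.
have [N N0 hN] : exists2 N, (0 < N)%N & B0 / N%:R <= e / 2.
  have [k _ hk] := nbhs_infty_gtr (B0 / (e / 2)).
  exists k.+1 => //; have := hk k.+1 (leqnSn k) => /= h.
  by rewrite ler_pdivrMr ?ltr0n// mulrC -ler_pdivrMr ?divr_gt0// ltW.
have n0 : 0 < N%:R :> R by rewrite ltr0n.
(* The point of the box that [U] maps to j / N. *)
pose node j := L * asin (2 * j%:R / N%:R - 1).
pose U (x : R) := (1 + sin (x / L)) / 2.
have U01 x : 0 <= U x <= 1.
  by rewrite /U; have := sin_geN1 (x / L); have := sin_le1 (x / L); lra.
exists (fun x y => bern N (fun j => bern N (fun k => F (node j) (node k)) (U y)) (U x)).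
split.
- have tU (a b : R) : tpoly (fun x y => ((1 + sin (a * x + b * y)) / 2)%:C).
    apply: eq_tpoly (tpolyD (tpoly_cst (2^-1)%:C) (tpolyM (tpoly_cst (2^-1)%:C) (tpoly_sin a b))).
    by move=> x y; rewrite -rmorphM -rmorphD; congr (_%:C); field.
  have tUx : tpoly (fun x y : R => (U x)%:C).
    by apply: eq_tpoly (tU L^-1 0) => x y; rewrite mul0r addr0 [L^-1 * _]mulrC.
  have tUy : tpoly (fun x y : R => (U y)%:C).
    by apply: eq_tpoly (tU 0 L^-1) => x y; rewrite mul0r add0r [L^-1 * _]mulrC.
  apply: (@tpoly_bern _ N (fun j x y => bern N (fun k => F (node j) (node k)) (U y)) (fun x y => U x)) => // j.
  apply: (@tpoly_bern _ N (fun k x y => F (node j) (node k)) (fun x y => U y)) => // k.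
  exact: tpoly_cst.
- by move=> x y; apply: bern_bound.
- move=> x y xL yL.
  have hnode j : (j <= N)%N -> [/\ `|node j| <= L * (pi / 2),
      - (pi / 2) <= node j / L <= pi / 2 & sin (node j / L) = 2 * j%:R / N%:R - 1].
    move=> jN; have r1 : -1 <= (2 * j%:R / N%:R - 1 : R) <= 1.
      pose r : R := j%:R / N%:R; have r0 : 0 <= r by rewrite divr_ge0.
      have r1 : r <= 1 by rewrite ler_pdivrMr// mul1r ler_nat.
      by rewrite -[2 * _ / _]mulrA -/r; clearbody r; lra.
    have nE : node j / L = asin (2 * j%:R / N%:R - 1) by rewrite /node mulrC mulKf// gt_eqF.
    rewrite nE asinK ?in_itv//= asin_geNpi2// asin_lepi2//; split => //.
    rewrite /node normrM gtr0_norm// ler_pM2l// ler_norml asin_geNpi2// asin_lepi2//.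
  have hx z : `|z| <= L * (pi / 2) -> - (pi / 2) <= z / L <= pi / 2.
    by move=> zL; rewrite -ler_norml normrM normfV (gtr0_norm L0) ler_pdivrMr// mulrC.
  have sep z j : `|z| <= L * (pi / 2) -> (j <= N)%N -> d <= `|z - node j| ->
      eta ^+ 2 <= 4 / N%:R ^+ 2 * (j%:R - N%:R * U z) ^+ 2.
    move=> zL jN dz; have [_ nl sE] := hnode j jN.
    have h : d' <= `|z / L - node j / L|.
      by rewrite -mulrBl normrM normfV (gtr0_norm L0) ge_min ler_pM2r ?invr_gt0// dz.
    have := sin_sep_norm (hx z zL) nl (ltW d'0) h; rewrite sE -/eta => he.
    have -> : 4 / N%:R ^+ 2 * (j%:R - N%:R * U z) ^+ 2 = `|sin (z / L) - (2 * j%:R / N%:R - 1)| ^+ 2.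
      by rewrite real_normK ?num_real// /U; field; rewrite gt_eqF.
    by rewrite lerXn2r ?nnegrE ?(ltW eta0).
  have -> : e = e / 2 + e / 2 by field.
  apply: le_trans (_ : e / 2 + B0 / N%:R ^+ 2 * N%:R <= _); last first.
    rewrite lerD2l (_ : B0 / N%:R ^+ 2 * N%:R = B0 / N%:R)//.
    by field; rewrite gt_eqF.
  apply: bern_approx => //; first by rewrite divr_ge0// exprn_ge0.
  move=> j k jN kN; set S := (_ - _) ^+ 2; set S' := (_ - N%:R * U y) ^+ 2.
  have [S0 S'0] : 0 <= S /\ 0 <= S' by split; exact: sqr_ge0.
  (* Far from the node the trivial bound 2 M is absorbed by the quadratic term; near it uniform
     continuity gives e / 2. *)
  have far : eta ^+ 2 <= 4 / N%:R ^+ 2 * (S + S') ->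
      `|F (node j) (node k) - F x y| <= e / 2 + B0 / N%:R ^+ 2 * (S + S').
    move=> he; apply: (@le_trans _ _ (2 * M)).
      by rewrite (le_trans (ler_normB _ _))// mulr_natl mulr2n lerD.
    have : 2 * M <= B0 / N%:R ^+ 2 * (S + S').
      have -> : B0 / N%:R ^+ 2 * (S + S') = 2 * M / eta ^+ 2 * (4 / N%:R ^+ 2 * (S + S')).
        by rewrite /B0; field; rewrite !gt_eqF.
      apply: (@le_trans _ _ (2 * M / eta ^+ 2 * eta ^+ 2)).
        by rewrite divfK// expf_neq0// gt_eqF.
      by rewrite ler_wpM2l// divr_ge0 ?mulr_ge0 ?exprn_ge0// ltW.
    by move=> h; apply: (le_trans h); rewrite lerDr ltW// divr_gt0.
  have q0 : 0 <= 4 / N%:R ^+ 2 :> R by rewrite divr_ge0// exprn_ge0.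
  have [xd|xd] := ltP `|x - node j| d; last first.
    apply: far; apply: le_trans (sep x j xL jN xd) _.
    by rewrite ler_wpM2l// -/S lerDl.
  have [yd|yd] := ltP `|y - node k| d; last first.
    apply: far; apply: le_trans (sep y k yL kN yd) _.
    by rewrite ler_wpM2l// -/S' lerDr.
  rewrite distrC; apply: le_trans (ltW (hd _ _ _ _ xL yL xd yd)) _.
  by rewrite lerDl mulr_ge0 ?addr_ge0// divr_ge0// exprn_ge0.
Qed.

End uniform_approximation.

(** * Continuity theorem for characteristic functions *)

Section measurability.
Context {R : realType}.

Lemma bmeas_tpoly (g : R -> R -> R[i]) d (T : measurableType d) (X Y : T -> R) :
  tpoly g -> measurable_fun setT X -> measurable_fun setT Y ->
  bmeas (fun w => g (X w) (Y w)).
Proof.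
move=> [s sE] mX mY.
rewrite (_ : (fun w => _) = fun w => \sum_(c <- s) c.1.1 * expi (c.1.2 * X w + c.2 * Y w)).
  apply: bmeas_sum => c; apply: bmeasZ; apply: bmeas_expi.
  by apply: measurable_funD; exact: measurable_funM.
by apply/funext => w; exact: sE.
Qed.

(** F is a pointwise limit of trigonometric polynomials, approximating it within 1/(m + 1) on boxes
    that grow with m, and these are measurable term by term. *)
Lemma measurable_continuous2 (F : R -> R -> R) M d (T : measurableType d) (X Y : T -> R) :
  continuous2 F -> (forall x y, `|F x y| <= M) ->
  measurable_fun setT X -> measurable_fun setT Y ->
  measurable_fun setT (fun w => F (X w) (Y w)).
Proof.
move=> cF FM mX mY.
have hq (m : nat) : exists q : R -> R -> R, tpoly (fun x y => (q x y)%:C) /\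
    (forall x y, `|x| <= m.+1%:R * (pi / 2) -> `|y| <= m.+1%:R * (pi / 2) ->
      `|q x y - F x y| <= m.+1%:R^-1).
  have m0 : 0 < m.+1%:R :> R by rewrite ltr0n.
  have m1 : 0 < m.+1%:R^-1 :> R by rewrite invr_gt0.
  by have [q [q1 _ q2]] := tpoly_approx cF FM m0 m1; exists q.
have [q qP] := choice hq.
apply: (measurable_fun_cvg (h := fun m w => q m (X w) (Y w))) => [m|w _].
  by have [tq _] := qP m; have [h _ _] := bmeas_tpoly tq mX mY; exact: h.
apply/cvgrPdist_le => e e0.
have [k _ hk] := nbhs_infty_gtr (`|X w| + `|Y w| + e^-1).
exists k => // m /= km; have [_] := qP m; rewrite distrC; move=> hm.
have p1 : 1 <= pi / 2 :> R by have := @pi_ge2 R; lra.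
have := hk _ (leq_trans km (leqnSn m)) => /= mk.
have e1 : 0 < e^-1 by rewrite invr_gt0.
have [x0 y0] := (normr_ge0 (X w), normr_ge0 (Y w)).
have mp : m.+1%:R <= m.+1%:R * (pi / 2) :> R by rewrite ler_peMr.
apply: (le_trans (hm _ _ _ _)); [lra|lra|].
rewrite -[leRHS]invrK lef_pV2 ?posrE ?ltr0n//; lra.
Qed.

End measurability.

Section levy.
Context {R : realType} (d : nat -> measure_display) (T : forall n, measurableType (d n))
  (P : forall n, probability (T n) R) (X Y : forall n, T n -> R)
  d' (T' : measurableType d') (P' : probability T' R) (X' Y' N : T' -> R).
Arguments X : clear implicits.
Arguments Y : clear implicits.
Hypothesis mX : forall n, measurable_fun setT (X n).
Hypothesis mY : forall n, measurable_fun setT (Y n).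
Hypothesis mX' : measurable_fun setT X'.
Hypothesis mY' : measurable_fun setT Y'.
Hypothesis mN : measurable_fun setT N.
(* N is an auxiliary standard normal variable: its transform turns Gaussian
   functions of X and Y into mixtures of characters. *)
Hypothesis hN : forall s, cint P' (fun w => expi (s * N w)) = (expR (- (s ^+ 2 / 2)))%:C.
Hypothesis hcf : forall s t,
  ccvg (fun n => cint (P n) (fun w => expi (s * X n w + t * Y n w)))
    (cint P' (fun w => expi (s * X' w + t * Y' w))).

Lemma ccvg_tpoly (g : R -> R -> R[i]) : tpoly g ->
  ccvg (fun n => cint (P n) (fun w => g (X n w) (Y n w)))
    (cint P' (fun w => g (X' w) (Y' w))).
Proof.
move=> [s sE].
have key dd (S : measurableType dd) (Q : probability S R) (U V : S -> R) :
    measurable_fun setT U -> measurable_fun setT V ->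
    cint Q (fun w => g (U w) (V w)) =
    \sum_(c <- s) c.1.1 * cint Q (fun w => expi (c.1.2 * U w + c.2 * V w)).
  move=> mU mV.
  have be a b : bmeas (fun w => expi (a * U w + b * V w)).
    by apply: bmeas_expi; apply: measurable_funD; exact: measurable_funM.
  rewrite (eq_cint _ (h := fun w => \sum_(c <- s) c.1.1 * expi (c.1.2 * U w + c.2 * V w))).
    rewrite cint_sum; first by apply: eq_bigr => c _; exact: cintZ.
    by move=> c; exact: bmeasZ.
  by move=> w; exact: sE.
rewrite key//; rewrite (_ : (fun n => _) = fun n => \sum_(c <- s) c.1.1 *
  cint (P n) (fun w => expi (c.1.2 * X n w + c.2 * Y n w))); last first.
  by apply/funext => n; exact: key.
elim: s {sE key} => [|c s IH].
  by under eq_fun do rewrite big_nil; rewrite big_nil; exact: ccvg_cst.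
under eq_fun do rewrite big_cons; rewrite big_cons.
by apply: ccvgD => //; apply: ccvgM => //; exact: ccvg_cst.
Qed.

(** gaussf y is the expectation of e^(i N y); Fubini rewrites the integral as an average over N of
    joint characteristic functions, to which bounded convergence applies. *)
Lemma cvg_Rintegral_gaussf a b :
  \int[P n]_w gaussf (a * X n w + b * Y n w) @[n --> \oo] -->
  \int[P']_w gaussf (a * X' w + b * Y' w).
Proof.
have key dd (S : measurableType dd) (Q : probability S R) (U V : S -> R) :
    measurable_fun setT U -> measurable_fun setT V ->
    bmeas (fun v => cint Q (fun w => expi ((N v * a) * U w + (N v * b) * V w))) /\
    (\int[Q]_w gaussf (a * U w + b * V w))%:C =
    cint P' (fun v => cint Q (fun w => expi ((N v * a) * U w + (N v * b) * V w))).
  move=> mU mV.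
  have bg : bmeas (fun z : T' * S => expi ((N z.1 * a) * U z.2 + (N z.1 * b) * V z.2)).
    have m1 : measurable_fun setT (fun z : T' * S => N z.1) by exact: measurableT_comp mN _.
    have m2 : measurable_fun setT (fun z : T' * S => U z.2) by exact: measurableT_comp mU _.
    have m3 : measurable_fun setT (fun z : T' * S => V z.2) by exact: measurableT_comp mV _.
    apply: bmeas_expi; apply: measurable_funD; apply: measurable_funM => //;
      exact: measurable_funM.
  have [b1 e1 e2] := cint_fubini P' Q bg; split; first exact: b1.
  rewrite -[RHS]e1 e2 -cint_real; apply: eq_cint => w /=; rewrite -hN.
  by apply: eq_cint => v; congr expi; ring.
have b1 n := (key _ _ (P n) _ _ (@mX n) (@mY n)).1.
have b2 := (key _ _ P' _ _ mX' mY').1.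
(* The constant is that of [normc_cint_le]; any bound uniform in n and v serves. *)
have bound n v : normc (cint (P n) (fun w => expi ((N v * a) * X n w + (N v * b) * Y n w))) <= 2.
  have := @normc_cint_le _ _ _ (P n) (fun w => expi ((N v * a) * X n w + (N v * b) * Y n w)) (fun=> 1).
  rewrite Rintegral_cst// mul1r.
  have PT : fine (P n setT) = 1 by rewrite probability_setT.
  rewrite (_ : fine _ = 1) ?mulr1//; apply => [||w].
  - by apply: bmeas_expi; apply: measurable_funD; apply: measurable_funM.
  - apply: (@bounded_integrable _ _ _ (P n) (fun=> 1) 1) => // w; by rewrite normr1.
  - by rewrite normc_expi.
have := cint_cvg P' b1 b2 bound (fun v => hcf (N v * a) (N v * b)).
rewrite -(key _ _ P' _ _ mX' mY').2 => -[/= h _].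
apply: cvg_trans h; apply: near_eq_cvg; apply: nearW => n.
by have := (key _ _ (P n) _ _ (@mX n) (@mY n)).2 => /(congr1 (@complex.Re R)) /= ->.
Qed.

Lemma measurable_gaussf_linear dd (S : measurableType dd) (U V : S -> R) a b :
  measurable_fun setT U -> measurable_fun setT V ->
  measurable_fun setT (fun w => gaussf (a * U w + b * V w)).
Proof.
move=> mU mV; apply: (measurableT_comp (f := @gaussf R)).
  by apply: continuous_measurable_fun; exact: gaussf_continuous.
by apply: measurable_funD; exact: measurable_funM.
Qed.

Lemma cvg_gaussf_scale dd (S : measurableType dd) (Q : probability S R) (U V : S -> R) a b :
  measurable_fun setT U -> measurable_fun setT V ->
  \int[Q]_w gaussf (a / k.+1%:R * U w + b / k.+1%:R * V w) @[k --> \oo] --> (1 : R).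
Proof.
move=> mU mV.
have g1 x : `|gaussf x| <= 1 :> R by rewrite ger0_norm ?gaussf_ge0 ?gaussf_le1.
have h1 (k : nat) := bmeas_real (measurable_gaussf_linear (a / k.+1%:R) (b / k.+1%:R) mU mV)
  (fun w => g1 _).
have := @cint_cvg _ _ _ Q _ _ 1 h1 (bmeas_cst 1) _ _.
have hn (k : nat) w : normc (gaussf (a / k.+1%:R * U w + b / k.+1%:R * V w))%:C <= 1.
  by rewrite normcR.
move=> /(_ hn); have hc w : ccvg (fun k => (gaussf (a / k.+1%:R * U w + b / k.+1%:R * V w))%:C) 1.
  split; last exact: cvg_cst.
  have c0 : a / k.+1%:R * U w + b / k.+1%:R * V w @[k --> \oo] --> (0 : R).
    rewrite (_ : (fun k => _) = fun k => (a * U w + b * V w) / k.+1%:R).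
      exact: cvg_inv_nat.
    by apply/funext => k; ring.
  have -> : complex.Re (1 : R[i]) = gaussf 0.
    by rewrite /gaussf expr0n/= mul0r oppr0 expR0.
  by apply: (cvg_comp _ (@gaussf R) c0); exact: gaussf_continuous.
move=> /(_ hc) [/= h _]; move: h; rewrite Rintegral_cst// mul1r.
have QT : fine (Q setT) = 1 by rewrite probability_setT.
by rewrite (_ : fine _ = 1).
Qed.

(** Outside the box one coordinate exceeds L in modulus, so its Gaussian is at most e^(-1/2), and
    the second term is then at least the trivial bound 2 M. *)
Lemma tpoly_error (F q : R -> R -> R) M L e x y : 0 < L -> 0 <= e ->
  (forall x y, `|F x y| <= M) -> (forall x y, `|q x y| <= M) ->
  (forall x y, `|x| <= L * (pi / 2) -> `|y| <= L * (pi / 2) -> `|q x y - F x y| <= e) ->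
  `|F x y - q x y| <= e + 2 * M / (1 - expR (- 2^-1)) * (2 - gaussf (x / L) - gaussf (y / L)).
Proof.
move=> L0 e0 FM qM qF; have M0 : 0 <= M := le_trans (normr_ge0 _) (FM 0 0).
set D := 1 - expR _.
have D0 : 0 < D by rewrite subr_gt0 -[ltRHS]expR0 ltr_expR; lra.
set C := 2 * M / D; have C0 : 0 <= C by rewrite divr_ge0 ?mulr_ge0// ltW.
have [g1 g2] := (gaussf_le1 (x / L), gaussf_le1 (y / L)).
have p1 : 1 <= pi / 2 :> R by have := @pi_ge2 R; lra.
have far z : L * (pi / 2) < `|z| -> gaussf (z / L) <= 1 - D.
  move=> zL; rewrite /D opprB addrC subrK /gaussf ler_expR lerN2.
  have : 1 <= (z / L) ^+ 2; last by lra.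
  rewrite -(real_normK (num_real _)) expr_ge1// normrM normfV (gtr0_norm L0).
  by rewrite ler_pdivlMr// mul1r (le_trans _ (ltW zL))// ler_peMr// ltW.
have FqM : `|F x y - q x y| <= C * D.
  rewrite /C divfK ?gt_eqF// (le_trans (ler_normB _ _))// mulr_natl mulr2n lerD//.
have [xL|xL] := leP `|x| (L * (pi / 2)); last first.
  have := far _ xL => gx; apply: (le_trans FqM); apply: ler_wpDl => //.
  by rewrite ler_wpM2l//; lra.
have [yL|yL] := leP `|y| (L * (pi / 2)); last first.
  have := far _ yL => gy; apply: (le_trans FqM); apply: ler_wpDl => //.
  by rewrite ler_wpM2l//; lra.
rewrite distrC (le_trans (qF _ _ xL yL))// lerDl mulr_ge0//; lra.
Qed.

(** The Gaussian terms of [tpoly_error] replace tightness: a width is fixed from the limit law, and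
    their convergence carries the bound over to [P n] for large n. Five errors of e / 8 add up. *)
Theorem levy_continuity (F : R -> R -> R) M :
  continuous2 F -> (forall x y, `|F x y| <= M) ->
  \int[P n]_w F (X n w) (Y n w) @[n --> \oo] --> \int[P']_w F (X' w) (Y' w).
Proof.
move=> cF FM; have M0 : 0 <= M := le_trans (normr_ge0 _) (FM 0 0).
apply/cvgrPdist_lt => e e0.
set D := 1 - expR (- 2^-1) : R; set C := 2 * M / D.
pose gX dd (S : measurableType dd) (Q : probability S R) (U V : S -> R) (l : R) :=
  \int[Q]_w gaussf (l * U w + 0 * V w).
pose gY dd (S : measurableType dd) (Q : probability S R) (U V : S -> R) (l : R) :=
  \int[Q]_w gaussf (0 * U w + l * V w).
have e8 : 0 < e / 8 by rewrite divr_gt0.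
have [k hk] : exists k : nat, C * (2 - gX _ _ P' X' Y' k.+1%:R^-1 - gY _ _ P' X' Y' k.+1%:R^-1) < e / 8.
  have h : C * (2 - gX _ _ P' X' Y' k.+1%:R^-1 - gY _ _ P' X' Y' k.+1%:R^-1) @[k --> \oo]
      --> C * (2 - 1 - 1).
    apply: cvgM; first exact: cvg_cst.
    apply: cvgB; first (apply: cvgB; first exact: cvg_cst).
      have := cvg_gaussf_scale P' 1 0 mX' mY'; under eq_fun do rewrite mul0r.
      by under eq_fun do rewrite mul1r.
    have := cvg_gaussf_scale P' 0 1 mX' mY'; under eq_fun do rewrite mul0r.
    by under eq_fun do rewrite mul1r.
  rewrite (_ : C * (2 - 1 - 1) = 0) in h; last by ring.
  have [k _ /(_ k (leqnn k))] := cvgr_lt _ h _ e8; by exists k.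
set l := k.+1%:R^-1 : R in hk.
have L0 : 0 < k.+1%:R :> R by rewrite ltr0n.
have [q [tq qM qF]] := tpoly_approx cF FM L0 e8.
have err dd (S : measurableType dd) (Q : probability S R) (U V : S -> R) :
    measurable_fun setT U -> measurable_fun setT V ->
    `|\int[Q]_w F (U w) (V w) - \int[Q]_w q (U w) (V w)| <=
    e / 8 + C * (2 - gX _ _ Q U V l - gY _ _ Q U V l).
  move=> mU mV.
  have iF : Q.-integrable setT (EFin \o (fun w => F (U w) (V w))).
    by apply: (@bounded_integrable _ _ _ Q _ M) => //; exact: measurable_continuous2 FM _ _.
  have iq : Q.-integrable setT (EFin \o (fun w => q (U w) (V w))).
    by have := bmeas_Re_integrable Q (bmeas_tpoly tq mU mV).
  have ig a b : Q.-integrable setT (EFin \o (fun w => gaussf (a * U w + b * V w))).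
    apply: (@bounded_integrable _ _ _ Q _ 1); first exact: measurable_gaussf_linear.
    by move=> w; rewrite ger0_norm ?gaussf_ge0 ?gaussf_le1.
  have ic (c : R) : Q.-integrable setT (EFin \o (fun=> c) : S -> \bar R).
    by apply: (@bounded_integrable _ _ _ Q _ `|c|).
  have iZ (c : R) f : Q.-integrable setT (EFin \o f) ->
    Q.-integrable setT (EFin \o (fun w : S => c * f w)) by exact: integrable_scaler.
  have iB (f g : S -> R) : Q.-integrable setT (EFin \o f) -> Q.-integrable setT (EFin \o g) ->
    Q.-integrable setT (EFin \o (fun w => f w - g w)).
    move=> hf hg; rewrite (_ : (fun w => _) = fun w => f w + (- 1) * g w); last first.
      by apply/funext => w; rewrite mulN1r.
    by apply: integrable_addr => //; exact: iZ.
  rewrite -RintegralB//; apply: (le_trans (le_normr_Rintegral _ (iB _ _ iF iq))) => //.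
  have -> : e / 8 + C * (2 - gX _ _ Q U V l - gY _ _ Q U V l) =
     \int[Q]_w ((e / 8 + 2 * C) - C * gaussf (l * U w + 0 * V w) - C * gaussf (0 * U w + l * V w)).
    rewrite RintegralB//; [|by apply: iB => //; exact: iZ|exact: iZ].
    rewrite RintegralB//; last exact: iZ.
    rewrite !RintegralZl// Rintegral_cst// -/(gX _ _ Q U V l) -/(gY _ _ Q U V l).
    have QT : fine (Q setT) = 1 by rewrite probability_setT.
    by rewrite (_ : fine _ = 1)//; ring.
  apply: le_Rintegral => //.
  - have mq : measurable_fun setT (fun w => `|F (U w) (V w) - q (U w) (V w)|).
      apply: (measurableT_comp (@normr_measurable R setT)).
      apply: measurable_funB; first exact: measurable_continuous2 FM _ _.
      by have [] := bmeas_tpoly tq mU mV.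
    apply: (@bounded_integrable _ _ _ Q _ (M + M)) => // w.
    by rewrite normr_id (le_trans (ler_normB _ _))// lerD.
  - by apply: (iB) => //; [apply: iB => //|]; exact: iZ.
  - move=> w _; apply: (le_trans (tpoly_error _ _ L0 (ltW e8) FM qM qF)).
    by rewrite !mul0r addr0 add0r -/D -/C /l ![_ / k.+1%:R]mulrC; lra.
have hq : \int[P n]_w q (X n w) (Y n w) @[n --> \oo] --> \int[P']_w q (X' w) (Y' w).
  by have [] := ccvg_tpoly tq.
have hB : C * (2 - gX _ _ (P n) (X n) (Y n) l - gY _ _ (P n) (X n) (Y n) l) @[n --> \oo] -->
    C * (2 - gX _ _ P' X' Y' l - gY _ _ P' X' Y' l).
  apply: cvgM; first exact: cvg_cst.
  by apply: cvgB; first (apply: cvgB; first exact: cvg_cst); exact: cvg_Rintegral_gaussf.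
have hB' : \forall n \near \oo, C * (2 - gX _ _ (P n) (X n) (Y n) l -
    gY _ _ (P n) (X n) (Y n) l) < e / 8 by exact: cvgr_lt hB _ hk.
move/cvgrPdist_lt: hq => /(_ _ e8).
apply: filterS2 hB' => n Bn qn.
have E1 := err _ _ P' _ _ mX' mY'; have E2 := err _ _ (P n) _ _ (@mX n) (@mY n).
move: E1 E2 qn Bn hk; set a := \int[P']_w _; set b := \int[P']_w _; set c := \int[P n]_w _.
set f := \int[P n]_w _; move=> E1 E2 qn Bn hk'.
have -> : a - c = (a - b) + (b - f) - (c - f) by ring.
rewrite (le_lt_trans (ler_normB _ _))// (le_lt_trans (lerD (ler_normD _ _) (lexx _)))//; lra.
Qed.

End levy.

(** * Convergence in law *)

Section continuity.
Context {R : realType}.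

Lemma continuous2_complex (f : R[i]^o -> R) : continuous f ->
  continuous2 (fun x y => f (x +i* y)).
Proof.
move=> cf x y e e0.
have /cvgrPdist_lt /(_ _ e0) /nbhs_ballP [r /= r0 hr] := cf (x +i* y).
(* Balls of [R[i]^o] have radii in R[i]; being positive there forces the radius to be real. *)
have rE : r = (complex.Re r)%:C.
  by move: r0; rewrite ltcE /=; case: r {hr} => a b /= /andP[/eqP -> _].
have r1 : 0 < complex.Re r by move: r0; rewrite ltcE /= => /andP[_].
exists (complex.Re r / 2) => [|x' y' xx yy]; first by rewrite divr_gt0.
apply: hr; rewrite /ball /= rE -[X in X < _]/((normc ((x +i* y) - (x' +i* y')))%:C).
rewrite ltcR; apply: le_lt_trans (normc_leD _) _ => /=.
by rewrite [ltRHS](_ : _ = complex.Re r / 2 + complex.Re r / 2) ?ltrD//; field.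
Qed.

End continuity.

Section expectations.
Context {R : realType} d (T : measurableType d) (P : probability T R).

Lemma expectation_bounded (f : T -> R) M : measurable_fun setT f ->
  (forall w, `|f w| <= M) -> ('E_P[f] = (\int[P]_w f w)%:E)%E.
Proof.
move=> mf fM; rewrite unlock /Rintegral fineK//.
by apply: integrable_fin_num => //; exact: bounded_integrable mf fM.
Qed.

Lemma cint_distribution d2 (T2 : measurableType d2) (X : {mfun T >-> T2}) (g : T2 -> R[i]) :
  bmeas g -> cint (distribution P X) g = cint P (fun w => g (X w)).
Proof.
move=> bg; have bgX : bmeas (fun w => g (X w)) by exact: bmeas_comp bg _.
have [g1 g2 _] := bg; apply: complex_ext; rewrite /= /Rintegral.
- rewrite integral_distribution//; first exact/measurable_EFinP.
  exact: bmeas_Re_integrable.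
- rewrite integral_distribution//; first exact/measurable_EFinP.
  exact: bmeas_Im_integrable.
Qed.

(** By uniqueness of the product measure on rectangles, the joint law is the product of the
    marginals; Fubini does the rest. *)
Lemma cint_independent (N1 N2 : {RV P >-> R}) (g h : R -> R[i]) :
  independent_RVs N1 N2 -> bmeas g -> bmeas h ->
  cint P (fun w => g (N1 w) * h (N2 w)) = cint P (fun w => g (N1 w)) * cint P (fun w => h (N2 w)).
Proof.
move=> ind bg bh.
pose m1 : {finite_measure set R -> \bar R} := fpush P N1.
pose m2 : {finite_measure set R -> \bar R} := fpush P N2.
have mN : measurable_fun setT (fun w => (N1 w, N2 w)) by exact: measurable_fun_pair.
pose N : {mfun T >-> (R * R)%type} := HB.pack (fun w => (N1 w, N2 w)) (isMeasurableFun.Build _ _ _ _ _ mN).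
have bG : bmeas (fun z : R * R => g z.1 * h z.2).
  by apply: bmeasM; [exact: bmeas_comp bg _|exact: bmeas_comp bh _].
have -> : cint P (fun w => g (N1 w) * h (N2 w)) = cint (prodm m1 m2) (fun z => g z.1 * h z.2).
  rewrite -[LHS](cint_distribution N bG).
  have eqm A : measurable A -> prodm m1 m2 A = distribution P N A.
    have rect (A1 A2 : set R) : measurable A1 -> measurable A2 ->
      distribution P N (A1 `*` A2) = (m1 A1 * m2 A2)%E by exact: ind.
    by move=> mA; exact: (product_measure_unique rect mA).
  rewrite /cint; congr (_ +i* _); congr fine; apply: eq_measure_integral => A mA _;
    exact/esym/eqm.
have [_ -> _] := cint_fubini m1 m2 bG.
rewrite (eq_cint _ (h := fun x => cint m2 h * g x)); last first.
  by move=> x /=; rewrite cintZ// mulrC.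
rewrite cintZ// mulrC; congr (_ * _); exact: cint_distribution.
Qed.

End expectations.

(** * The transform of the normalised logarithm *)

Section log_transform.
Context {R : realType}.
Implicit Types (s t : R) (p n m : nat).

Definition norm_log p n m (th : m.-tuple R) : R[i] :=
  (log_Zp p th - (p%:R * ln n%:R)%:C) / (Num.sqrt (ln n%:R))%:C.

Lemma norm_logE p n m (th : m.-tuple R) : norm_log p n th =
  ((ln p`!%:R + \sum_(k < m) ln (normc (1 - expi (tnth th k))) - p%:R * ln n%:R) * rsln n)
  +i* ((\sum_(k < m) carg (1 - expi (tnth th k))) * rsln n).
Proof.
rewrite /norm_log /rsln -fmorphV.
apply: complex_ext; rewrite ?cReM ?cImM /= !(mulr0, subr0, add0r, addr0) /log_Zp
   ?cReD ?cImD /= ?Re_sum ?Im_sum /=; congr (_ * _).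
by rewrite add0r oppr0 addr0.
Qed.

(** Three parts: the constant ln p!, whose phase tends to 1; the centring, p ln n rsln = p sqrt (ln
    n); and a product over the angles, ready for Andreief's identity. *)
Lemma expi_norm_log p n m (th : m.-tuple R) s t :
  expi (s * complex.Re (norm_log p n th) + t * complex.Im (norm_log p n th)) =
  expi (s * ln p`!%:R * rsln n) * expi (- (p%:R * s * Num.sqrt (ln n%:R))) *
  \prod_(k < m) fh_char (s * rsln n) (t * rsln n) (tnth th k).
Proof.
rewrite norm_logE /= /fh_char -expi_sum -!expiD; congr expi.
rewrite /fh_phase big_split /= -!mulr_sumr -ln_mul_rsln; ring.
Qed.

Lemma measurable_norm_log p n m : 
  measurable_fun setT (fun th : m.-tuple R => complex.Re (norm_log p n th)) /\
  measurable_fun setT (fun th : m.-tuple R => complex.Im (norm_log p n th)).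
Proof.
have ml : measurable_fun setT (fun x : R => ln (normc (1 - expi x))).
  have := @measurable_fh_phase R 1 0; congr measurable_fun.
  by apply/funext => x; rewrite /fh_phase mul1r mul0r addr0.
have mc : measurable_fun setT (fun x : R => carg (1 - expi x)).
  have := @measurable_fh_phase R 0 1; congr measurable_fun.
  by apply/funext => x; rewrite /fh_phase mul1r mul0r add0r.
split; under eq_fun do rewrite norm_logE /=; apply: measurable_funM => //.
  apply: measurable_funB => //; apply: measurable_funD => //.
  apply: measurable_sum => k.
  exact: (measurableT_comp ml (@measurable_tnth _ _ _ k)).
apply: measurable_sum => k.
exact: (measurableT_comp mc (@measurable_tnth _ _ _ k)).
Qed.

(** Total mass 1 says that Andreief's constant times the determinant at (0, 0) is 1, so the
    transform is the ratio of determinants. It also yields the positivity of [fhK]. *)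
Lemma cint_fh_char_prod p m (mu : probability (m.-tuple R) R) xi eta :
  is_spectral_law p.+1 mu -> (0 < m)%N -> `|eta| <= 1 ->
  0 < fhK (R := R) p.+1 /\
  cint mu (fun th => \prod_(k < m) fh_char xi eta (tnth th k)) = fh_ratio p.+1 m xi eta.
Proof.
move=> hmu m0 e1; have [c hc] := spectral_law_cint hmu.
have c1 : c%:C * \det (toeplitz (fh_coef p.+1 (fh_char 0 0)) m) = 1.
  rewrite -hc; last exact: bmeas_fh_char.
  rewrite (eq_cint _ (h := fun=> 1)).
    rewrite cint_cst mul1r.
    have muT : fine (mu setT) = 1 by rewrite probability_setT.
    by rewrite (_ : fine _ = 1).
  move=> th; rewrite big1// => k _.
  by rewrite /fh_char /fh_phase !mul0r addr0 expi0.
(* The determinant at (0, 0) contains the factor [fhK] to the power m > 0, so [fhK] cannot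
   vanish. *)
have K0 : 0 < fhK (R := R) p.+1.
  rewrite lt_neqAle fhK_ge0 andbT eq_sym; apply/eqP => K0.
  have dz : \det (toeplitz (fh_coef p.+1 (fh_char 0 0)) m) = 0 :> R[i].
    rewrite (@det_toeplitz _ (fh_a p.+1 0 0) (fh_b p.+1 0 0)) => [|k|i|i].
    - rewrite -[fh_coef _ _ 0]/(fhc p.+1 0 0) fhcK K0 expr0n; case: (m) m0 => // k _.
      by rewrite mul0r.
    - exact: fh_coef_rec.
    - by apply: fh_a_neq0; rewrite normr0 ler01.
    - by apply: fh_b_neq0; rewrite normr0 ler01.
  by move: c1; rewrite dz mulr0 => /eqP; rewrite eq_sym oner_eq0.
split=> //; rewrite hc; last exact: bmeas_fh_char.
by rewrite det_toeplitz_fh// mulrA c1 mul1r.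
Qed.

End log_transform.

Theorem corollary5p5 (R : realType) (p : nat) (hp : (1 <= p)%N)
    (d : nat -> measure_display) (T : forall n, measurableType (d n))
    (P : forall n, probability (T n) R)
    (theta : forall n, {RV (P n) >-> (n - p).-tuple R})
    (htheta : forall n, (p < n)%N ->
      is_spectral_law p (distribution (P n) (theta n)))
    (d' : measure_display) (T' : measurableType d') (P' : probability T' R)
    (N1 N2 : {RV P' >-> R})
    (hN1 : is_normal 0 1 N1) (hN2 : is_normal 0 1 N2)
    (hN12 : independent_RVs N1 N2) :
  cvg_in_law P
    (fun n w => (log_Zp p (theta n w) - (p%:R * ln n%:R)%:C)
                / (Num.sqrt (ln n%:R))%:C)
    P' (fun w => ((Num.sqrt 2)^-1)%:C * (N1 w +i* N2 w)).
Proof.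
move=> f cf [M fM].
case: p hp theta htheta => // p _ theta htheta.
pose F x y := f (x +i* y); have cF : continuous2 F := continuous2_complex cf.
have FM x y : `|F x y| <= M by exact: fM.
pose Z n w := norm_log p.+1 n (theta n w).
pose X n w := complex.Re (Z n w); pose Y n w := complex.Im (Z n w).
pose r : R := (Num.sqrt 2)^-1.
pose X' w := r * N1 w; pose Y' w := r * N2 w.
have mX n : measurable_fun setT (X n).
  exact: (measurableT_comp (measurable_norm_log p.+1 n _).1 _).
have mY n : measurable_fun setT (Y n).
  exact: (measurableT_comp (measurable_norm_log p.+1 n _).2 _).
have mX' : measurable_fun setT X' by exact: measurable_funM.
have mY' : measurable_fun setT Y' by exact: measurable_funM.
have eX : (fun n => 'E_(P n)[f \o (fun w => norm_log p.+1 n (theta n w))])%E = (fun n => (\int[P n]_w F (X n w) (Y n w))%:E).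
  apply/funext => n; rewrite -(@expectation_bounded _ _ _ _ _ M) //; last first.
    exact: measurable_continuous2 FM _ _.
  congr expectation; apply/funext => w; rewrite /F /X /Y /Z /=.
  by congr f; case: (norm_log _ _ _).
have eY : 'E_P'[f \o (fun w => (r%:C * (N1 w +i* N2 w))%R)]%E =
   (\int[P']_w F (X' w) (Y' w))%:E.
  rewrite -(@expectation_bounded _ _ _ _ _ M) //; last first.
    exact: measurable_continuous2 FM _ _.
  congr expectation; apply/funext => w; rewrite /F /X' /Y' /=.
  by congr f; apply: complex_ext; rewrite /= !mul0r ?subr0 ?addr0.
rewrite [X in X @ _ --> _]eX [X in _ --> X]eY; apply: cvg_EFin; first by apply: nearW.
apply: (levy_continuity mX mY mX' mY' _ (cint_expi_normal hN1) _ cF FM) => // s t.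
(* The scaling r^2 = 1/2 turns the variances 1 into 1/2, hence the 4. *)
have -> : cint P' (fun w => expi (s * X' w + t * Y' w)) = (expR (- (s ^+ 2 + t ^+ 2) / 4))%:C.
  rewrite (eq_cint _ (h := fun w => expi ((s * r) * N1 w) * expi ((t * r) * N2 w))); last first.
    by move=> w; rewrite -expiD; congr expi; rewrite /X' /Y'; ring.
  have be (a : R) : bmeas (fun x : R => expi (a * x)).
    by apply: bmeas_expi; exact: measurable_funM.
  rewrite (cint_independent hN12 (be _) (be _)) !cint_expi_normal// -rmorphM -expRD.
  congr ((expR _)%:C); rewrite !exprMn.
  have -> : r ^+ 2 = 2^-1 by rewrite /r exprVn sqr_sqrtr.
  by field.
(* Positivity does not depend on n; it is taken from the smallest admissible size, where a single
   angle remains. *)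
have [K0 _] := @cint_fh_char_prod _ p _ (distribution (P p.+2) (theta p.+2)) 0 0
  (htheta p.+2 (ltnSn _)) ltac:(by rewrite subn_gt0) ltac:(by rewrite normr0 ler01).
have c0 (c : R) : c * rsln n @[n --> \oo] --> (0 : R).
  by rewrite -[X in _ --> X](mulr0 c); apply: cvgM; [exact: cvg_cst|exact: cvg_rsln].
have e1 : ccvg (fun n => expi (s * ln p.+1`!%:R * rsln n)) (1 : R[i]).
  have -> : (1 : R[i]) = cexp (0 +i* 0) by rewrite cexp_im expi0.
  under eq_fun do rewrite -cexp_im.
  by apply: ccvg_cexp; split; [exact: cvg_cst|exact: c0].
have := ccvgM e1 (ccvg_fh_ratio_ln s t K0); rewrite mul1r; apply: near_eq_ccvg.
(* Keeps the denominators i + 1 + a and i + 1 + b away from 0; this holds for large n, which is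
   enough for the limit. *)
have te : \forall n \near \oo, `|t * rsln n| <= 1.
  have : \forall n \near \oo, `|t| * rsln n < 1 by exact: cvgr_lt (c0 `|t|) _ ltr01.
  apply: filterS => n.
  by rewrite normrM (ger0_norm (rsln_ge0 n)) => /ltW.
have tn : \forall n \near \oo, (p.+1 < n)%N by exists p.+2.
apply: filterS2 te tn => n tr pn.
rewrite [RHS](eq_cint _ (h := fun w => (expi (s * ln p.+1`!%:R * rsln n) *
    expi (- (p.+1%:R * s * Num.sqrt (ln n%:R)))) *
  \prod_k fh_char (s * rsln n) (t * rsln n) (tnth (theta n w) k))); last first.
  by move=> w; exact: expi_norm_log.
have bp : bmeas (fun th : (n - p.+1).-tuple R =>
    \prod_k fh_char (s * rsln n) (t * rsln n) (tnth th k)).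
  by apply: bmeas_prod => k; exact: (bmeas_comp (bmeas_fh_char _ _) (@measurable_tnth _ _ _ k)).
rewrite cintZ; last exact: (bmeas_comp bp _).
rewrite -(cint_distribution (P n) (theta n) bp) mulrA; congr (_ * _); apply: esym.
by apply: (cint_fh_char_prod _ (htheta n pn) _ tr).2; rewrite subn_gt0.
Qed.
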